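(* The pointwise stabilizer of $C_0$ in $G_{\mathbb{F}}$ is $$B_{\mathbb{F}}(O)=U_{\mathbb{F}}(O)A_{\mathbb{F}}(O)M_{\mathbb{F}}.$$
   Context: Let $\mathbb{K},\mathbb{F}$ be real closed fields with $\mathbb{K}\subseteq\mathbb{R}\cap\mathbb{F}$. Let $O\subsetneq\mathbb{F}$ be an order convex subring ($a,b\in O$ and $a\le c\le b$ imply $c\in O$); it is a valuation ring. Let $\Lambda=\mathbb{F}^\times/O^\times$, written additively, and let $v:\mathbb{F}\to\Lambda\cup\{\infty\}$ be the associated valuation, with $\Lambda$ ordered so that $(-v)(a)\ge(-v)(b)$ whenever $a\ge b>0$; thus $O=\{a:(-v)(a)\le 0\}$. For a semialgebraic set $V$ defined over $\mathbb{K}$, $V_{\mathbb{F}}$ denotes its $\mathbb{F}$-extension. $G<\operatorname{SL}_n$ is a connected semisimple algebraic group over $\mathbb{K}$, self-adjoint ($g\in G$ implies $g^{\mathsf T}\in G$). $S<G$ is a maximal $\mathbb{K}$-split torus with $s=s^{\mathsf T}$ for all $s\in S$; $A_{\mathbb{F}}$ is the $\mathbb{F}$-extension of the semialgebraic connected component of $S_{\mathbb{K}}$ containing $\operatorname{Id}$; $K_{\mathbb{F}}=G_{\mathbb{F}}\cap\operatorname{SO}_n(\mathbb{F})$; $M_{\mathbb{F}}=\operatorname{Cen}_{K_{\mathbb{F}}}(A_{\mathbb{F}})$. Let $\mathfrak{g}=\operatorname{Lie}(G_{\mathbb{R}})$, $\mathfrak{a}=\operatorname{Lie}(A_{\mathbb{R}})$;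 $\Sigma\subseteq\mathfrak{a}^\star$ is the (possibly non-reduced) root system of $\mathfrak{g}$ with respect to $\mathfrak{a}$, with root spaces $\mathfrak{g}_\alpha$. For $\alpha\in\Sigma$, $\chi_\alpha:A_{\mathbb{F}}\to\mathbb{F}_{>0}$ is the restriction of the algebraic character of $S$ over $\mathbb{K}$ which over $\mathbb{R}$ satisfies $\chi_\alpha(\exp H)=e^{\alpha(H)}$, $H\in\mathfrak{a}$. Fix a basis $\Delta$ of $\Sigma$ with positive roots $\Sigma_{>0}$; let $A^+_{\mathbb{F}}=\{a\in A_{\mathbb{F}}:\chi_\alpha(a)\ge1\ \forall\alpha\in\Delta\}$, $U_{\mathbb{F}}=\exp(\bigoplus_{\alpha\in\Sigma_{>0}}(\mathfrak{g}_\alpha)_{\mathbb{F}})$, $B_{\mathbb{F}}=U_{\mathbb{F}}A_{\mathbb{F}}M_{\mathbb{F}}$. For a subset $H_{\mathbb{F}}\subseteq G_{\mathbb{F}}$, $H_{\mathbb{F}}(O)=H_{\mathbb{F}}\cap O^{n\times n}$. $G_{\mathbb{F}}$ acts on symmetric positive definite matrices of determinant $1$ over $\mathbb{F}$ by $g.x=gxg^{\mathsf T}$, and $\mathcal{X}_{\mathbb{F}}=G_{\mathbb{F}}.\operatorname{Id}$. For $x=g.\operatorname{Id}$, $y=h.\operatorname{Id}$, $\delta_{\mathbb{F}}(x,y)$ is the unique $a\in A^+_{\mathbb{F}}$ with $g^{-1}h\in K_{\mathbb{F}}aK_{\mathbb{F}}$. For $a\in A_{\mathbb{F}}$, $N_{\mathbb{F}}(a)=\prod_{\alpha\in\Sigma}\max\{\chi_\alpha(a),\chi_\alpha(a)^{-1}\}$,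 and $d(x,y)=(-v)(N_{\mathbb{F}}(\delta_{\mathbb{F}}(x,y)))\in\Lambda$, a $G_{\mathbb{F}}$-invariant pseudo-distance. $\mathcal{B}=\mathcal{X}_{\mathbb{F}}/\!\sim$ with $x\sim y$ iff $d(x,y)=0$, with the induced $G_{\mathbb{F}}$-action; $o\in\mathcal{B}$ is the class of $\operatorname{Id}$; $\mathbb{A}=A_{\mathbb{F}}.o\subseteq\mathcal{B}$. The fundamental Weyl chamber is $C_0=\{a.o\in\mathbb{A}:(-v)(\chi_\alpha(a))\ge0\text{ for all }\alpha\in\Sigma_{>0}\}$. *)

(* Defs.v *)
From HB Require Import structures.
From mathcomp Require Import all_boot all_order all_algebra.
(* [mpoly] is not imported: its notations clash with those of
   MathComp-Analysis. *)
From mathcomp Require mpoly.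
From mathcomp Require Import complex.
From mathcomp Require Import boolp classical_sets functions cardinality.
From mathcomp Require Import fsbigop reals topology normedtype sequences exp.
Import numFieldNormedType.Exports.
Import Order.TTheory GRing.Theory Num.Theory.

Set Implicit Arguments.
Unset Strict Implicit.
Unset Printing Implicit Defensive.

Local Open Scope classical_set_scope.
Local Open Scope ring_scope.

(* Polynomials in the entries of an n x n matrix; the variables are the
   entries in the order of [mxvec]. *)
Definition mxpoly (K : nzRingType) (n : nat) := mpoly.mpoly (n * n) K.

Definition mxeval (K L : nzRingType) (i : K -> L) n (p : mxpoly K n)
    (x : 'M[L]_n) : L :=
  mpoly.mmap i (fun k => mxvec x 0 k) p.

Definition points (K L : nzRingType) (i : K -> L) n (P : set (mxpoly K n)) :
    set 'M[L]_n :=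
  [set x | forall p, P p -> mxeval i p x = 0].

Definition zariski_closed (D : fieldType) n (X : set 'M[D]_n) :=
  exists P : set (mxpoly D n), X = points idfun P.

Definition zariski_connected (D : fieldType) n (X : set 'M[D]_n) :=
  forall Y Z : set 'M[D]_n, zariski_closed Y -> zariski_closed Z ->
  Y `|` Z = X -> Y `&` Z = set0 -> Y = set0 \/ Z = set0.

Definition mxset_mul (L : nzRingType) n (X Y : set 'M[L]_n) : set 'M[L]_n :=
  [set x *m y | x in X & y in Y].

Definition mx_group (L : fieldType) n (X : set 'M[L]_n) :=
  [/\ X `<=` [set x | x \in unitmx], X 1%:M,
      forall x y, X x -> X y -> X (x *m y)
    & forall x, X x -> X (invmx x)].

Definition generated_group (L : fieldType) n (X : set 'M[L]_n) : set 'M[L]_n :=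
  [set x | forall Y, mx_group Y -> X `<=` Y -> Y x].

Definition derived_group (L : fieldType) n (X : set 'M[L]_n) : set 'M[L]_n :=
  generated_group [set invmx x *m invmx y *m x *m y | x in X & y in X].

Definition solvable_group (L : fieldType) n (X : set 'M[L]_n) :=
  exists k, iter k (@derived_group L n) X = [set 1%:M].

Definition normal_in (L : fieldType) n (N X : set 'M[L]_n) :=
  N `<=` X /\ forall x y, X x -> N y -> N (x *m y *m invmx x).

(* The radical of X is trivial. *)
Definition semisimple_group (D : fieldType) n (X : set 'M[D]_n) :=
  forall N : set 'M[D]_n, zariski_closed N -> zariski_connected N ->
  mx_group N -> normal_in N X -> solvable_group N -> N = [set 1%:M].

(* Algebraic groups are identified with their points over the algebraic closure
   K[i] of K; as K is perfect, those defined over K are those which are the zero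
   set of polynomials over K. *)

Definition geom_points (K : rcfType) n (P : set (mxpoly K n)) :
    set 'M[K[i]]_n :=
  points (real_complex K) P.

Definition connected_semisimple_subgroup_of_SL (K : rcfType) n
    (G : set (mxpoly K n)) :=
  [/\ mx_group (geom_points G),
      geom_points G `<=` [set x | \det x = 1],
      zariski_connected (geom_points G)
    & semisimple_group (geom_points G)].

Definition self_adjoint (K : rcfType) n (G : set (mxpoly K n)) :=
  forall x, geom_points G x -> geom_points G x^T.

Definition split_torus (K : rcfType) n (T : set (mxpoly K n)) :=
  [/\ mx_group (geom_points T),
      zariski_connected (geom_points T)
    & exists2 P : 'M[K]_n, P \in unitmx &
      let Q := map_mx (real_complex K) P in
      forall t, geom_points T t -> is_diag_mx (Q *m t *m invmx Q)].

Definition maximal_split_torus (K : rcfType) n (G S : set (mxpoly K n)) :=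
  [/\ split_torus S, geom_points S `<=` geom_points G
    & forall T, split_torus T -> geom_points T `<=` geom_points G ->
      geom_points S `<=` geom_points T -> geom_points T = geom_points S].

Definition algebraic_character (K : rcfType) n (S : set (mxpoly K n))
    (p : mxpoly K n) :=
  mxeval (real_complex K) p 1%:M = 1 /\
  forall s t, geom_points S s -> geom_points S t ->
    mxeval (real_complex K) p (s *m t) =
    mxeval (real_complex K) p s * mxeval (real_complex K) p t.

(* A finite union of sets given by finitely many equations (first component)
   and strict inequalities (second component). *)
Definition sa_description (K : rcfType) n :=
  seq (seq (mxpoly K n) * seq (mxpoly K n)).

Definition sa_points (K L : rcfType) (i : K -> L) n (phi : sa_description K n) :
    set 'M[L]_n :=
  [set x | has (fun b => all (fun p => mxeval i p x == 0) b.1 &&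
                         all (fun p => 0 < mxeval i p x) b.2) phi].

Definition semialgebraic (K : rcfType) n (X : set 'M[K]_n) :=
  exists phi : sa_description K n, X = sa_points idfun phi.

(* The L2-extension of a semialgebraic subset V of 'M[L1]_n defined over K. By
   the transfer principle, the choice of phi does not matter. *)
Definition sa_extension (K L1 L2 : rcfType) (i1 : K -> L1) (i2 : K -> L2) n
    (V : set 'M[L1]_n) : set 'M[L2]_n :=
  [set x | exists2 phi : sa_description K n,
             V = sa_points i1 phi & sa_points i2 phi x].

Definition closed_in (K : rcfType) n (A X : set 'M[K]_n) :=
  exists2 Z : set 'M[K]_n, closed Z & A = X `&` Z.

Definition sa_connected (K : rcfType) n (X : set 'M[K]_n) :=
  forall A B : set 'M[K]_n, semialgebraic A -> semialgebraic B ->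
  closed_in A X -> closed_in B X -> A `|` B = X -> A `&` B = set0 ->
  A = X \/ B = X.

Definition sa_component (K : rcfType) n (X : set 'M[K]_n) (x : 'M[K]_n) :
    set 'M[K]_n :=
  [set y | exists C : set 'M[K]_n,
     [/\ semialgebraic C, sa_connected C, C `<=` X, C x & C y]].

(* A_L, for an extension L of K. *)
Definition split_component (K L : rcfType) (i : K -> L) n
    (S : set (mxpoly K n)) : set 'M[L]_n :=
  sa_extension idfun i (sa_component (points idfun S) 1%:M).

Definition expmx (R : realType) n (X : 'M[R]_n) : 'M[R]_n :=
  limn (series (fun k => (k`!%:R)^-1 *: X ^+ k)).

Definition is_Lie_algebra (R : realType) n (H : set 'M[R]_n)
    (l : {vspace 'M[R]_n}) :=
  forall X, X \in l <-> forall t : R, H (expmx (t *: X)).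

Definition dual (R : realType) n (a : {vspace 'M[R]_n}) :=
  'Hom(subvs_of a, R^o).

Definition root_space (R : realType) n (g a : {vspace 'M[R]_n})
    (alpha : dual a) : set 'M[R]_n :=
  [set X | X \in g /\ forall H : subvs_of a,
             vsval H *m X - X *m vsval H = (alpha H : R) *: X].

Definition roots (R : realType) n (g a : {vspace 'M[R]_n}) : set (dual a) :=
  [set alpha | alpha != 0 /\ exists2 X, X != 0 & root_space g alpha X].

Definition nonneg_combination (R : realType) n (a : {vspace 'M[R]_n})
    (Delta : seq (dual a)) (alpha : dual a) :=
  exists c : dual a -> nat, alpha = \sum_(beta <- Delta) beta *+ c beta.

Definition root_basis (R : realType) n (g a : {vspace 'M[R]_n})
    (Delta : seq (dual a)) :=
  [/\ forall alpha, alpha \in Delta -> roots g alpha,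
      basis_of {:dual a} Delta
    & forall alpha, roots g alpha ->
      nonneg_combination Delta alpha \/ nonneg_combination Delta (- alpha)].

Definition pos_roots (R : realType) n (g a : {vspace 'M[R]_n})
    (Delta : seq (dual a)) : set (dual a) :=
  [set alpha | roots g alpha /\ nonneg_combination Delta alpha].

(* chi alpha is a polynomial over K inducing on S the algebraic character whose
   differential is the root alpha. *)
Definition root_characters (K : rcfType) (R : realType) (iR : K -> R) n
    (S : set (mxpoly K n)) (g a : {vspace 'M[R]_n})
    (chi : dual a -> mxpoly K n) :=
  forall alpha, roots g alpha ->
    algebraic_character S (chi alpha) /\
    forall H : subvs_of a,
      mxeval iR (chi alpha) (expmx (vsval H)) = expR (alpha H).

Definition order_convex (F : rcfType) (O : {pred F}) :=
  forall a b c, a \in O -> b \in O -> a <= c -> c <= b -> c \in O.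

Section Valuation.
Variables (F : rcfType) (O : {pred F}).

Definition integral_units : set F := [set u | [/\ u != 0, u \in O & u^-1 \in O]].

(* The elements of Lambda are represented by the corresponding cosets in F of
   the group of units of O; infinity is represented by {0}, the coset of 0. *)
Definition valuation (a : F) : set F := [set a * u | u in integral_units].

(* (-v)(a), for a != 0. *)
Definition oppval (a : F) : set F := valuation a^-1.

Definition Lambda0 : set F := valuation 1.

(* v(a) <= v(b) iff b / a is in O; hence (-v)(a) >= (-v)(b) if a >= b > 0. *)
Definition Lambda_le (s t : set F) :=
  exists a b : F, [/\ a != 0, b != 0, s = valuation a, t = valuation b & b / a \in O].

Definition integral_mx n : set 'M[F]_n := [set x | forall i j, x i j \in O].

End Valuation.

Section Building.
Variables (K F : rcfType) (R : realType) (iR : K -> R) (iF : K -> F).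
Variables (O : {pred F}) (n : nat) (G S : set (mxpoly K n)).
Variables (g a : {vspace 'M[R]_n}) (Delta : seq (dual a)).
Variable chi : dual a -> mxpoly K n.

Definition G_F : set 'M[F]_n := points iF G.
Definition A_F : set 'M[F]_n := split_component iF S.
Definition K_F : set 'M[F]_n :=
  G_F `&` [set k | k *m k^T = 1%:M /\ \det k = 1].
Definition M_F : set 'M[F]_n :=
  K_F `&` [set k | forall b, A_F b -> k *m b = b *m k].

Definition root_space_F (alpha : dual a) : set 'M[F]_n :=
  sa_extension iR iF (root_space g alpha).

Definition pos_root_sum_F : set 'M[F]_n :=
  [set X | exists2 Y : dual a -> 'M[F]_n,
     (forall alpha, pos_roots g Delta alpha ->
        root_space_F alpha (Y alpha)) &
     X = \sum_(alpha \in pos_roots g Delta) Y alpha].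

(* The exponential of a nilpotent n x n matrix. *)
Definition expmx_nilpotent (X : 'M[F]_n) : 'M[F]_n :=
  \sum_(k < n) (k`!%:R)^-1 *: X ^+ k.

Definition U_F : set 'M[F]_n := [set expmx_nilpotent X | X in pos_root_sum_F].
Definition B_F : set 'M[F]_n := mxset_mul (mxset_mul U_F A_F) M_F.

Definition chi_F (alpha : dual a) (b : 'M[F]_n) : F := mxeval iF (chi alpha) b.

Definition A_F_plus : set 'M[F]_n :=
  A_F `&` [set b | forall alpha, alpha \in Delta -> 1 <= chi_F alpha b].

Definition X_F : set 'M[F]_n := [set h *m h^T | h in G_F].

Definition delta_F (x y : 'M[F]_n) : 'M[F]_n :=
  xget 1%:M [set b | A_F_plus b /\
    exists h1 h2 : 'M[F]_n, [/\ G_F h1, G_F h2,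
      x = h1 *m h1^T, y = h2 *m h2^T &
      mxset_mul (mxset_mul K_F [set b]) K_F (invmx h1 *m h2)]].

Definition N_F (b : 'M[F]_n) : F :=
  \big[*%R/1]_(alpha \in roots g (a := a))
    Num.max (chi_F alpha b) (chi_F alpha b)^-1.

Definition dist (x y : 'M[F]_n) : set F := oppval O (N_F (delta_F x y)).

(* Points of the building are the equivalence classes, as subsets of X_F. *)
Definition building_class (x : 'M[F]_n) : set 'M[F]_n :=
  X_F `&` [set y | dist x y = Lambda0 O].

Definition building : set (set 'M[F]_n) := building_class @` X_F.

Definition building_act (h : 'M[F]_n) (c : set 'M[F]_n) : set 'M[F]_n :=
  [set h *m x *m h^T | x in c].

Definition building_o : set 'M[F]_n := building_class 1%:M.

Definition Weyl_chamber0 : set (set 'M[F]_n) :=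
  [set building_act b building_o | b in
    A_F `&` [set b | forall alpha, pos_roots g Delta alpha ->
                       Lambda_le O (Lambda0 O) (oppval O (chi_F alpha b))]].

Definition pointwise_stabilizer (C : set (set 'M[F]_n)) : set 'M[F]_n :=
  G_F `&` [set h | forall c, C c -> building_act h c = c].

End Building.

(* Main.v *)
(* Quantifier elimination commutes with extending the coefficients, so a
   first-order property of the L-points of G and S with parameters in K holds
   for all real closed extensions L of K as soon as it holds for one of them: it
   is enough to prove it for L = K or L = R to have it for L = F.

   In an eigenbasis of S defined over K, A consists of the points of S with
   positive weights, and b^-1 h b has entries h_kl w_l(b) / w_k(b) for b in A.
   Maximality of S enters through one fact: if x is in G and x x^T centralizes
   A, then x x^T is in A, since S and x x^T generate a split torus.

   Cartan decomposition over R: for h h^T = exp X, let k maximize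
   tr(k X k^T H0) on the maximal compact subgroup, for H0 in the open chamber.
   The first order condition says that k X k^T centralizes a, hence lies in a,
   and the second order condition says that it is dominant. Over F it follows
   that the class o consists of the integral points of X_F, and that h
   stabilizes C0 pointwise iff b^-1 h b is integral for all b in the chamber.

   The (k, l) entry of such an h vanishes unless w_k = w_l or w_k > w_l at H0,
   as w_l / w_k is otherwise unbounded on the chamber while O is a proper convex
   subring: h is block triangular. Over R the block diagonal
   part of a block triangular h is the limit of exp(-s H0) h exp(s H0), hence it
   is in G; its polar decomposition is in A M, and the remaining unipotent
   factor is the exponential of its logarithm, which is a sum of positive root
   vectors. Since h = u a m is triangular up to the orthogonal factor m, u and a
   are integral when h is. *)

(* Exponentials, limits and compactness are available over R only, and O lives over F. So every
   analytic object is replaced by a first order one before it is transferred: A by positivity of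
   weights, membership of a nilpotent X in the Lie algebra by exp(tX) in G for all t, with exp a
   polynomial, and real powers of characters by integral bounds c^N. As G and S may be given by
   infinitely many equations, Hilbert's basis theorem comes first.

   Maximality is a statement over K[i], which is not real closed; it is exploited over K. There the
   difficulty is that the enlarged torus must be Zariski connected: along the powers of a positive
   element, polynomials become sums of geometric progressions with positive ratios, which have no
   zero divisors. A second difficulty is that x x^T commutes with A only, whereas the new torus
   contains S: weights of S that agree on A have to agree on S.

   K lies in O, because its elements are bounded by natural numbers as soon as K embeds in R.
   Integrality can therefore be tested in the eigenbasis, although that basis is not orthonormal. *)
From HB Require Import structures.
Require Import Defs.
From mathcomp Require Import all_boot all_order all_algebra sesquilinear spectral.
From mathcomp Require mpoly.
From mathcomp Require qe_rcf_th qe_rcf.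
From mathcomp Require Import boolp.

Set Implicit Arguments.
Unset Strict Implicit.
Unset Printing Implicit Defensive.

Import Order.TTheory GRing.Theory Num.Theory.
Local Open Scope ring_scope.

(* The notations of [qe_rcf] hide [True] and [False]. *)
Module Elementarity.
Import qe_rcf_th qe_rcf.

(** * Quantifier elimination commutes with field morphisms *)

Section QEMap.
Variables (K L : rcfType) (i : {rmorphism K -> L}).

Fixpoint map_term (t : term K) : term L :=
  match t with
  | Var n => Var _ n
  | Const x => Const (i x)
  | NatConst n => NatConst _ n
  | Add u v => Add (map_term u) (map_term v)
  | Opp u => Opp (map_term u)
  | NatMul u n => NatMul (map_term u) n
  | Mul u v => Mul (map_term u) (map_term v)
  | Exp u n => Exp (map_term u) n
  end.

Fixpoint map_formula (f : formula K) : formula L :=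
  match f with
  | Bool b => Bool b
  | Equal x y => Equal (map_term x) (map_term y)
  | qe_rcf.Lt x y => qe_rcf.Lt (map_term x) (map_term y)
  | qe_rcf.Le x y => qe_rcf.Le (map_term x) (map_term y)
  | And f g => And (map_formula f) (map_formula g)
  | Or f g => Or (map_formula f) (map_formula g)
  | Implies f g => Implies (map_formula f) (map_formula g)
  | Not f => Not (map_formula f)
  end.

Notation mt := map_term.
Notation mp := (map map_term).
Notation mf := map_formula.

(** [qe_rcf] is written in continuation passing style: an algorithm hands its result to a
    continuation that builds the rest of the formula. Hence the shape of the lemmas below: if the
    continuations correspond under the morphism, so do the formulas. *)
Lemma map_Size p k k' : (forall n, mf (k n) = k' n) ->
  mf (Size p k) = Size (mp p) k'.
Proof.
elim: p k k' => [|c p IHp] k k' kk' //=.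
by apply: IHp => -[|n] //=; rewrite !kk'.
Qed.

Lemma map_Isnull p k k' : (forall n, mf (k n) = k' n) ->
  mf (Isnull p k) = Isnull (mp p) k'.
Proof. by move=> kk'; apply: map_Size => n. Qed.

Lemma map_LtSize p q k k' : (forall n, mf (k n) = k' n) ->
  mf (LtSize p q k) = LtSize (mp p) (mp q) k'.
Proof. by move=> kk'; apply: map_Size => n; apply: map_Size. Qed.

Lemma map_LeadCoef p k k' : (forall x, mf (k x) = k' (mt x)) ->
  mf (LeadCoef p k) = LeadCoef (mp p) k'.
Proof.
elim: p k k' => [|c p IHp] k k' kk' //=; first by rewrite kk' /= rmorph0.
by apply: IHp => x /=; rewrite !kk'.
Qed.

Lemma map_AmulXn a n : mp (AmulXn a n) = AmulXn (mt a) n.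
Proof. by elim: n => //= n ->; rewrite rmorph0. Qed.

Lemma map_AddPoly p q : mp (AddPoly p q) = AddPoly (mp p) (mp q).
Proof. by elim: p q => [|a p IHp] [|b q] //=; rewrite IHp. Qed.

Lemma map_ScalPoly c p : mp (ScalPoly c p) = ScalPoly (mt c) (mp p).
Proof. by rewrite /ScalPoly -!map_comp; apply: eq_map. Qed.

Lemma map_MulPoly p q : mp (MulPoly p q) = MulPoly (mp p) (mp q).
Proof. by elim: p => [|a p IHp] //=; rewrite map_AddPoly map_ScalPoly /= IHp. Qed.

Lemma map_ExpPoly p n : mp (ExpPoly p n) = ExpPoly (mp p) n.
Proof.
case: n => [|n] //; rewrite /ExpPoly !iteropS.
by elim: n => //= n IHn; rewrite map_MulPoly IHn.
Qed.

Lemma map_OppPoly p : mp (OppPoly p) = OppPoly (mp p).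
Proof. by rewrite map_ScalPoly /= rmorphN1. Qed.

Lemma map_NatMulPoly n p : mp (NatMulPoly n p) = NatMulPoly n (mp p).
Proof. exact: map_ScalPoly. Qed.

Lemma map_Deriv p : mp (Deriv p) = Deriv (mp p).
Proof. by elim: p => //= a p IHp; rewrite map_AddPoly /= IHp. Qed.

Definition map_OpPoly := (map_MulPoly, map_AmulXn, map_AddPoly, map_OppPoly,
  map_NatMulPoly, map_ExpPoly, map_Deriv, map_ScalPoly).

Lemma map_Rediv_rec_loop q sq cq c qq r n k k' :
  (forall c qq r, mf (k (c, qq, r)) = k' (c, mp qq, mp r)) ->
  mf (Rediv_rec_loop q sq cq c qq r n k) =
  Rediv_rec_loop (mp q) sq (mt cq) c (mp qq) (mp r) n k'.
Proof.
move=> kk'; elim: n c qq r => [|n IHn] c qq r /=;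
  apply: map_Size => sr; case: ifP => _ //; apply: map_LeadCoef => lr;
  by rewrite ?IHn ?kk' !map_OpPoly.
Qed.

Lemma map_Rediv p q k k' :
  (forall c qq r, mf (k (c, qq, r)) = k' (c, mp qq, mp r)) ->
  mf (Rediv p q k) = Rediv (mp p) (mp q) k'.
Proof.
move=> kk'; apply: map_Isnull => -[]; first by rewrite kk' /= rmorph0.
apply: map_Size => sq; apply: map_Size => sp; apply: map_LeadCoef => lq.
by rewrite (map_Rediv_rec_loop _ _ _ _ _ _ _ kk') /= rmorph0.
Qed.

Lemma map_Rmod p q k k' : (forall r, mf (k r) = k' (mp r)) ->
  mf (Rmod p q k) = Rmod (mp p) (mp q) k'.
Proof. by move=> kk'; apply: map_Rediv. Qed.

Lemma map_Rscal p q k k' : (forall r, mf (k r) = k' r) ->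
  mf (Rscal p q k) = Rscal (mp p) (mp q) k'.
Proof. by move=> kk'; apply: map_Rediv. Qed.

Lemma map_Rgcd_loop n p q k k' : (forall r, mf (k r) = k' (mp r)) ->
  mf (Rgcd_loop n p q k) = Rgcd_loop n (mp p) (mp q) k'.
Proof.
move=> kk'; elim: n p q => [|n IHn] p q /=;
  by apply: map_Rmod => r; apply: map_Isnull => -[] //.
Qed.

Lemma map_Rgcd p q k k' : (forall r, mf (k r) = k' (mp r)) ->
  mf (Rgcd p q k) = Rgcd (mp p) (mp q) k'.
Proof.
move=> kk'; apply: map_LtSize => -[]; apply: map_Isnull => -[] //;
  by apply: map_Size => n; apply: map_Rgcd_loop.
Qed.

Lemma map_BigRgcd ps k k' : (forall r, mf (k r) = k' (mp r)) ->
  mf (BigRgcd ps k) = BigRgcd (map mp ps) k'.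
Proof.
elim: ps k k' => [|p ps IHps] k k' kk' /=; first by rewrite kk' /= rmorph0.
by apply: IHps => r; apply: map_Rgcd.
Qed.

Lemma map_Changes s k k' : (forall n, mf (k n) = k' n) ->
  mf (Changes s k) = Changes (mp s) k'.
Proof.
elim: s k k' => [|a s IHs] k k' kk' //=; apply: IHs => n /=.
by rewrite !kk'; case: s => //=; rewrite rmorph0.
Qed.

Lemma map_SeqPInfty ps k k' : (forall r, mf (k r) = k' (mp r)) ->
  mf (SeqPInfty ps k) = SeqPInfty (map mp ps) k'.
Proof.
elim: ps k k' => [|p ps IHps] k k' kk' //=; apply: map_LeadCoef => x.
by apply: IHps => y; rewrite kk'.
Qed.

Lemma map_SeqMInfty ps k k' : (forall r, mf (k r) = k' (mp r)) ->
  mf (SeqMInfty ps k) = SeqMInfty (map mp ps) k'.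
Proof.
elim: ps k k' => [|p ps IHps] k k' kk' //=; apply: map_LeadCoef => x.
by apply: map_Size => n; apply: IHps => y; rewrite kk' /= rmorphN1.
Qed.

Lemma map_ChangesPoly ps k k' : (forall n, mf (k n) = k' n) ->
  mf (ChangesPoly ps k) = ChangesPoly (map mp ps) k'.
Proof.
move=> kk'; apply: map_SeqMInfty => mps; apply: map_SeqPInfty => pps.
by apply: map_Changes => vm; apply: map_Changes => vp; apply: kk'.
Qed.

Lemma map_NextMod p q k k' : (forall r, mf (k r) = k' (mp r)) ->
  mf (NextMod p q k) = NextMod (mp p) (mp q) k'.
Proof.
move=> kk'; apply: map_LeadCoef => lq; apply: map_Rscal => spq.
by apply: map_Rmod => mpq; rewrite kk' !map_OpPoly.
Qed.

Lemma map_ModsAux p q n k k' : (forall r, mf (k r) = k' (map mp r)) ->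
  mf (ModsAux p q n k) = ModsAux (mp p) (mp q) n k'.
Proof.
elim: n p q k k' => [|n IHn] p q k k' kk' //=.
apply: map_Isnull => -[]; first exact: (kk' [::]).
by apply: map_NextMod => npq; apply: IHn => r; rewrite kk'.
Qed.

Lemma map_Mods p q k k' : (forall r, mf (k r) = k' (map mp r)) ->
  mf (Mods p q k) = Mods (mp p) (mp q) k'.
Proof.
by move=> kk'; apply: map_Size => sp; apply: map_Size => sq; apply: map_ModsAux.
Qed.

Lemma map_PolyComb sq sc : mp (PolyComb sq sc) = PolyComb (map mp sq) sc.
Proof.
rewrite /PolyComb size_map; elim: (iota _ _) => //= a s IHs.
rewrite map_MulPoly map_ExpPoly IHs; congr (MulPoly (ExpPoly _ _) _).
by elim: sq a {IHs} => [|q sq IHq] [|a] //=.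
Qed.

Lemma map_Pcq sq j : mp (Pcq sq j) = Pcq (map mp sq) j.
Proof.
rewrite /Pcq size_map; elim: (sg_tab _) j => [|a s IHs] [|j] //=.
exact: map_PolyComb.
Qed.

Lemma map_TaqR p q k k' : (forall n, mf (k n) = k' n) ->
  mf (TaqR p q k) = TaqR (mp p) (mp q) k'.
Proof.
move=> kk'; rewrite /TaqR -map_Deriv -map_MulPoly.
by apply: map_Mods => r; apply: map_ChangesPoly.
Qed.

Lemma map_TaqsR p sq j k k' : (forall r, mf (k r) = k' (mt r)) ->
  mf (TaqsR p sq j k) = TaqsR (mp p) (map mp sq) j k'.
Proof.
move=> kk'; rewrite /TaqsR -map_Pcq; apply: map_TaqR => n.
by rewrite /= kk' /= rmorph_int.
Qed.

(** These coefficients are entries of the inverse of an integer matrix, hence rational numbers,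
    which every field morphism preserves. *)
Lemma rmorph_coefs n j : i (coefs K n j) = coefs L n j.
Proof.
rewrite /coefs; set f := fun k => _; set g := fun k => _.
have fg k : i (f k) = g k.
  have me a b (M : 'M[K]_(a, b)) k1 k2 : i (M k1 k2) = map_mx i M k1 k2 by rewrite mxE.
  rewrite /f /g me.
  rewrite map_castmx map_invmx -map_mx_comp; congr (castmx _ (invmx _) _ _).
  by apply/matrixP => a b; rewrite !mxE /= rmorph_int.
by elim: (enum _) j => [|a s IHs] [|j] //=; rewrite rmorph0.
Qed.

Lemma map_BoundingPoly sq : mp (BoundingPoly sq) = BoundingPoly (map mp sq).
Proof.
by rewrite /BoundingPoly map_Deriv; congr Deriv; elim: sq => //= a s IHs;
  rewrite map_MulPoly IHs.
Qed.

Lemma map_Coefs n j : mt (Coefs K n j) = Coefs L n j.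
Proof.
rewrite /Coefs /=; congr Const.
case: n => [|[|n]]; first by rewrite rmorph_nat.
  by move: j => [|[|[|[|j]]]] //=; rewrite ?rmorph0 ?fmorphV ?rmorph_nat.
exact: rmorph_coefs.
Qed.

Lemma map_CcountWeak p sq k k' : (forall r, mf (k r) = k' (mt r)) ->
  mf (CcountWeak p sq k) = CcountWeak (mp p) (map mp sq) k'.
Proof.
(* The accumulator of the sum, initially 0, is generalized for the induction. *)
rewrite /CcountWeak size_map -[0%qfT in RHS]/(mt 0%qfT); move: 0%qfT => x.
elim: (3 ^ _)%N k k' x => [|n IHn] k k' x kk' /=; first exact: kk'.
by apply: map_TaqsR => y; rewrite -map_Coefs; apply: (IHn k k').
Qed.

Lemma map_CcountGt0 sp sq : mf (CcountGt0 sp sq) = CcountGt0 (map mp sp) (map mp sq).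
Proof.
apply: map_BigRgcd => p; apply: map_Isnull => -[] /=; last first.
  exact: map_CcountWeak.
rewrite -map_BoundingPoly; apply: map_CcountWeak => c /=.
congr (Or _ (Or _ _)).
  elim: sq => //= q sq ->; congr And.
  exact: map_LeadCoef.
elim: sq => //= q sq ->; congr And.
by apply: map_Size => n; apply: map_LeadCoef.
Qed.

Lemma map_abstrX j t : mp (abstrX j t) = abstrX j (mt t).
Proof.
elim: t => //=.
- by move=> n; case: eqP.
- by move=> t IHt u IHu; rewrite map_AddPoly IHt IHu.
- by move=> t IHt; rewrite map_OppPoly IHt.
- by move=> t IHt n; rewrite map_NatMulPoly IHt.
- by move=> t IHt u IHu; rewrite map_MulPoly IHt IHu.
- by move=> t IHt n; rewrite map_ExpPoly IHt.
Qed.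

End QEMap.

Lemma eq_iff (b c : bool) : b = c -> (b <-> c).
Proof. by move->. Qed.

(** The order is definable from the ring structure: the nonnegative elements are the squares. *)
Lemma rcf_morph_gt0 (K L : rcfType) (i : {rmorphism K -> L}) x :
  (0 < i x) = (0 < x).
Proof.
have ge0 y : 0 <= y -> 0 <= i y.
  by move=> y0; rewrite -(sqr_sqrtr y0) rmorphXn sqr_ge0.
have [x0|x0|->] := ltgtP x 0; last by rewrite rmorph0 ltxx.
  by apply/negbTE; rewrite -leNgt -oppr_ge0 -rmorphN ge0 // oppr_ge0 ltW.
by rewrite lt_def fmorph_eq0 gt_eqF //= ge0 // ltW.
Qed.

Lemma rcf_morph_ge0 (K L : rcfType) (i : {rmorphism K -> L}) x :
  (0 <= i x) = (0 <= x).
Proof. by rewrite [RHS]leNgt [LHS]leNgt -!oppr_gt0 -rmorphN rcf_morph_gt0. Qed.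

(** * Properties defined uniformly over all real closed extensions *)

Section Elementary.
Variable K : rcfType.
Implicit Types (L : rcfType) (t : term K).

Definition teval L (i : {rmorphism K -> L}) (e : seq L) (t : term K) : L :=
  eval e (map_term i t).

Definition dnf := seq (seq (term K) * seq (term K)).

Definition dnf_holds L (i : {rmorphism K -> L}) (e : seq L) (phi : dnf) :=
  has (fun c => all (fun t => teval i e t == 0) c.1 &&
                all (fun t => 0 < teval i e t) c.2) phi.

Definition family := forall L, {rmorphism K -> L} -> seq L -> Prop.

(** A single quantifier-free description with coefficients in [K] has to serve for all extensions
    and all values of the variables; transfer rests on this uniformity. *)
Definition elementary (D : family) :=
  exists phi, forall L (i : {rmorphism K -> L}) e, D L i e <-> dnf_holds i e phi.

Lemma elementary_ext (D E : family) :
  (forall L (i : {rmorphism K -> L}) e, D L i e <-> E L i e) ->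
  elementary D -> elementary E.
Proof.
by move=> DE [phi Dphi]; exists phi => L i e; rewrite -DE; apply: Dphi.
Qed.

Lemma elementary_true : elementary (fun _ _ _ => Logic.True).
Proof. by exists [:: ([::], [::])]. Qed.

Lemma elementary_false : elementary (fun _ _ _ => Logic.False).
Proof. by exists [::]. Qed.

Lemma elementary_cst (P : Prop) : elementary (fun _ _ _ => P).
Proof.
by have [p|np] := pselect P; [apply: elementary_ext elementary_true|
  apply: elementary_ext elementary_false].
Qed.

Lemma elementary_or D E : elementary D -> elementary E ->
  elementary (fun L i e => D L i e \/ E L i e).
Proof.
move=> [phi Dphi] [psi Epsi]; exists (phi ++ psi) => L i e.
by rewrite /dnf_holds has_cat Dphi Epsi; split=> /orP.
Qed.

Lemma elementary_and D E : elementary D -> elementary E ->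
  elementary (fun L i e => D L i e /\ E L i e).
Proof.
move=> [phi Dphi] [psi Epsi].
exists [seq (c.1 ++ d.1, c.2 ++ d.2) | c <- phi, d <- psi] => L i e.
rewrite Dphi Epsi (rwP andP); apply: eq_iff; rewrite /dnf_holds.
elim: phi {Dphi} => //= c phi IHphi; rewrite has_cat -{}IHphi has_map andb_orl.
congr orb; elim: psi {Epsi} => [|d psi IHpsi] /=; first by rewrite andbF.
by rewrite andb_orr IHpsi !all_cat andbACA.
Qed.

Definition pterm (f : forall L, {rmorphism K -> L} -> seq L -> L) :=
  exists t, forall L (i : {rmorphism K -> L}) e, f L i e = teval i e t.

Lemma pterm_ext f g : (forall L (i : {rmorphism K -> L}) e, f L i e = g L i e) ->
  pterm f -> pterm g.
Proof. by move=> fg [t ft]; exists t => L i e; rewrite -fg. Qed.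

Lemma pterm_cst c : pterm (fun _ i _ => i c).
Proof. by exists (Const c). Qed.

Lemma pterm_nat n : pterm (fun _ i _ => n%:R).
Proof. by exists (NatConst _ n). Qed.

Lemma pterm_var k : pterm (fun _ i e => e`_k).
Proof. by exists (Var _ k). Qed.

Lemma pterm_add f g : pterm f -> pterm g -> pterm (fun L i e => f L i e + g L i e).
Proof. by move=> [t ft] [u gu]; exists (qe_rcf.Add t u) => L i e; rewrite ft gu. Qed.

Lemma pterm_mul f g : pterm f -> pterm g -> pterm (fun L i e => f L i e * g L i e).
Proof. by move=> [t ft] [u gu]; exists (qe_rcf.Mul t u) => L i e; rewrite ft gu. Qed.

Lemma pterm_opp f : pterm f -> pterm (fun L i e => - f L i e).
Proof. by move=> [t ft]; exists (qe_rcf.Opp t) => L i e; rewrite ft. Qed.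

Lemma pterm_exp f n : pterm f -> pterm (fun L i e => f L i e ^+ n).
Proof. by move=> [t ft]; exists (qe_rcf.Exp t n) => L i e; rewrite ft. Qed.

Lemma pterm_sum (I : Type) (r : seq I) (P : pred I)
    (f : I -> forall L, {rmorphism K -> L} -> seq L -> L) :
  (forall j, P j -> pterm (f j)) ->
  pterm (fun L i e => \sum_(j <- r | P j) f j L i e).
Proof.
move=> pf; elim: r => [|j r IHr].
  by apply: pterm_ext (pterm_nat 0) => L i e; rewrite big_nil.
have [Pj|nPj] := boolP (P j); last first.
  by apply: pterm_ext IHr => L i e; rewrite big_cons (negbTE nPj).
by apply: pterm_ext (pterm_add (pf j Pj) IHr) => L i e; rewrite big_cons Pj.
Qed.

Lemma pterm_prod (I : Type) (r : seq I) (P : pred I)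
    (f : I -> forall L, {rmorphism K -> L} -> seq L -> L) :
  (forall j, P j -> pterm (f j)) ->
  pterm (fun L i e => \prod_(j <- r | P j) f j L i e).
Proof.
move=> pf; elim: r => [|j r IHr].
  by apply: pterm_ext (pterm_nat 1) => L i e; rewrite big_nil.
have [Pj|nPj] := boolP (P j); last first.
  by apply: pterm_ext IHr => L i e; rewrite big_cons (negbTE nPj).
by apply: pterm_ext (pterm_mul (pf j Pj) IHr) => L i e; rewrite big_cons Pj.
Qed.

Lemma elementary_eq0 f : pterm f -> elementary (fun L i e => f L i e = 0).
Proof.
move=> [t ft]; exists [:: ([:: t], [::])] => L i e.
by rewrite ft /dnf_holds /= !andbT orbF; split=> /eqP.
Qed.

Lemma elementary_gt0 f : pterm f -> elementary (fun L i e => 0 < f L i e).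
Proof.
by move=> [t ft]; exists [:: ([::], [:: t])] => L i e;
  rewrite ft /dnf_holds /= !andbT orbF.
Qed.

Lemma elementary_eq f g : pterm f -> pterm g ->
  elementary (fun L i e => f L i e = g L i e).
Proof.
move=> pf pg; apply: elementary_ext (elementary_eq0 (pterm_add pf (pterm_opp pg))).
by move=> L i e /=; split=> [/eqP|->]; rewrite ?subrr // subr_eq0 => /eqP.
Qed.

Lemma elementary_lt f g : pterm f -> pterm g ->
  elementary (fun L i e => f L i e < g L i e).
Proof.
move=> pf pg; apply: elementary_ext (elementary_gt0 (pterm_add pg (pterm_opp pf))).
by move=> L i e; rewrite subr_gt0.
Qed.

Lemma elementary_le f g : pterm f -> pterm g ->
  elementary (fun L i e => f L i e <= g L i e).
Proof.
move=> pf pg; apply: elementary_ext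
  (elementary_or (elementary_lt pf pg) (elementary_eq pf pg)).
move=> L i e; rewrite le_eqVlt; split; first by case=> [->|->]; rewrite ?eqxx ?orbT.
by case/orP => [/eqP|]; [right|left].
Qed.

Lemma elementary_not D : elementary D -> elementary (fun L i e => ~ D L i e).
Proof.
move=> [phi Dphi].
suff: elementary (fun L i e => ~~ dnf_holds i e phi).
  apply: elementary_ext => L i e; rewrite -(rwP negP).
  by split=> h /Dphi.
elim: phi {D Dphi} => [|c phi IH] /=;
  first exact: elementary_ext elementary_true.
suff: elementary (fun L (i : {rmorphism K -> L}) e =>
    ~~ (all (fun t => teval i e t == 0) c.1) \/
    ~~ (all (fun t => 0 < teval i e t) c.2)).
  move=> /elementary_and /(_ IH); apply: elementary_ext => L i e.
  by rewrite negb_or negb_and; split=> [[/orP-> ->]|/andP[/orP]].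
apply: elementary_or.
  elim: c.1 => [|t s IHs] /=;
    first exact: elementary_ext elementary_false.
  have pt : pterm (fun L i e => teval i e t) by exists t.
  apply: elementary_ext (elementary_or (elementary_or
    (elementary_gt0 pt) (elementary_lt pt (pterm_nat 0))) IHs) => L i e.
  rewrite negb_and neq_lt; split.
    by move=> [[|]|] h; rewrite h ?orbT.
  by move=> /orP[/orP[]|] h; [left; right|left; left|right].
elim: c.2 => [|t s IHs] /=;
    first exact: elementary_ext elementary_false.
have pt : pterm (fun L i e => teval i e t) by exists t.
apply: elementary_ext (elementary_or (elementary_le pt (pterm_nat 0)) IHs).
by move=> L i e; rewrite negb_and -leNgt; split=> /orP.
Qed.

Lemma elementary_imp D E : elementary D -> elementary E ->
  elementary (fun L i e => D L i e -> E L i e).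
Proof.
move=> eD eE; apply: elementary_ext (elementary_or (elementary_not eD) eE).
move=> L i e; split=> [[nD|e0] //|DE].
by have [/DE|] := pselect (D L i e); [right|left].
Qed.

Lemma elementary_all_seq (I : eqType) (r : seq I) (D : I -> family) :
  (forall j, j \in r -> elementary (D j)) ->
  elementary (fun L i e => forall j, j \in r -> D j L i e).
Proof.
elim: r => [|j r IHr] eD.
  by apply: elementary_ext elementary_true.
have eDj := eD j (mem_head _ _).
have eDr := IHr (fun k kr => eD k (mem_behead (s := j :: r) kr)).
apply: elementary_ext (elementary_and eDj eDr) => L i e; split.
  by move=> [Dj Dr] k; rewrite inE => /predU1P[->|/Dr].
by move=> DD; split=> [|k kr]; apply: DD; rewrite inE ?eqxx ?kr ?orbT.
Qed.

Lemma elementary_all (I : finType) (D : I -> family) :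
  (forall j, elementary (D j)) ->
  elementary (fun L i e => forall j, D j L i e).
Proof.
move=> eD; apply: elementary_ext
  (elementary_all_seq (r := enum I) (fun j _ => eD j)) => L i e.
by split=> DD j; [apply: DD; rewrite mem_enum|move=> _].
Qed.

Lemma elementary_exfin (I : finType) (D : I -> family) :
  (forall j, elementary (D j)) ->
  elementary (fun L i e => exists j, D j L i e).
Proof.
move=> eD; apply: elementary_ext
  (elementary_not (elementary_all (fun j => elementary_not (eD j)))) => L i e.
split=> [nD|[j Dj] /(_ j)] //; apply: contrapT => nj; apply: nD => j Dj.
by apply: nj; exists j.
Qed.

Fixpoint subst_term (s : nat -> term K) (t : term K) : term K :=
  match t with
  | Var n => s n
  | Const x => Const x
  | NatConst n => NatConst _ n
  | qe_rcf.Add u v => qe_rcf.Add (subst_term s u) (subst_term s v)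
  | qe_rcf.Opp u => qe_rcf.Opp (subst_term s u)
  | NatMul u n => NatMul (subst_term s u) n
  | qe_rcf.Mul u v => qe_rcf.Mul (subst_term s u) (subst_term s v)
  | qe_rcf.Exp u n => qe_rcf.Exp (subst_term s u) n
  end.

Lemma teval_subst L (i : {rmorphism K -> L}) e e' s t :
  (forall n, e'`_n = teval i e (s n)) ->
  teval i e (subst_term s t) = teval i e' t.
Proof.
rewrite /teval => es; elim: t => //=.
- by move=> u -> v ->.
- by move=> u ->.
- by move=> u -> n.
- by move=> u -> v ->.
- by move=> u -> n.
Qed.

Lemma elementary_subst D (s : nat -> term K)
    (g : forall L, {rmorphism K -> L} -> seq L -> seq L) :
  (forall L (i : {rmorphism K -> L}) e n, (g L i e)`_n = teval i e (s n)) ->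
  elementary D -> elementary (fun L i e => D L i (g L i e)).
Proof.
move=> gs [phi Dphi].
exists [seq (map (subst_term s) c.1, map (subst_term s) c.2) | c <- phi] => L i e.
rewrite Dphi /dnf_holds has_map; apply: eq_iff.
by apply: eq_has => c /=; rewrite !all_map; congr andb; apply: eq_all => t /=;
  rewrite (teval_subst _ (gs _ _ _)).
Qed.

Lemma pterm_subst f (s : nat -> term K)
    (g : forall L, {rmorphism K -> L} -> seq L -> seq L) :
  (forall L (i : {rmorphism K -> L}) e n, (g L i e)`_n = teval i e (s n)) ->
  pterm f -> pterm (fun L i e => f L i (g L i e)).
Proof.
move=> gs [t ft]; exists (subst_term s t) => L i e.
by rewrite ft (teval_subst _ (gs _ _ _)).
Qed.

Lemma elementary_formula (f : formula K) :
  elementary (fun L i e => qf_eval e (map_formula i f)).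
Proof.
have pt t : pterm (fun L i e => eval e (map_term i t)) by exists t.
elim: f => /=.
- by move=> b; apply: elementary_cst.
- move=> t u; apply: elementary_ext (elementary_eq (pt t) (pt u)) => L i e.
  by split=> /eqP.
- by move=> t u; exact: elementary_lt.
- by move=> t u; exact: elementary_le.
- move=> f IHf g IHg; apply: elementary_ext (elementary_and IHf IHg) => L i e.
  by split=> /andP.
- move=> f IHf g IHg; apply: elementary_ext (elementary_or IHf IHg) => L i e.
  by split=> /orP.
- move=> f IHf g IHg; apply: elementary_ext (elementary_imp IHf IHg) => L i e.
  by split=> /implyP.
- move=> f IHf; apply: elementary_ext (elementary_not IHf) => L i e.
  by split=> /negP.
Qed.

(** The quantifier distributes over the disjunction, and for one conjunction [CcountGt0] decides
    whether a system in one variable has a solution. *)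
Lemma elementary_ex1 D : elementary D ->
  elementary (fun L i e => exists x : L, D L i (x :: e)).
Proof.
move=> [phi Dphi].
suff: elementary (fun L i e => exists x : L, dnf_holds i (x :: e) phi).
  by apply: elementary_ext => L i e; split=> -[x /Dphi]; exists x.
elim: phi {D Dphi} => [|c phi IH].
  by apply: elementary_ext elementary_false => L i e; split=> // -[].
have := elementary_formula (CcountGt0 (map (abstrX 0) c.1) (map (abstrX 0) c.2)).
(* Abstraction has removed variable 0 from the coefficients. The formula is read with a dummy 0 at
   the head of the list, and the other variables are shifted down. *)
move=> /(elementary_subst (s := fun n => if n is m.+1 then Var _ m else NatConst _ 0)
  (g := fun L i e => 0 :: e)) [|psi psiP]; first by move=> L i e [].
have : elementary (fun L i e => dnf_holds i e psi) by exists psi.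
move=> /elementary_or/(_ IH); apply: elementary_ext => L i e.
rewrite -psiP map_CcountGt0 eval_CcountGt0.
have -> : ccount_gt0
    [seq eval_poly (0 :: e) i0 | i0 <- [seq [seq map_term i i0 | i0 <- p]
      | p <- [seq abstrX 0 t | t <- c.1]]]
    [seq eval_poly (0 :: e) i0 | i0 <- [seq [seq map_term i i0 | i0 <- p]
      | p <- [seq abstrX 0 t | t <- c.2]]] <->
    exists x, all (fun t => teval i (x :: e) t == 0) c.1 &&
              all (fun t => 0 < teval i (x :: e) t) c.2.
  split; first move=> /ccount_gt0P[x]; last move=> [x xP]; last apply/ccount_gt0P.
    rewrite !big_all !all_map => /andP[x1 x2]; exists x.
    by apply/andP; split; [move: x1|move: x2]; apply: sub_all => t /=;
      rewrite map_abstrX abstrXP.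
  exists x; move: xP; rewrite !big_all !all_map => /andP[x1 x2].
  by apply/andP; split; [move: x1|move: x2]; apply: sub_all => t /=;
      rewrite map_abstrX abstrXP.
split; first by move=> [[x xP]|[x xP]]; exists x; rewrite /dnf_holds /= ?xP //
  -/(dnf_holds _ _ _) xP orbT.
by move=> [x /orP[]]; [left|right]; exists x.
Qed.

(** On the empty list every term is the image of an element of [K]. Morphisms preserve zeros and
    signs, so the truth of the description is decided in [K]. *)
Lemma elementary_transfer (D : forall L, {rmorphism K -> L} -> Prop) :
  elementary (fun L i _ => D L i) ->
  forall L1 (i1 : {rmorphism K -> L1}) L2 (i2 : {rmorphism K -> L2}),
  D L1 i1 -> D L2 i2.
Proof.
move=> [phi Dphi] L1 i1 L2 i2 /(Dphi _ _ [::]) D1.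
apply/(Dphi L2 i2 [::]); move: D1; rewrite /dnf_holds.
have tevalK L (i : {rmorphism K -> L}) t : teval i [::] t = i (teval idfun [::] t).
  rewrite /teval; elim: t => //=.
  - by move=> n; rewrite !nth_nil rmorph0.
  - by move=> n; rewrite rmorph_nat.
  - by move=> u -> v ->; rewrite rmorphD.
  - by move=> u ->; rewrite rmorphN.
  - by move=> u -> n; rewrite rmorphMn.
  - by move=> u -> v ->; rewrite rmorphM.
  - by move=> u -> n; rewrite rmorphXn.
have holdsK L (i : {rmorphism K -> L}) :
    has (fun c => all (fun t => teval i [::] t == 0) c.1 &&
      all (fun t => 0 < teval i [::] t) c.2) phi = dnf_holds idfun [::] phi.
  apply: eq_has => c; congr andb; apply: eq_all => t; rewrite tevalK.
    by rewrite fmorph_eq0.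
  exact: rcf_morph_gt0.
by rewrite !holdsK.
Qed.

End Elementary.

End Elementarity.
Import Elementarity.

From mathcomp Require Import finmap perm complex.
From mathcomp Require Import classical_sets functions cardinality fsbigop.
From mathcomp Require Import reals topology normedtype sequences derive exp.
From mathcomp Require Import ring lra.
Import (canonicals, coercions) mpoly.
Import numFieldNormedType.Exports.
Local Open Scope classical_set_scope.
Local Open Scope ring_scope.

(** * Families of matrices *)

Section MxEval.
Variables (K : comNzRingType) (n : nat).
Implicit Types p q : mxpoly K n.

Section Morphism.
Variables (L : comNzRingType) (i : {rmorphism K -> L}).

Lemma mxevalD p q (x : 'M[L]_n) : mxeval i (p + q) x = mxeval i p x + mxeval i q x.
Proof. by rewrite /mxeval mpoly.mmapD. Qed.

Lemma mxeval0 (x : 'M[L]_n) : mxeval i (0 : mxpoly K n) x = 0.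
Proof. exact: mpoly.mmap0. Qed.

Lemma mxevalN p (x : 'M[L]_n) : mxeval i (- p) x = - mxeval i p x.
Proof. by rewrite /mxeval mpoly.mmapN. Qed.

Lemma mxevalM p q (x : 'M[L]_n) : mxeval i (p * q) x = mxeval i p x * mxeval i q x.
Proof. exact: rmorphM. Qed.

Lemma mxevalC c (x : 'M[L]_n) : mxeval i (mpoly.mpolyC (n * n) c) x = i c.
Proof. by rewrite /mxeval mpoly.mmapC. Qed.

Lemma mxevalX k l (x : 'M[L]_n) :
  mxeval i (mpoly.mpolyX K (mpoly.mnm1 (mxvec_index k l))) x = x k l.
Proof. by rewrite /mxeval mpoly.mmapX mpoly.mmap1U mxvecE. Qed.

End Morphism.

Lemma mxpoly_ind (P : mxpoly K n -> Prop) :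
  (forall c, P (mpoly.mpolyC (n * n) c)) ->
  (forall k l, P (mpoly.mpolyX K (mpoly.mnm1 (mxvec_index k l)))) ->
  (forall p q, P p -> P q -> P (p + q)) ->
  (forall p q, P p -> P q -> P (p * q)) -> forall p, P p.
Proof.
move=> PC PX PD PM p; elim/mpoly.mpolyind: p => [|c m p _ _ Pp].
  by rewrite -mpoly.mpolyC0; apply: PC.
apply: (PD) Pp; rewrite -mpoly.mul_mpolyC; apply: (PM) => //.
rewrite mpoly.mpolyXE_id; apply: (big_ind P _ PM).
  by rewrite -mpoly.mpolyC1; apply: (PC).
move=> k _; set e := (X in _ ^+ X); move: e => e; case/mxvec_indexP: k => k l.
elim: e => [|e IHe]; first by rewrite expr0 -mpoly.mpolyC1; apply: (PC).
by rewrite exprS; apply: PM IHe.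
Qed.

(** This is how polynomial conditions meet everything else: it is applied below to limits,
    exponential and geometric sums, polynomials in a time parameter, and elements of O. *)
Lemma mxeval_ind (L : comNzRingType) (i : {rmorphism K -> L}) (T : Type)
    (X : T -> 'M[L]_n) (P : (T -> L) -> Prop) :
  (forall c, P (fun=> i c)) -> (forall k l, P (fun t => X t k l)) ->
  (forall f g, P f -> P g -> P (fun t => f t + g t)) ->
  (forall f g, P f -> P g -> P (fun t => f t * g t)) ->
  forall p, P (fun t => mxeval i p (X t)).
Proof.
move=> PC PX PD PM.
have Pext f g : f =1 g -> P f -> P g by move=> /funext->.
move=> p; elim/mxpoly_ind: p => [c|k l|p q Pp Pq|p q Pp Pq].
- by apply: Pext (PC c) => t; rewrite mxevalC.
- by apply: Pext (PX k l) => t; rewrite mxevalX.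
- by apply: Pext (PD _ _ Pp Pq) => t; rewrite mxevalD.
- by apply: Pext (PM _ _ Pp Pq) => t; rewrite mxevalM.
Qed.

End MxEval.

Lemma mxeval_map (K L M : comNzRingType) n (i : {rmorphism K -> L})
    (j : {rmorphism L -> M}) (k : {rmorphism K -> M}) (p : mxpoly K n) x :
  j \o i =1 k -> mxeval k p (map_mx j x) = j (mxeval i p x).
Proof.
move=> ji; elim/mxpoly_ind: p => [c|a b|p q IHp IHq|p q IHp IHq].
- by rewrite !mxevalC -ji.
- by rewrite !mxevalX mxE.
- by rewrite !mxevalD IHp IHq rmorphD.
- by rewrite !mxevalM IHp IHq rmorphM.
Qed.

Section MatrixFamilies.
Variables (K : rcfType) (n : nat).
Implicit Types (L : rcfType).

(** A quantified matrix occupies the first n * n variables of the list, in the order of [mxvec];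
    [mx_head] and [mx_tail] undo this. *)
Definition mx_seq L (X : 'M[L]_n) : seq L := [seq mxvec X 0 k | k <- enum 'I_(n * n)].
Definition mx_head L (e : seq L) : 'M[L]_n := vec_mx (\row_k e`_k).
Definition mx_tail L (e : seq L) : seq L := drop (n * n) e.

Lemma size_mx_seq L (X : 'M[L]_n) : size (mx_seq X) = (n * n)%N.
Proof. by rewrite size_map size_enum_ord. Qed.

Lemma nth_mx_seq L (X : 'M[L]_n) (k : 'I_(n * n)) : (mx_seq X)`_k = mxvec X 0 k.
Proof. by rewrite (nth_map k) ?size_enum_ord // nth_ord_enum. Qed.

Lemma mx_head_cat L (X : 'M[L]_n) e : mx_head (mx_seq X ++ e) = X.
Proof.
rewrite /mx_head -[RHS]mxvecK; congr vec_mx; apply/rowP => k.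
by rewrite !mxE nth_cat size_mx_seq ltn_ord nth_mx_seq.
Qed.

Lemma mx_tail_cat L (X : 'M[L]_n) e : mx_tail (mx_seq X ++ e) = e.
Proof. by rewrite /mx_tail drop_size_cat // size_mx_seq. Qed.

Lemma mx_headE L (e : seq L) k l : mx_head e k l = e`_(mxvec_index k l).
Proof. by rewrite /mx_head mxE mxE. Qed.

Definition mx_family := forall L, {rmorphism K -> L} -> seq L -> 'M[L]_n.

Definition mxterm (X : mx_family) := forall k l, pterm (fun L i e => X L i e k l).

Lemma elementary_exmx (D : forall L, {rmorphism K -> L} -> 'M[L]_n -> seq L -> Prop) :
  elementary (fun L i e => D L i (mx_head e) (mx_tail e)) ->
  elementary (fun L i e => exists X, D L i X e).
Proof.
move=> eD.
have exm m (E : family K) : elementary E ->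
    elementary (fun L i e => exists s, size s = m /\ E L i (s ++ e)).
  elim: m E => [|m IHm] E eE.
    apply: elementary_ext eE => L i e; split=> [Ee|[[|x s] [] //]].
    by exists [::].
  apply: elementary_ext (IHm _ (elementary_ex1 eE)) => L i e; split.
    by move=> [s [ss [x Ex]]]; exists (x :: s); rewrite /= ss.
  by move=> [[|x s] [] //= [ss] Ex]; exists s; split=> //; exists x.
apply: elementary_ext (exm (n * n)%N _ eD) => L i e; split.
  move=> [s [ss]]; rewrite /mx_tail -{1}ss drop_size_cat // => Ds.
  by exists (mx_head (s ++ e)).
move=> [X DX]; exists (mx_seq X); rewrite size_mx_seq.
by rewrite mx_head_cat mx_tail_cat.
Qed.

Lemma elementary_allmx (D : forall L, {rmorphism K -> L} -> 'M[L]_n -> seq L -> Prop) :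
  elementary (fun L i e => D L i (mx_head e) (mx_tail e)) ->
  elementary (fun L i e => forall X, D L i X e).
Proof.
move=> eD; have := elementary_not (elementary_exmx
  (D := fun L i X e => ~ D L i X e) (elementary_not eD)).
apply: elementary_ext => L i e; split=> [nD X|DD [X]]; last exact.
by have [//|DX] := pselect (D L i X e); case: nD; exists X.
Qed.

Lemma elementary_exsc (D : forall L, {rmorphism K -> L} -> L -> seq L -> Prop) :
  elementary (fun L i e => D L i (head 0 e) (behead e)) ->
  elementary (fun L i e => exists x, D L i x e).
Proof. by move=> /elementary_ex1; apply: elementary_ext. Qed.

Lemma elementary_allsc (D : forall L, {rmorphism K -> L} -> L -> seq L -> Prop) :
  elementary (fun L i e => D L i (head 0 e) (behead e)) ->
  elementary (fun L i e => forall x, D L i x e).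
Proof.
move=> eD; have := elementary_not (elementary_exsc
  (D := fun L i x e => ~ D L i x e) (elementary_not eD)).
apply: elementary_ext => L i e; split=> [nD X|DD [X]]; last exact.
by have [//|DX] := pselect (D L i X e); case: nD; exists X.
Qed.

Lemma pterm_head : pterm (fun L (i : {rmorphism K -> L}) e => head 0 e).
Proof. by apply: pterm_ext (pterm_var K 0) => L i []. Qed.

Lemma pterm_behead f : pterm f -> pterm (fun L (i : {rmorphism K -> L}) e => f L i (behead e)).
Proof.
apply: (pterm_subst (s := fun k => qe_rcf.Var _ k.+1)) => L i e k.
by rewrite nth_behead.
Qed.

Lemma mxterm_behead (X : mx_family) : mxterm X -> mxterm (fun L i e => X L i (behead e)).
Proof. by move=> pX k l; apply: (pterm_behead (pX k l)). Qed.

Lemma mxterm_head : mxterm (fun L i e => mx_head e).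
Proof.
move=> k l; apply: pterm_ext (pterm_var K (mxvec_index k l)) => L i e.
by rewrite mx_headE.
Qed.

Lemma mxterm_cst (M : 'M[K]_n) : mxterm (fun L i e => map_mx i M).
Proof. by move=> k l; apply: pterm_ext (pterm_cst (M k l)) => L i e; rewrite mxE. Qed.

Lemma mxterm_add (X Y : mx_family) : mxterm X -> mxterm Y ->
  mxterm (fun L i e => X L i e + Y L i e).
Proof.
move=> pX pY k l; apply: pterm_ext (pterm_add (pX k l) (pY k l)) => L i e.
by rewrite mxE.
Qed.

Lemma mxterm_mul (X Y : mx_family) : mxterm X -> mxterm Y ->
  mxterm (fun L i e => X L i e *m Y L i e).
Proof.
move=> pX pY k l; apply: (pterm_ext (f := fun L i e =>
  \sum_j X L i e k j * Y L i e j l)); first by move=> L i e; rewrite mxE.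
by apply: pterm_sum => j _; apply: pterm_mul.
Qed.

Lemma mxterm_tr (X : mx_family) : mxterm X -> mxterm (fun L i e => (X L i e)^T).
Proof. by move=> pX k l; apply: pterm_ext (pX l k) => L i e; rewrite mxE. Qed.

Lemma mxterm_scale f (X : mx_family) : pterm f -> mxterm X ->
  mxterm (fun L i e => f L i e *: X L i e).
Proof.
by move=> pf pX k l; apply: pterm_ext (pterm_mul pf (pX k l)) => L i e; rewrite mxE.
Qed.

Lemma mxterm0 : mxterm (fun L i e => 0).
Proof. by move=> k l; apply: pterm_ext (pterm_nat K 0) => L i e; rewrite mxE. Qed.

Lemma mxterm1 : mxterm (fun L i e => 1%:M).
Proof. by move=> k l; apply: pterm_ext (pterm_nat K (k == l)) => L i e; rewrite mxE. Qed.

Lemma mxterm_exp (X : mx_family) m : mxterm X -> mxterm (fun L i e => X L i e ^+ m).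
Proof.
move=> pX; elim: m => [|m IHm]; first exact: mxterm1.
move=> k l; apply: pterm_ext (mxterm_mul pX IHm k l) => L i e.
by rewrite exprS.
Qed.

Lemma mxterm_sum (I : Type) (r : seq I) (X : I -> mx_family) :
  (forall j, mxterm (X j)) -> mxterm (fun L i e => \sum_(j <- r) X j L i e).
Proof.
move=> pX k l; apply: (pterm_ext (f := fun L i e => \sum_(j <- r) X j L i e k l)).
  by move=> L i e; rewrite summxE.
by apply: pterm_sum => j _; apply: pX.
Qed.

Lemma pterm_det (X : mx_family) : mxterm X -> pterm (fun L i e => \det (X L i e)).
Proof.
move=> pX; apply: (@pterm_sum K _ _ _ (fun (s : {perm 'I_n}) L i e =>
  (-1) ^+ s * \prod_j (X L i e) j (s j))) => s _.
apply: pterm_mul; last by apply: pterm_prod => j _; apply: pX.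
apply: pterm_exp; apply: pterm_opp; exact: (pterm_nat K 1).
Qed.

Lemma pterm_mxeval (X : mx_family) (p : mxpoly K n) : mxterm X ->
  pterm (fun L i e => mxeval i p (X L i e)).
Proof.
move=> pX; elim/mxpoly_ind: p => [c|a b|p q IHp IHq|p q IHp IHq].
- by apply: pterm_ext (pterm_cst c) => L i e; rewrite mxevalC.
- by apply: pterm_ext (pX a b) => L i e; rewrite mxevalX.
- by apply: pterm_ext (pterm_add IHp IHq) => L i e; rewrite mxevalD.
- by apply: pterm_ext (pterm_mul IHp IHq) => L i e; rewrite mxevalM.
Qed.

Lemma elementary_eqmx (X Y : mx_family) : mxterm X -> mxterm Y ->
  elementary (fun L i e => X L i e = Y L i e).
Proof.
move=> pX pY; apply: elementary_ext (elementary_all (fun k =>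
  elementary_all (fun l => elementary_eq (pX k l) (pY k l)))) => L i e.
by split=> [?|-> //]; apply/matrixP.
Qed.

Definition mxelementary (P : forall L, {rmorphism K -> L} -> 'M[L]_n -> Prop) :=
  forall X, mxterm X -> elementary (fun L i e => P L i (X L i e)).

Lemma mxelementary_sa P : mxelementary P ->
  exists phi : sa_description K n, forall L (i : {rmorphism K -> L}) x,
    P L i x <-> sa_points i phi x.
Proof.
move=> /(_ _ mxterm_head)[phi Pphi].
have mpt (t : qe_rcf.term K) : sig (fun p : mxpoly K n =>
    forall L (i : {rmorphism K -> L}) x, mxeval i p x = teval i (mx_seq x) t).
  elim: t => /= [k|c|k|u [p pu] v [q qv]|u [p pu]|u [p pu] k|u [p pu] v [q qv]|u [p pu] k].
  - case: (boolP (k < n * n)%N) => kn.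
      exists (mpoly.mpolyX K (mpoly.mnm1 (Ordinal kn))) => L i x.
      rewrite /teval /= -[k in RHS]/(val (Ordinal kn)) nth_mx_seq.
      by case/mxvec_indexP: (Ordinal kn) => a b; rewrite mxevalX mxvecE.
    (* A variable beyond the n * n entries takes the default value 0 of the list. *)
    exists 0 => L i x; rewrite mxeval0 /teval /= nth_default // size_mx_seq.
    by rewrite leqNgt.
  - by exists (mpoly.mpolyC (n * n) c) => L i x; rewrite mxevalC.
  - exists (mpoly.mpolyC (n * n) k%:R) => L i x.
    by rewrite mxevalC rmorph_nat.
  - by exists (p + q) => L i x; rewrite mxevalD pu qv.
  - by exists (- p) => L i x; rewrite mxevalN pu.
  - exists (mpoly.mpolyC (n * n) k%:R * p) => L i x.
    by rewrite mxevalM mxevalC rmorph_nat pu mulr_natl.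
  - by exists (p * q) => L i x; rewrite mxevalM pu qv.
  - exists (p ^+ k) => L i x; rewrite /teval /= -[qe_rcf.eval _ _]/(teval i _ u) -pu.
    elim: k => [|k IHk]; first by rewrite !expr0 -mpoly.mpolyC1 mxevalC rmorph1.
    by rewrite !exprS mxevalM IHk.
exists [seq (map (fun t => sval (mpt t)) c.1, map (fun t => sval (mpt t)) c.2) | c <- phi].
move=> L i x; have -> : P L i x <-> dnf_holds i (mx_seq x) phi.
  by rewrite -Pphi -[mx_seq x]cats0 mx_head_cat.
apply: eq_iff; rewrite /dnf_holds has_map; apply: eq_has => c /=.
by rewrite !all_map; congr andb; apply: eq_all => t /=; rewrite (svalP (mpt t)).
Qed.

Lemma mxelementary_sa_points (phi : sa_description K n) :
  mxelementary (fun L i x => sa_points i phi x).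
Proof.
move=> X pX; rewrite /sa_points /=; elim: phi => [|c phi IH] /=.
  by apply: elementary_ext (elementary_false K).
have e1 : elementary (fun L i e => all (fun p => mxeval i p (X L i e) == 0) c.1).
  elim: c.1 => [|p s IHs] /=; first by apply: elementary_ext (elementary_true K).
  apply: elementary_ext (elementary_and (elementary_eq0 (pterm_mxeval p pX)) IHs).
  by move=> L i e; split=> [[-> ->]|/andP[/eqP-> ->]]; rewrite ?eqxx.
have e2 : elementary (fun L i e => all (fun p => 0 < mxeval i p (X L i e)) c.2).
  elim: c.2 => [|p s IHs] /=; first by apply: elementary_ext (elementary_true K).
  apply: elementary_ext (elementary_and (elementary_gt0 (pterm_mxeval p pX)) IHs).
  by move=> L i e; split=> /andP.
apply: elementary_ext (elementary_or (elementary_and e1 e2) IH) => L i e.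
by split=> [[/andP->|->]|/orP[/andP|]] //; rewrite ?orbT //; [left|right].
Qed.

(** Any description of the set over [L1] is equivalent to [P] there, and by transfer also over [L2].
    So the choice of a description in [sa_extension] is harmless, and each extension in the theorem
    can be computed from a convenient [P]. *)
Lemma sa_extension_elementary P : mxelementary P ->
  forall L1 (i1 : {rmorphism K -> L1}) L2 (i2 : {rmorphism K -> L2}),
  sa_extension i1 i2 [set x | P L1 i1 x]%classic = [set x | P L2 i2 x]%classic.
Proof.
move=> eP L1 i1 L2 i2; apply/seteqP; split=> x /=; last first.
  have [phi Pphi] := mxelementary_sa eP; move=> /Pphi phix; exists phi => //.
  by apply/seteqP; split=> y /= /Pphi.
move=> [phi Pphi phix].
have := @elementary_transfer K (fun L i => forall x : 'M[L]_n,
  sa_points i phi x -> P L i x) _ L1 i1 L2 i2; apply => //.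
  apply: elementary_allmx; apply: elementary_imp.
    exact: mxelementary_sa_points mxterm_head.
  exact: eP mxterm_head.
by move=> y; rewrite -Pphi.
Qed.

End MatrixFamilies.

(** * Hilbert's basis theorem *)

Section Dickson.

(** Take the position of the minimum of the whole sequence, then that of the minimum of what
    follows, and so on. *)
Lemma nondecreasing_extraction (u : nat -> nat) :
  exists phi : nat -> nat, {homo phi : i j / (i < j)%N} /\
    {homo u \o phi : i j / (i <= j)%N}.
Proof.
have min m : exists k, (m <= k)%N && `[< forall l, (m <= l)%N -> (u k <= u l)%N >].
  have exv : exists v, `[< exists2 k, (m <= k)%N & u k = v >].
    by exists (u m); apply/asboolP; exists m.
  case: (ex_minnP exv) => v /asboolP[k mk ukv] vmin; exists k.
  rewrite mk; apply/asboolP => l ml; rewrite ukv; apply: vmin.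
  by apply/asboolP; exists l.
have /choice[g gP] : forall m, exists k,
    (m <= k)%N /\ forall l, (m <= l)%N -> (u k <= u l)%N.
  by move=> m; have [k /andP[mk /asboolP kmin]] := min m; exists k.
pose phi := fix phi k := if k is j.+1 then g (phi j).+1 else g 0%N.
exists phi; split.
  apply: homo_ltn => [k l m|k /=]; first exact: ltn_trans.
  by have [] := gP (phi k).+1.
apply: homo_leq => // [k l m|k /=]; first exact: leq_trans.
case: k => [|k] /=; apply: (proj2 (gP _)) => //.
by apply: leq_trans (proj1 (gP _)); apply: leqW; apply: (proj1 (gP _)).
Qed.

(** Extract a subsequence on which one coordinate is nondecreasing, and repeat for each coordinate
    in turn. *)
Lemma dickson m (f : nat -> 'I_m -> nat) :
  exists i j, (i < j)%N /\ forall k, (f i k <= f j k)%N.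
Proof.
suff [phi [phi_mono phiP]] : exists phi : nat -> nat,
    {homo phi : i j / (i < j)%N} /\
    forall k, k \in enum 'I_m -> {homo (fun i => f (phi i) k) : i j / (i <= j)%N}.
  exists (phi 0%N), (phi 1%N); split=> [|k]; first exact: phi_mono.
  by apply: phiP => //; rewrite mem_enum.
elim: (enum _) => [|k s [phi [phi_mono phiP]]]; first by exists id; split.
have [psi [psi_mono psiP]] := nondecreasing_extraction (fun i => f (phi i) k).
exists (phi \o psi); split=> [i j ij|l]; first by apply/phi_mono/psi_mono.
rewrite inE => /predU1P[->|ls] i j ij; first exact: psiP.
by apply: (phiP l ls); case: ltngtP ij => // [/psi_mono/ltnW|->].
Qed.

End Dickson.

Section Hilbert.
Variables (K : fieldType) (m : nat).
Notation mp := (mpoly.mpoly m K).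

Inductive ideal_of (P : mp -> Prop) : mp -> Prop :=
| ideal0 : ideal_of P 0
| ideal_mem p : P p -> ideal_of P p
| idealD p q : ideal_of P p -> ideal_of P q -> ideal_of P (p + q)
| idealM p q : ideal_of P q -> ideal_of P (p * q).

Lemma ideal_of_sub (P Q : mp -> Prop) :
  (forall p, P p -> ideal_of Q p) -> forall p, ideal_of P p -> ideal_of Q p.
Proof.
move=> PQ p; elim=> {p} [|p /PQ //|p q _ Qp _ Qq|p q _ Qq].
- exact: ideal0.
- exact: idealD.
- exact: idealM.
Qed.

(** Otherwise one can choose forever an element of the ideal outside the ideal of its predecessors,
    with minimal leading monomial among those. By Dickson's lemma some leading monomial divides a
    later one, and cancelling it contradicts minimality. *)
Lemma hilbert_basis (P : mp -> Prop) :
  exists2 s : seq mp, (forall p, p \in s -> ideal_of P p) &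
    forall p, P p -> ideal_of (fun q => q \in s) p.
Proof.
apply: contrapT => noS.
have next (s : seq mp) : exists p, (forall q, q \in s -> ideal_of P q) ->
    [/\ ideal_of P p, ~ ideal_of (fun q => q \in s) p &
      forall q, (mpoly.mlead q < mpoly.mlead p)%O -> ideal_of P q ->
        ideal_of (fun q => q \in s) q].
  have [sP|] := pselect (forall q, q \in s -> ideal_of P q); last by exists 0.
  have [p0 [Pp0 sp0]] : exists p, ideal_of P p /\ ~ ideal_of (fun q => q \in s) p.
    apply: contrapT => noP; apply: noS; exists s => // p Pp.
    by apply: contrapT => sp; apply: noP; exists p; split=> //; apply: ideal_mem.
  move: {2}(mpoly.mlead p0) (erefl (mpoly.mlead p0)) => d.
  elim/(well_founded_ind (@mpoly.ltom_wf m)): d p0 Pp0 sp0 => d IH p0 Pp0 sp0 dp0.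
  have [|noq] := pselect (exists q, [/\ (mpoly.mlead q < mpoly.mlead p0)%O,
      ideal_of P q & ~ ideal_of (fun q => q \in s) q]).
    by move=> [q [qp0 Pq sq]]; apply: (IH (mpoly.mlead q)) Pq sq erefl; rewrite -dp0.
  exists p0 => _; split=> // q qp0 Pq; apply: contrapT => sq; apply: noq.
  by exists q.
have [g gP] := choice next.
pose sq := fix sq k := if k is j.+1 then g (sq j) :: sq j else [::].
have sqP k q : q \in sq k -> ideal_of P q.
  elim: k q => [//|k IHk] q /=; rewrite inE => /predU1P[->|/IHk //].
  by case: (gP _ IHk).
have sq_sub i j : (i < j)%N -> g (sq i) \in sq j.
  elim: j => [//|j IHj]; rewrite ltnS leq_eqVlt => /predU1P[->|/IHj h] /=.
    by rewrite mem_head.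
  by rewrite inE h orbT.
have [i [j [ij leij]]] := dickson (fun k => mpoly.mlead (g (sq k)) : 'I_m -> nat).
have [Pi _ _] := gP _ (sqP i); have [Pj nPj minj] := gP _ (sqP j).
set p := g (sq i) in Pi leij; set q := g (sq j) in Pj nPj minj leij.
have pj : ideal_of (fun q => q \in sq j) p by apply: ideal_mem; apply: sq_sub.
have p0 : p != 0.
  apply/eqP => p0; have [_ + _] := gP _ (sqP i); apply; rewrite -/p p0.
  exact: ideal0.
have q0 : q != 0 by apply/eqP => q0; apply: nPj; rewrite q0; apply: ideal0.
(* The factor for which [r * p] has the same leading term as [q]. *)
pose r : mp := (mpoly.mcoeff (mpoly.mlead q) q / mpoly.mcoeff (mpoly.mlead p) p)
  *: mpoly.mpolyX K (mpoly.mnm_sub (mpoly.mlead q) (mpoly.mlead p)).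
have c0 : mpoly.mcoeff (mpoly.mlead q) q / mpoly.mcoeff (mpoly.mlead p) p != 0.
  by rewrite mulf_neq0 ?invr_eq0 ?mpoly.mleadc_eq0.
have r0 : r != 0.
  by rewrite scaler_eq0 negb_or c0; apply/eqP => /(congr1 (mpoly.mcoeff
    (mpoly.mnm_sub (mpoly.mlead q) (mpoly.mlead p))));
    rewrite mpoly.mcoeffX eqxx mpoly.mcoeff0; apply/eqP; rewrite oner_eq0.
have lr : mpoly.mlead (r * p) = mpoly.mlead q.
  rewrite mpoly.mleadM // mpoly.mleadZ // mpoly.mleadXm.
  by rewrite mpoly.submK //; apply/mpoly.mnm_lepP.
have lcr : mpoly.mcoeff (mpoly.mlead q) (r * p) = mpoly.mcoeff (mpoly.mlead q) q.
  rewrite -[in LHS]lr mpoly.mleadM // mpoly.mleadcM mpoly.mleadcZE mpoly.mleadXm.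
  by rewrite mpoly.mcoeffX eqxx mulr1 divfK // mpoly.mleadc_eq0.
have [qrp|qrp] := eqVneq (q - r * p) 0.
  by apply: nPj; move/eqP: qrp; rewrite subr_eq0 => /eqP->; apply: idealM.
apply: nPj; rewrite -[q](subrK (r * p)); apply: idealD; last exact: idealM.
apply: minj; last first.
  by apply: idealD => //; rewrite -mulNr; apply: idealM.
rewrite lt_neqAle; apply/andP; split; last first.
  by apply: le_trans (mpoly.mleadB_le _ _) _; rewrite lr joinxx.
apply: contraNneq qrp => h; rewrite -mpoly.mleadc_eq0 h mpoly.mcoeffB lcr.
by rewrite subrr.
Qed.

Lemma ideal_of_fin (P : mp -> Prop) p : ideal_of P p ->
  exists2 s : seq mp, (forall q, q \in s -> P q) & ideal_of (fun q => q \in s) p.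
Proof.
elim=> {p} [|p Pp|p q _ [s sP sp] _ [t tP tq]|p q _ [s sP sq]].
- by exists [::] => //; apply: ideal0.
- exists [:: p]; first by move=> q; rewrite inE => /eqP->.
  by apply: ideal_mem; rewrite mem_head.
- exists (s ++ t); first by move=> r; rewrite mem_cat => /orP[/sP|/tP].
  by apply: idealD; [move: sp|move: tq]; apply: ideal_of_sub => r rs;
    apply: ideal_mem; rewrite mem_cat rs ?orbT.
- by exists s => //; apply: idealM.
Qed.

(** Each generator of the ideal involves only finitely many elements of [P]; these together
    generate. *)
Lemma hilbert_basis_sub (P : mp -> Prop) :
  exists2 s : seq mp, (forall p, p \in s -> P p) &
    forall p, P p -> ideal_of (fun q => q \in s) p.
Proof.
have [s sP Ps] := hilbert_basis P.
suff [t tP st] : exists2 t : seq mp, (forall p, p \in t -> P p) &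
    forall q, q \in s -> ideal_of (fun q => q \in t) q.
  by exists t => // p /Ps; apply: ideal_of_sub.
elim: s {Ps} sP => [|q s IHs] sP; first by exists [::].
have [t tP st] := IHs (fun r rs => sP r (mem_behead (s := q :: s) rs)).
have [u uP qu] := ideal_of_fin (sP q (mem_head _ _)).
exists (u ++ t); first by move=> r; rewrite mem_cat => /orP[/uP|/tP].
move=> r; rewrite inE => /predU1P[->|/st]; [move: qu|]; apply: ideal_of_sub => r' r's;
  by apply: ideal_mem; rewrite mem_cat r's ?orbT.
Qed.

End Hilbert.

(** A first order formula is finite, while groups are given by arbitrary sets of equations. The
    finite list depends neither on [L] nor on the embedding. *)
Lemma points_finite (K : fieldType) n (P : set (mxpoly K n)) :
  exists s : seq (mxpoly K n), forall (L : comNzRingType) (i : {rmorphism K -> L}) x,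
    points i P x <-> forall p, p \in s -> mxeval i p x = 0.
Proof.
have [s sP Ps] := hilbert_basis_sub P; exists s => L i x; split=> [Px p /sP /Px //|].
move=> sx p /Ps; elim=> {p} [|p /sx //|p q _ px _ qx|p q _ qx].
- exact: mxeval0.
- by rewrite mxevalD px qx addr0.
- by rewrite mxevalM qx mulr0.
Qed.

Lemma mxelementary_points (K : rcfType) n (P : set (mxpoly K n)) :
  mxelementary (fun L i x => points i P x).
Proof.
have [s sP] := points_finite P; move=> X pX.
apply: elementary_ext (elementary_all_seq (r := s)
  (fun p _ => elementary_eq0 (pterm_mxeval p pX))) => L i e.
by split=> /sP.
Qed.

(** * Independence of characters *)

(** Dedekind's independence of characters, in a form that tolerates repetitions in the family: a
    linear relation between characters on [D] holds for any values [phi] that are equal whenever the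
    characters are. Typically [phi] extends the characters to a point outside [D]. *)
Lemma dedekind_independence (F : fieldType) (X : Type) (D : X -> Prop)
    (op : X -> X -> X) (e : X) (I : eqType) (r : seq I) (c : I -> F)
    (chi : I -> X -> F) (phi : I -> F) :
  D e -> (forall x y, D x -> D y -> D (op x y)) ->
  (forall k, chi k e = 1) ->
  (forall k x y, D x -> D y -> chi k (op x y) = chi k x * chi k y) ->
  (forall k l, (forall x, D x -> chi k x = chi l x) -> phi k = phi l) ->
  (forall x, D x -> \sum_(k <- r) c k * chi k x = 0) ->
  \sum_(k <- r) c k * phi k = 0.
Proof.
move=> De Dop chi1 chiM phiP.
have [m] := ubnP (size r); elim: m r c => // m IHm r c; rewrite ltnS => rm cr.
(* The relation at [op y x] minus [chi k0 y] times the relation at [x] has no term in [k0], so the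
   induction hypothesis applies to it. *)
have key k0 y : k0 \in r -> D y ->
    \sum_(k <- r) c k * chi k y * phi k = chi k0 y * \sum_(k <- r) c k * phi k.
  move=> k0r Dy; apply/eqP; rewrite -subr_eq0 mulr_sumr -sumrB.
  rewrite (big_rem k0) //= [X in X + _](_ : _ = 0) ?add0r; last first.
    by rewrite -mulrA mulrCA subrr.
  have E k : c k * chi k y * phi k - chi k0 y * (c k * phi k) =
      c k * (chi k y - chi k0 y) * phi k by rewrite mulrBr mulrBl; congr (_ - _);
      rewrite mulrCA mulrA.
  under eq_bigr do rewrite E; apply/eqP; apply: IHm.
    by rewrite size_rem //; case: (r) k0r rm => //= a s _; rewrite ltnS.
  move=> x Dx; have : \sum_(k <- r) c k * chi k (op y x) -
      chi k0 y * \sum_(k <- r) c k * chi k x = 0.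
    by rewrite !cr ?mulr0 ?subrr //; apply: Dop.
  rewrite mulr_sumr -sumrB.
  rewrite (big_rem k0) //= [X in X + _](_ : _ = 0) ?add0r; last first.
    by rewrite chiM // mulrCA subrr.
  move=> {2}<-; apply: eq_bigr => k _.
  by rewrite chiM // mulrBr mulrBl !mulrA; congr (_ - _); rewrite -!mulrA mulrCA.
have [[k0 [k1 [y [[k0r k1r Dy] /eqP neq]]]]|] := pselect (exists k0 k1 y,
    [/\ k0 \in r, k1 \in r & D y] /\ chi k0 y <> chi k1 y).
  have /eqP := key k1 y k1r Dy; rewrite (key k0 y k0r Dy) -subr_eq0 -mulrBl.
  by rewrite mulf_eq0 subr_eq0 (negbTE neq) => /eqP.
move=> eqchi; case: r => [|k0 r'] in rm cr key eqchi *; first by rewrite big_nil.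
rewrite big_seq (eq_bigr (fun k => c k * phi k0)) => [|k kr].
  rewrite -big_seq -mulr_suml; have := cr e De.
  by under eq_bigr do rewrite chi1 mulr1; move=> ->; rewrite mul0r.
congr (_ * _); apply: phiP => x Dx; apply: contrapT => neq; apply: eqchi.
by exists k, k0, x; rewrite mem_head kr.
Qed.

Lemma seq_max (K : realDomainType) (s : seq K) : s != [::] ->
  exists2 b, b \in s & forall c, c \in s -> c <= b.
Proof.
elim: s => // a [|a' s] IHs _.
  by exists a; [rewrite mem_head|move=> c; rewrite inE => /eqP->].
have [b bs bmax] := IHs isT; have [ab|ba] := leP a b.
  exists b; first by rewrite inE bs orbT.
  by move=> c; rewrite inE => /predU1P[->|/bmax].
exists a; first by rewrite mem_head.
move=> c; rewrite inE => /predU1P[->//|/bmax cb].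
exact: le_trans cb (ltW ba).
Qed.

(** * Sums of geometric progressions with positive ratios *)

Section GeometricSums.
Variables (K : realFieldType) (F : fieldType) (f : {rmorphism K -> F}).

(** Such are the values of a polynomial along the powers of a matrix with positive eigenvalues. The
    ratios are kept in the ordered field, where they have a maximum. *)
Definition geometric_sum (u : nat -> F) :=
  exists r : seq (F * K), all (fun a => 0 < a.2) r /\
    forall j, u j = \sum_(a <- r) a.1 * f a.2 ^+ j.

Lemma geometric_sum_ext u v : u =1 v -> geometric_sum u -> geometric_sum v.
Proof. by move=> /funext->. Qed.

Lemma geometric_sum_geom c b : 0 < b -> geometric_sum (fun j => c * f b ^+ j).
Proof.
by move=> b0; exists [:: (c, b)]; rewrite /= b0; split=> // j; rewrite big_seq1.
Qed.

Lemma geometric_sum_cst c : geometric_sum (fun=> c).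
Proof.
apply: geometric_sum_ext (geometric_sum_geom c ltr01) => j.
by rewrite rmorph1 expr1n mulr1.
Qed.

Lemma geometric_sumD u v : geometric_sum u -> geometric_sum v ->
  geometric_sum (fun j => u j + v j).
Proof.
move=> [r [r0 ur]] [s [s0 vs]]; exists (r ++ s); rewrite all_cat r0 s0.
by split=> // j; rewrite big_cat /= -ur -vs.
Qed.

Lemma geometric_sumM u v : geometric_sum u -> geometric_sum v ->
  geometric_sum (fun j => u j * v j).
Proof.
move=> [r [r0 ur]] [s [s0 vs]].
exists [seq (a.1 * b.1, a.2 * b.2) | a <- r, b <- s]; split.
  apply/allP => _ /allpairsP[[a b] [/= ar bs ->]] /=.
  by rewrite mulr_gt0 // ?(allP r0 _ ar) ?(allP s0 _ bs).
move=> j; rewrite ur vs big_allpairs_dep /= mulr_suml; apply: eq_bigr => a _.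
rewrite mulr_sumr; apply: eq_bigr => b _.
by rewrite rmorphM exprMn mulrACA.
Qed.

Lemma geometric_sum_sum (I : Type) (r : seq I) (u : I -> nat -> F) :
  (forall k, geometric_sum (u k)) -> geometric_sum (fun j => \sum_(k <- r) u k j).
Proof.
move=> gu; elim: r => [|k r IHr].
  by apply: geometric_sum_ext (geometric_sum_cst 0) => j; rewrite big_nil.
by apply: geometric_sum_ext (geometric_sumD (gu k) IHr) => j; rewrite big_cons.
Qed.

Lemma geometric_sum_reduced u : geometric_sum u ->
  exists (s : seq K) (c : K -> F), [/\ uniq s, all (fun b => 0 < b) s,
    forall b, b \in s -> c b != 0 & forall j, u j = \sum_(b <- s) c b * f b ^+ j].
Proof.
move=> [r [r0 ur]]; pose c b := \sum_(a <- r | a.2 == b) a.1.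
exists [seq b <- undup (map snd r) | c b != 0], c; split.
- by rewrite filter_uniq ?undup_uniq.
- apply/allP => b; rewrite mem_filter mem_undup => /andP[_ /mapP[a ar ->]].
  exact: (allP r0).
- by move=> b; rewrite mem_filter => /andP[].
move=> j; rewrite ur big_filter [RHS]big_mkcond /=.
rewrite [RHS](eq_bigr (fun b => \sum_(a <- r | a.2 == b) a.1 * f a.2 ^+ j)); last first.
  move=> b _; have -> : \sum_(a <- r | a.2 == b) a.1 * f a.2 ^+ j = c b * f b ^+ j.
    by rewrite /c mulr_suml; apply: eq_bigr => a /eqP->.
  by case: (eqVneq (c b) 0) => [->|] //; rewrite mul0r.
rewrite (exchange_big_dep predT) //= big_seq [RHS]big_seq; apply: eq_bigr => a ar.
rewrite -big_filter (_ : [seq b <- _ | _] = [:: a.2]) ?big_seq1 //.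
rewrite (eq_filter (a2 := pred1 a.2)); last by move=> b /=; rewrite eq_sym.
by rewrite filter_pred1_uniq ?undup_uniq // mem_undup map_f.
Qed.

(* The product of the terms with largest ratios cannot be cancelled. *)
Lemma geometric_sum_domain u v : geometric_sum u -> geometric_sum v ->
  (forall j, u j * v j = 0) -> (forall j, u j = 0) \/ (forall j, v j = 0).
Proof.
move=> /geometric_sum_reduced[s [c [s_uniq s0 cs us]]].
move=> /geometric_sum_reduced[t [d [t_uniq t0 dt vt]]] uv0.
have [s_nil|s_neq0] := eqVneq s [::]; first by left=> j; rewrite us s_nil big_nil.
have [t_nil|t_neq0] := eqVneq t [::]; first by right=> j; rewrite vt t_nil big_nil.
have [b bs bmax] := seq_max s_neq0; have [e et emax] := seq_max t_neq0.
have b0 := allP s0 _ bs; have e0 := allP t0 _ et.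
(* Independence of the characters of the naturals, with [phi] the indicator of the largest product
   of ratios, isolates the coefficient of that product. *)
suff : \sum_(k <- [seq (x, y) | x <- s, y <- t])
    c k.1 * d k.2 * (k.1 * k.2 == b * e)%:R = 0.
  rewrite big_allpairs_dep /= (bigD1_seq b) //= [X in _ + X]big1_seq ?addr0.
    rewrite (bigD1_seq e) //= [X in _ + X]big1_seq ?addr0.
      rewrite eqxx mulr1 => /eqP; rewrite mulf_eq0.
      by rewrite (negbTE (cs _ bs)) (negbTE (dt _ et)).
    move=> y /andP[ye yt]; rewrite [_ == _](_ : _ = false) ?mulr0 //.
    by apply/negbTE; rewrite (inj_eq (mulfI _)) // gt_eqF.
  move=> x /andP[xb xs]; rewrite big1_seq // => y /andP[_ yt].
  rewrite [_ == _](_ : _ = false) ?mulr0 //; apply: lt_eqF.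
  have xlb : x < b by rewrite lt_neqAle xb bmax.
  apply: (@lt_le_trans _ _ (b * y)); first by rewrite ltr_pM2r ?(allP t0 _ yt).
  by rewrite ler_pM2l // emax.
apply: (@dedekind_independence F nat (fun=> Logic.True) addn 0%N _ _ _
  (fun k j => f (k.1 * k.2) ^+ j)) => //.
- by move=> k x y _ _; rewrite exprD.
- move=> k l /(_ 1%N I); rewrite !expr1 => /fmorph_inj kl.
  by rewrite kl.
move=> j _; rewrite big_allpairs_dep /= -[RHS](uv0 j) us vt mulr_suml.
apply: eq_bigr => x _; rewrite mulr_sumr; apply: eq_bigr => y _.
by rewrite rmorphM exprMn mulrACA.
Qed.

End GeometricSums.

(** * The matrix exponential *)

Lemma cvg_sumr (R : numFieldType) (T I : Type) (F : set_system T) (FF : Filter F)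
    (r : seq I) (f : I -> T -> R) (l : I -> R) :
  (forall i, f i x @[x --> F] --> l i) ->
  \sum_(i <- r) f i x @[x --> F] --> \sum_(i <- r) l i.
Proof.
move=> fl; elim: r => [|i r IHr].
  by rewrite big_nil; under eq_cvg do rewrite big_nil; apply: cvg_cst.
by rewrite big_cons; under eq_cvg do rewrite big_cons; apply: cvgD.
Qed.

Section EntrywiseLimits.
Variables (R : numFieldType) (T : Type) (F : set_system T).
Context {FF : ProperFilter F}.

Definition mxcvg_to m n (u : T -> 'M[R]_(m, n)) (M : 'M[R]_(m, n)) :=
  forall i j, u k i j @[k --> F] --> M i j.

Variables (m n p : nat).

Lemma mxcvg_cst (M : 'M[R]_(m, n)) : mxcvg_to (fun=> M) M.
Proof. by move=> i j; apply: cvg_cst. Qed.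

Lemma mxcvg_mul (u : T -> 'M[R]_(m, n)) M (v : T -> 'M[R]_(n, p)) N :
  mxcvg_to u M -> mxcvg_to v N -> mxcvg_to (fun k => u k *m v k) (M *m N).
Proof.
move=> uM vN i j; rewrite mxE.
under eq_cvg do rewrite mxE.
by apply: cvg_sumr => l; apply: cvgM.
Qed.

Lemma mxcvg_unique (u : T -> 'M[R]_(m, n)) M N :
  mxcvg_to u M -> mxcvg_to u N -> M = N.
Proof.
by move=> uM uN; apply/matrixP => i j; apply: (cvg_unique _ (uM i j) (uN i j)).
Qed.

Lemma mxcvg_tr (u : T -> 'M[R]_(m, n)) M :
  mxcvg_to u M -> mxcvg_to (fun k => (u k)^T) M^T.
Proof. by move=> uM i j; rewrite mxE; under eq_cvg do rewrite mxE; apply: uM. Qed.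

Lemma mxcvg_ext (u v : T -> 'M[R]_(m, n)) M :
  mxcvg_to u M -> u =1 v -> mxcvg_to v M.
Proof. by move=> uM /funext <-. Qed.

End EntrywiseLimits.

Arguments mxcvg_cst {R T F FF m n} M.
Arguments mxcvg_unique {R T F FF m n u M N}.
Arguments mxcvg_ext {R T F m n u v M}.
Arguments mxcvg_tr {R T F m n u M}.
Arguments mxcvg_mul {R T F FF m n p u M v N}.

Notation mxcvg := (mxcvg_to \oo).

Lemma mxcvg_lim (R : realType) m n (u : nat -> 'M[R]_(m, n)) M :
  mxcvg u M -> u k @[k --> \oo] --> M.
Proof.
move=> uM; apply/cvg_ballP => e e0.
have : \forall k \near \oo, forall ij : 'I_m * 'I_n, ball (M ij.1 ij.2) e (u k ij.1 ij.2).
  by apply: filter_forall => ij; move/cvg_ballP: (uM ij.1 ij.2) => /(_ e e0).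
by apply: filterS => k uk; split=> // i j; apply: (uk (i, j)).
Qed.

Lemma mxeval_cvg (K : rcfType) (R : realType) (i : {rmorphism K -> R}) n
    (p : mxpoly K n) (u : nat -> 'M[R]_n) M :
  mxcvg u M -> mxeval i p (u k) @[k --> \oo] --> mxeval i p M.
Proof.
move=> uM; pose X (o : option nat) := if o is Some k then u k else M.
apply: (@mxeval_ind _ _ _ i (option nat) X
  (fun f => f (Some k) @[k --> \oo] --> f None)) => //.
- by move=> c; apply: cvg_cst.
- by move=> f g; apply: cvgD.
- by move=> f g; apply: cvgM.
Qed.

Lemma points_closed (K : rcfType) (R : realType) (i : {rmorphism K -> R}) n
    (P : set (mxpoly K n)) (u : nat -> 'M[R]_n) M :
  mxcvg u M -> (forall k, points i P (u k)) -> points i P M.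
Proof.
move=> uM Pu p Pp; have := @mxeval_cvg K R i n p u M uM.
under eq_cvg do rewrite (Pu _ p Pp).
by move=> /(cvg_unique _ (cvg_cst 0))->.
Qed.

Section MatrixExponential.
Variables (R : realType) (n : nat).
Implicit Types (X Y g : 'M[R]_n).

Definition mxnorm1 X : R := \sum_i \sum_j `|X i j|.

Lemma mxnorm1_ge0 X : 0 <= mxnorm1 X.
Proof. by apply: sumr_ge0 => i _; apply: sumr_ge0. Qed.

Lemma norm_exprmx X k i j : `|(X ^+ k) i j| <= mxnorm1 X ^+ k.
Proof.
elim: k i j => [|k IHk] i j; first by rewrite !expr0 mxE normr_nat; case: eqP.
rewrite exprS mxE; apply: le_trans (ler_norm_sum _ _ _) _.
apply: (@le_trans _ _ (\sum_l `|X i l| * mxnorm1 X ^+ k)).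
  by apply: ler_sum => l _; rewrite normrM ler_wpM2l.
rewrite -mulr_suml exprS ler_wpM2r ?exprn_ge0 ?mxnorm1_ge0 //.
by rewrite /mxnorm1 [leRHS](bigD1 i) //= lerDl; apply: sumr_ge0 => a _; apply: sumr_ge0.
Qed.

Definition expmx_part N X := \sum_(k < N) (k`!%:R)^-1 *: X ^+ k.

Lemma expmx_part_entry N X i j :
  expmx_part N X i j = series (fun k => (k`!%:R)^-1 * (X ^+ k) i j) N.
Proof.
rewrite /series /= big_mkord summxE; apply: eq_bigr => k _.
by rewrite mxE.
Qed.

Lemma expmx_cvg X : mxcvg (expmx_part ^~ X) (expmx X).
Proof.
have cX i j : cvgn (fun N => expmx_part N X i j).
  rewrite (_ : (fun N => _) = series (fun k => (k`!%:R)^-1 * (X ^+ k) i j)); last first.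
    by apply/funext => N; apply: expmx_part_entry.
  apply: normed_cvg; apply: series_le_cvg (is_cvg_series_exp_coeff (mxnorm1 X)).
  - by move=> k; apply: normr_ge0.
  - by move=> k; apply: exp_coeff_ge0; apply: mxnorm1_ge0.
  move=> k /=; rewrite /exp_coeff /= normrM ger0_norm ?invr_ge0 // mulrC.
  by rewrite ler_wpM2r ?invr_ge0 // norm_exprmx.
pose Y : 'M[R]_n := \matrix_(i, j) limn (fun N => expmx_part N X i j).
have XY : mxcvg (expmx_part ^~ X) Y by move=> i j; rewrite mxE; apply: cX.
suff -> : expmx X = Y by [].
rewrite /expmx; apply: cvg_lim => //.
rewrite (_ : series _ = expmx_part ^~ X); first exact: mxcvg_lim.
by apply/funext => N; rewrite /series /= big_mkord.
Qed.

Arguments expmx_cvg : clear implicits.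

Lemma expmx_unique X Y : mxcvg (expmx_part ^~ X) Y -> expmx X = Y.
Proof. by move=> XY; apply: (mxcvg_unique (expmx_cvg X) XY). Qed.

Lemma expmx_conj X g : g \in unitmx ->
  expmx (g *m X *m invmx g) = g *m expmx X *m invmx g.
Proof.
move=> gU; apply: expmx_unique.
apply: (mxcvg_ext (mxcvg_mul (mxcvg_mul (mxcvg_cst g) (expmx_cvg X))
  (mxcvg_cst (invmx g)))) => N.
rewrite /expmx_part mulmx_sumr mulmx_suml; apply: eq_bigr => k _.
rewrite -scalemxAr -scalemxAl; congr (_ *: _).
elim: (k : nat) => [|m IHm]; first by rewrite !expr0 mulmx1 mulmxV.
by rewrite !exprS -IHm -!mulmxE !mulmxA mulmxKV.
Qed.

Lemma expmx_tr X : expmx X^T = (expmx X)^T.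
Proof.
apply: expmx_unique; apply: (mxcvg_ext (mxcvg_tr (expmx_cvg X))) => N.
rewrite /expmx_part raddf_sum /=; apply: eq_bigr => k _.
rewrite linearZ /=; congr (_ *: _).
elim: (k : nat) => [|m IHm]; first by rewrite !expr0 trmx1.
by rewrite exprS exprSr -IHm -mulmxE trmx_mul.
Qed.

Lemma expmx_diag (d : 'rV[R]_n) :
  expmx (diag_mx d) = diag_mx (\row_j expR (d 0 j)).
Proof.
apply: expmx_unique => i j; rewrite !mxE.
have E k : (diag_mx d ^+ k) = diag_mx (\row_j (d 0 j ^+ k)).
  elim: k => [|k IHk].
    by apply/matrixP => a b; rewrite !mxE expr0.
  rewrite exprS IHk -mulmxE mulmx_diag; congr diag_mx.
  by apply/rowP => a; rewrite !mxE exprS.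
have [<-|ij] := eqVneq i j; last first.
  rewrite mulr0n; under eq_cvg => N.
    rewrite summxE big1; last by move=> k _; rewrite E !mxE (negbTE ij) mulr0n mulr0.
    over.
  exact: cvg_cst.
rewrite mulr1n; have := is_cvg_series_exp_coeff (d 0 i).
move=> /cvg_ex[l cl]; rewrite /expR (cvg_lim _ cl) //.
apply: cvg_trans cl; apply: near_eq_cvg; near=> N.
rewrite expmx_part_entry; congr (series _ N); apply/funext => k.
by rewrite E !mxE eqxx mulr1n /exp_coeff /= mulrC.
Unshelve. all: by end_near.
Qed.

Lemma expmx_comm X g : g *m X = X *m g -> g *m expmx X = expmx X *m g.
Proof.
move=> gX; apply: (mxcvg_unique (mxcvg_mul (mxcvg_cst g) (expmx_cvg X))).
apply: (mxcvg_ext (mxcvg_mul (expmx_cvg X) (mxcvg_cst g))) => N.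
rewrite /expmx_part mulmx_sumr mulmx_suml; apply: eq_bigr => k _.
rewrite -scalemxAr -scalemxAl; congr (_ *: _).
elim: (k : nat) => [|m IHm]; first by rewrite !expr0 mulmx1 mul1mx.
by rewrite exprS -mulmxE -mulmxA IHm !mulmxA gX.
Qed.

Lemma expmx_nilpotentE X : X ^+ n = 0 -> expmx X = expmx_nilpotent X.
Proof.
move=> X0; apply: expmx_unique => i j; apply: cvg_near_cst; near=> N.
have nN : (n <= N)%N by near: N; exists n.
congr (fun_of_matrix _ i j); rewrite /expmx_part /expmx_nilpotent.
rewrite [RHS](big_ord_widen N (fun k => (k`!%:R)^-1 *: X ^+ k)) // [LHS](bigID (fun k : 'I_N => (k < n)%N)) /=.
rewrite [X in _ + X]big1 ?addr0 // => k; rewrite -leqNgt => nk.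
by rewrite -(subnK nk) exprD X0 mulr0 scaler0.
Unshelve. all: by end_near.
Qed.

(** The partial sum for s + t collects the pairs (k, l) with k + l < N from the product of the two
    partial sums. The powers are abstracted into [f], so that one identity serves for the matrix and
    for its scalar majorant. *)
Lemma exp_partD (V : lmodType R) (f : nat -> V) (s t : R) N :
  \sum_(k < N) ((s + t) ^+ k / k`!%:R) *: f k =
  \sum_(k < N) \sum_(l < N | (k + l < N)%N)
     ((s ^+ k / k`!%:R) * (t ^+ l / l`!%:R)) *: f (k + l)%N.
Proof.
pose G k l := ((s ^+ k / k`!%:R) * (t ^+ l / l`!%:R)) *: f (k + l)%N.
have E (m : 'I_N) : ((s + t) ^+ m / m`!%:R) *: f m =
    \sum_(k < N) \sum_(l < N | (k + l == m)%N) G k l.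
  transitivity (\sum_(k < m.+1) G k (m - k)%N).
    rewrite addrC exprDn mulr_suml scaler_suml; apply: eq_bigr => k _.
    have km : (k <= m)%N by rewrite -ltnS.
    rewrite /G subnKC //; congr (_ *: _).
    have := bin_fact km => /(congr1 (fun x => x%:R : R)); rewrite !natrM => <-.
    have k0 : (k`!%:R : R) != 0 by rewrite pnatr_eq0 -lt0n fact_gt0.
    have mk0 : ((m - k)`!%:R : R) != 0 by rewrite pnatr_eq0 -lt0n fact_gt0.
    have b0 : ('C(m, k)%:R : R) != 0 by rewrite pnatr_eq0 -lt0n bin_gt0.
    by rewrite -mulr_natr; field; rewrite k0 mk0 b0.
  rewrite (big_ord_widen N (fun k => G k (m - k)%N) (ltn_ord m)) big_mkcond /=.
  apply: eq_bigr => k _; case: ifP => km; last first.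
    rewrite big1 // => l /eqP klm; move: km; rewrite ltnS -klm leq_addr //.
  have lN : (m - k < N)%N by apply: leq_ltn_trans (leq_subr _ _) (ltn_ord m).
  rewrite (big_pred1 (Ordinal lN)) // => l.
  by rewrite /= -val_eqE /= -(eqn_add2l k l) subnKC.
under eq_bigr do rewrite E.
rewrite exchange_big /=; apply: eq_bigr => k _.
rewrite (exchange_big_dep predT) //= [RHS]big_mkcond; apply: eq_bigr => l _.
case: ifP => klN.
  by rewrite (big_pred1 (Ordinal klN)).
by rewrite big1 // => m /eqP klm; rewrite klm ltn_ord in klN.
Qed.

Lemma expmx_partZ N t X : expmx_part N (t *: X) = \sum_(k < N) (t ^+ k / k`!%:R) *: X ^+ k.
Proof.
apply: eq_bigr => k _; rewrite [_ / _]mulrC -scalerA; congr (_ *: _).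
elim: (k : nat) => [|m IHm]; first by rewrite !expr0 scale1r.
by rewrite !exprS IHm -!mulmxE -scalemxAl -scalemxAr scalerA.
Qed.

(** The terms missing from the partial sum for s + t are dominated entrywise by those of the real
    series with [mxnorm1 X] in place of X, and these tend to 0 by the functional equation of the
    real exponential. *)
Lemma expmxD s t X : expmx ((s + t) *: X) = expmx (s *: X) *m expmx (t *: X).
Proof.
pose c := mxnorm1 X.
pose E N (x : R) := \sum_(k < N) (x ^+ k / k`!%:R) *: (c ^+ k : R^o).
have EE x : E N x @[N --> \oo] --> expR (x * c).
  have /cvg_ex[l cl] := is_cvg_series_exp_coeff (x * c).
  rewrite /expR (cvg_lim _ cl) //; apply: cvg_trans cl.
  apply: near_eq_cvg; near=> N; rewrite /E /series /= big_mkord.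
  by apply: eq_bigr => k _; rewrite /exp_coeff /= exprMn mulrAC.
have bound N i j :
    `|(expmx_part N (s *: X) *m expmx_part N (t *: X) -
       expmx_part N ((s + t) *: X)) i j| <= E N `|s| * E N `|t| - E N (`|s| + `|t|).
  have F (V : lmodType R) (f : nat -> V) (x y : R) :
      \sum_(k < N) \sum_(l < N) ((x ^+ k / k`!%:R) * (y ^+ l / l`!%:R)) *: f (k + l)%N -
      \sum_(k < N) ((x + y) ^+ k / k`!%:R) *: f k =
      \sum_(k < N) \sum_(l < N | ~~ (k + l < N)%N)
         ((x ^+ k / k`!%:R) * (y ^+ l / l`!%:R)) *: f (k + l)%N.
    rewrite exp_partD -sumrB; apply: eq_bigr => k _.
    rewrite (bigID (fun l : 'I_N => (k + l < N)%N)) /=.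
    by rewrite addrAC subrr add0r.
  rewrite !expmx_partZ (_ : _ *m _ = \sum_(k < N) \sum_(l < N)
      ((s ^+ k / k`!%:R) * (t ^+ l / l`!%:R)) *: X ^+ (k + l)%N); last first.
    rewrite mulmx_suml; apply: eq_bigr => k _; rewrite mulmx_sumr.
    apply: eq_bigr => l _; rewrite -scalemxAl -scalemxAr scalerA; congr (_ *: _).
    by rewrite exprD.
  rewrite (F 'M[R]_n) (_ : E N _ * _ = \sum_(k < N) \sum_(l < N)
      ((`|s| ^+ k / k`!%:R) * (`|t| ^+ l / l`!%:R)) *: (c ^+ (k + l)%N : R^o)); last first.
    rewrite /E mulr_suml; apply: eq_bigr => k _; rewrite mulr_sumr.
    apply: eq_bigr => l _; rewrite /GRing.scale /= exprD; ring.
  rewrite /E (F R^o) summxE; apply: le_trans (ler_norm_sum _ _ _) _.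
  apply: ler_sum => k _; rewrite summxE; apply: le_trans (ler_norm_sum _ _ _) _.
  apply: ler_sum => l _; rewrite mxE normrM ler_pM //; last exact: norm_exprmx.
  by rewrite !(normrM, normrX, normfV, normr_nat).
have h : mxcvg (fun N => expmx_part N (s *: X) *m expmx_part N (t *: X))
    (expmx (s *: X) *m expmx (t *: X)) by apply: mxcvg_mul; apply: expmx_cvg.
apply: expmx_unique => i j.
have -> : (expmx (s *: X) *m expmx (t *: X)) i j =
  (expmx (s *: X) *m expmx (t *: X)) i j - 0 by rewrite subr0.
have E0 : E N `|s| * E N `|t| - E N (`|s| + `|t|) @[N --> \oo] --> (0 : R).
  rewrite -(subrr (expR ((`|s| + `|t|) * c))) {1}mulrDl expRD.
  by apply: cvgB; [apply: cvgM|].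
have D0 : (expmx_part N (s *: X) *m expmx_part N (t *: X) -
       expmx_part N ((s + t) *: X)) i j @[N --> \oo] --> (0 : R).
  apply/norm_cvg0P; apply: (@squeeze_cvgr _ _ _ _ (fun=> 0) _ _ _ _ (cvg_cst 0) E0).
  by near=> N; rewrite normr_ge0 bound.
apply: cvg_trans (cvgB (h i j) D0); apply: near_eq_cvg; near=> N.
have key (A B : 'M[R]_n) : A i j - (A - B) i j = B i j by rewrite !mxE opprB addrC subrK.
exact: key.
Unshelve. all: by end_near.
Qed.

Lemma expmx0 : expmx (0 : 'M[R]_n) = 1%:M.
Proof.
apply: expmx_unique => i j; apply: cvg_near_cst; near=> N.
have N0 : (0 < N)%N by near: N; exists 1%N.
rewrite /expmx_part -(prednK N0) big_ord_recl /= big1 => [|k _].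
  by rewrite addr0 fact0 invr1 scale1r expr0.
by rewrite exprS mul0r scaler0.
Unshelve. all: by end_near.
Qed.

Lemma expmxN X : expmx X *m expmx (- X) = 1%:M.
Proof. by rewrite -[X in expmx X *m _]scale1r -scaleN1r -expmxD subrr scale0r expmx0. Qed.

Lemma expmx_natmul X m : expmx (m%:R *: X) = expmx X ^+ m.
Proof.
elim: m => [|m IHm]; first by rewrite scale0r expmx0 expr0.
by rewrite -natr1 addrC expmxD scale1r IHm exprS.
Qed.

Lemma expmx_taylor X t i j : `|t| <= 1 ->
  `|(expmx (t *: X) - (1%:M + t *: X + (t ^+ 2 / 2) *: (X *m X))) i j|
   <= `|t| ^+ 3 * expR (mxnorm1 X).
Proof.
move=> t1; pose c := mxnorm1 X.
have c0 : 0 <= c := mxnorm1_ge0 X.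
have S3 : 1%:M + t *: X + (t ^+ 2 / 2) *: (X *m X) = expmx_part 3 (t *: X).
  rewrite expmx_partZ !big_ord_recl big_ord0 /= addr0 addrA /bump /=.
  by rewrite !expr0 !expr1 expr2 fact0 !divr1 scale1r -[X ^+ 2]/(X *m X).
rewrite S3.
have bound N : `|(expmx_part (3 + N) (t *: X) - expmx_part 3 (t *: X)) i j| <=
    `|t| ^+ 3 * expR c.
  rewrite !expmx_partZ big_split_ord /= addrAC subrr add0r summxE.
  apply: le_trans (ler_norm_sum _ _ _) _.
  apply: (@le_trans _ _ (`|t| ^+ 3 * series (exp_coeff c) (3 + N)%N)); last first.
    rewrite ler_wpM2l ?exprn_ge0 //.
    apply: nondecreasing_cvgn_le; last exact: is_cvg_series_exp_coeff.
    by apply: nondecreasing_series => k _ _; apply: exp_coeff_ge0.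
  rewrite /series /= big_mkord big_split_ord /= mulrDr mulr_sumr.
  apply: (@le_trans _ _ (\sum_(k < N) `|t| ^+ 3 * exp_coeff c (3 + k)%N)); last first.
    rewrite mulr_sumr lerDr; apply: sumr_ge0 => k _.
    by rewrite mulr_ge0 ?exprn_ge0 // exp_coeff_ge0.
  apply: ler_sum => k _; rewrite mxE normrM.
  rewrite (_ : exp_coeff c (3 + k)%N = c ^+ (3 + k) / (3 + k)`!%:R) //.
  rewrite normrM normrX normfV normr_nat -mulrA.
  apply: ler_pM; [exact: exprn_ge0|by rewrite mulr_ge0 ?invr_ge0| |].
    by rewrite exprD ler_piMr ?exprn_ge0 // exprn_ile1.
  by rewrite mulrC ler_wpM2r ?invr_ge0 // norm_exprmx.
have cv : `|(expmx_part (N + 3)%N (t *: X) - expmx_part 3 (t *: X)) i j| @[N --> \oo]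
    --> `|(expmx (t *: X) - expmx_part 3 (t *: X)) i j|.
  apply: cvg_norm; rewrite [X in _ --> X]mxE [X in _ + X]mxE.
  under eq_cvg do rewrite mxE [X in _ + X]mxE.
  by apply: cvgB; [rewrite (cvg_shiftn 3 (fun N => expmx_part N (t *: X) i j));
    apply: expmx_cvg|apply: cvg_cst].
apply: (cvgr_to_le cv); near=> N; rewrite addnC; exact: bound.
Unshelve. all: by end_near.
Qed.

End MatrixExponential.

(** * Recognition of first order statements *)

Section Walks.
Variables (K : rcfType) (n : nat).

(** Under nested quantifiers a bound variable is read from iterated tails of the list. A walk is a
    mere renumbering of the variables, so what is read after it is still a variable. *)
Definition walk (g : forall L : rcfType, {rmorphism K -> L} -> seq L -> seq L) :=
  exists s : nat -> nat, forall (L : rcfType) (i : {rmorphism K -> L}) e k, (g L i e)`_k = e`_(s k).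

Lemma walk_id : walk (fun L i e => e).
Proof. by exists id. Qed.

Lemma walk_tail g : walk g -> walk (fun L i e => mx_tail n (g L i e)).
Proof.
by move=> [s gs]; exists (fun k => s (n * n + k)%N) => L i e k; rewrite nth_drop gs.
Qed.

Lemma walk_behead g : walk g -> walk (fun L i e => behead (g L i e)).
Proof. by move=> [s gs]; exists (fun k => s k.+1) => L i e k; rewrite nth_behead gs. Qed.

Lemma mxterm_walk g : walk g -> mxterm (fun L i e => mx_head n (g L i e)).
Proof.
move=> [s gs] k l; exists (qe_rcf.Var _ (s (mxvec_index k l))) => L i e.
by rewrite mx_headE gs.
Qed.

Lemma pterm_walk g : walk g -> pterm (fun L (i : {rmorphism K -> L}) e => head 0 (g L i e)).
Proof. by move=> [s gs]; exists (qe_rcf.Var _ (s 0%N)) => L i e; rewrite -nth0 gs. Qed.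

Lemma pterm_entry (X : mx_family K n) k l : mxterm X -> pterm (fun L i e => X L i e k l).
Proof. by move=> pX; apply: pX. Qed.

Lemma pterm1 : pterm (fun L (i : {rmorphism K -> L}) e => 1).
Proof. exact: (pterm_nat K 1). Qed.

Lemma pterm0 : pterm (fun L (i : {rmorphism K -> L}) e => 0).
Proof. exact: (pterm_nat K 0). Qed.

Lemma elementary_iff D E : elementary D -> elementary E ->
  elementary (fun L (i : {rmorphism K -> L}) e => D L i e <-> E L i e).
Proof.
move=> eD eE; apply: elementary_ext
  (elementary_and (elementary_imp eD eE) (elementary_imp eE eD)) => L i e.
by split=> -[].
Qed.

Lemma elementary_points (X : mx_family K n) (P : set (mxpoly K n)) : mxterm X ->
  elementary (fun L i e => points i P (X L i e)).
Proof. exact: mxelementary_points. Qed.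

Lemma elementary_sa (X : mx_family K n) (phi : sa_description K n) : mxterm X ->
  elementary (fun L i e => sa_points i phi (X L i e)).
Proof. exact: mxelementary_sa_points. Qed.

End Walks.

Ltac walk := repeat first [apply: walk_tail | apply: walk_behead | apply: walk_id].

(** A hook for [elem], redefined when new elementary notions become available. *)
Ltac elem_user := fail.

Ltac elem := repeat first
  [ assumption
  | elem_user
  | apply: elementary_points | apply: elementary_sa
  | apply: elementary_allmx | apply: elementary_exmx
  | apply: elementary_allsc | apply: elementary_exsc
  | apply: elementary_iff
  | apply: elementary_and | apply: elementary_or | apply: elementary_not
  | apply: elementary_eqmx | apply: elementary_lt | apply: elementary_le
  | apply: elementary_eq
  | apply: elementary_all => ?
  | apply: elementary_exfin => ?
  | apply: elementary_cst
  | apply: elementary_imp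
  | apply: mxterm_mul | apply: mxterm_add | apply: mxterm_tr
  | apply: mxterm_cst | apply: mxterm1 | apply: mxterm0 | apply: mxterm_scale
  | apply: mxterm_exp | apply: mxterm_sum => ?
  | apply: mxterm_walk; walk
  | apply: pterm_det | apply: pterm_mxeval | apply: pterm_walk; walk
  | apply: pterm_add | apply: pterm_mul | apply: pterm_opp
  | apply: pterm0 | apply: pterm1 | apply: pterm_cst | apply: pterm_nat
  | apply: pterm_exp
  | apply: pterm_entry ].

(** * Points of algebraic groups over real closed extensions *)

Section RationalPoints.
Variables (K : rcfType) (n : nat) (G : set (mxpoly K n)).

Lemma geom_points_real (x : 'M[K]_n) :
  geom_points G (map_mx (real_complex K) x) <-> points idfun G x.
Proof.
have E p : mxeval (real_complex K) p (map_mx (real_complex K) x) =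
    real_complex K (mxeval idfun p x) by apply: mxeval_map.
split=> Gx p Gp; have := Gx p Gp; last by rewrite /= E => ->; rewrite rmorph0.
by rewrite E => /eqP; rewrite fmorph_eq0 => /eqP.
Qed.

(** The hypothesis concerns K[i], to which transfer does not apply: as in the lemmas that follow, it
    is first restricted to the points over [K], and then transferred to [L]. *)
Lemma geom_points_det1 : geom_points G `<=` [set x | \det x = 1] ->
  forall (L : rcfType) (i : {rmorphism K -> L}) x, points i G x -> \det x = 1.
Proof.
move=> Gdet L i.
apply: (@elementary_transfer K (fun L i => forall x : 'M[L]_n, points i G x -> \det x = 1)
  _ K idfun L i); first by elem.
move=> x /geom_points_real /Gdet /=; rewrite det_map_mx.
by rewrite -(rmorph1 (real_complex K)) => /fmorph_inj.
Qed.

Lemma geom_points_mul : mx_group (geom_points G) ->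
  forall (L : rcfType) (i : {rmorphism K -> L}) x y,
  points i G x -> points i G y -> points i G (x *m y).
Proof.
move=> [_ _ GM _] L i.
apply: (@elementary_transfer K (fun L i => forall x y : 'M[L]_n, points i G x ->
  points i G y -> points i G (x *m y)) _ K idfun L i); first by elem.
move=> x y /geom_points_real Gx /geom_points_real Gy; apply/geom_points_real.
by rewrite map_mxM; apply: GM.
Qed.

Lemma geom_points1 : mx_group (geom_points G) ->
  forall (L : rcfType) (i : {rmorphism K -> L}), points i G 1%:M.
Proof.
move=> [_ G1 _ _] L i.
apply: (@elementary_transfer K (fun L i => points i G 1%:M) _ K idfun L i); first by elem.
by apply/geom_points_real; rewrite map_mx1.
Qed.

Lemma geom_points_unit : mx_group (geom_points G) ->
  forall (L : rcfType) (i : {rmorphism K -> L}) x, points i G x -> x \in unitmx.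
Proof.
move=> [GU _ _ _] L i x Gx; rewrite unitmxE unitfE; apply/eqP; move: x Gx.
apply: (@elementary_transfer K (fun L i => forall x : 'M[L]_n, points i G x ->
  \det x <> 0) _ K idfun L i); first by elem.
move=> x /geom_points_real /GU /=; rewrite unitmxE unitfE det_map_mx fmorph_eq0.
by move/eqP.
Qed.

Lemma geom_points_inv : mx_group (geom_points G) ->
  forall (L : rcfType) (i : {rmorphism K -> L}) x,
  points i G x -> points i G (invmx x).
Proof.
move=> Ggrp L i x Gx.
have xU := geom_points_unit Ggrp Gx; have [_ _ _ GV] := Ggrp.
suff: exists y, points i G y /\ x *m y = 1%:M.
  by move=> [y [Gy xy]]; rewrite (_ : invmx x = y) // -[RHS](mulKmx xU) xy mulmx1.
move: x Gx {xU}.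
apply: (@elementary_transfer K (fun L i => forall x : 'M[L]_n, points i G x ->
  exists y, points i G y /\ x *m y = 1%:M) _ K idfun L i); first by elem.
move=> x Gx; exists (invmx x); split.
  by apply/geom_points_real; rewrite map_invmx; apply/GV/geom_points_real.
exact: mulmxV (geom_points_unit Ggrp Gx).
Qed.

Lemma geom_points_tr : self_adjoint G ->
  forall (L : rcfType) (i : {rmorphism K -> L}) x, points i G x -> points i G x^T.
Proof.
move=> Gsa L i.
apply: (@elementary_transfer K (fun L i => forall x : 'M[L]_n, points i G x ->
  points i G x^T) _ K idfun L i); first by elem.
move=> x /geom_points_real Gx; apply/geom_points_real.
by rewrite -map_trmx; apply: Gsa.
Qed.

Lemma geom_points_sym : (forall s, geom_points G s -> s = s^T) ->
  forall (L : rcfType) (i : {rmorphism K -> L}) x, points i G x -> x^T = x.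
Proof.
move=> Gs L i.
apply: (@elementary_transfer K (fun L i => forall x : 'M[L]_n, points i G x ->
  x^T = x) _ K idfun L i); first by elem.
move=> x /geom_points_real /Gs h.
by apply/matrixP => a b; move/matrixP/(_ a b): h; rewrite !mxE => /fmorph_inj.
Qed.

Lemma geom_points_diag (P : 'M[K]_n) : P \in unitmx ->
  (forall t, geom_points G t -> is_diag_mx
     (map_mx (real_complex K) P *m t *m invmx (map_mx (real_complex K) P))) ->
  forall (L : rcfType) (i : {rmorphism K -> L}) x, points i G x ->
  forall k l, k != l -> (map_mx i P *m x *m map_mx i (invmx P)) k l = 0.
Proof.
move=> PU Gd L i.
apply: (@elementary_transfer K (fun L i => forall x : 'M[L]_n, points i G x ->
  forall k l, k != l -> (map_mx i P *m x *m map_mx i (invmx P)) k l = 0) _ K idfun L i).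
  by elem.
move=> x /geom_points_real /Gd /is_diag_mxP d k l kl.
have := d k l; rewrite val_eqE -map_invmx -!map_mxM mxE => /(_ kl) /eqP.
rewrite fmorph_eq0 => /eqP <-; congr (fun_of_matrix _ k l).
by congr (_ *m _ *m _); apply/matrixP => a b; rewrite mxE.
Qed.

End RationalPoints.

Lemma geom_points_sub (K : rcfType) n (G S : set (mxpoly K n)) : geom_points S `<=` geom_points G ->
  forall (L : rcfType) (i : {rmorphism K -> L}), points i S `<=` points i G.
Proof.
move=> SG L i.
apply: (@elementary_transfer K (fun L i => forall x : 'M[L]_n, points i S x ->
  points i G x) _ K idfun L i); first by elem.
by move=> x /geom_points_real Sx; apply/geom_points_real; apply: SG.
Qed.

(** * The positive part of the torus *)

Section ExponentialCurves.
Variables (R : realType).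

Definition exp_sum (f : R -> R) :=
  exists r : seq (R * R), forall t, f t = \sum_(a <- r) a.1 * expR (t * a.2).

Lemma exp_sum_ext f g : f =1 g -> exp_sum f -> exp_sum g.
Proof. by move=> /funext->. Qed.

Lemma exp_sum_exp c b : exp_sum (fun t => c * expR (t * b)).
Proof. by exists [:: (c, b)] => t; rewrite big_seq1. Qed.

Lemma exp_sum_cst c : exp_sum (fun=> c).
Proof. by apply: exp_sum_ext (exp_sum_exp c 0) => t; rewrite mulr0 expR0 mulr1. Qed.

Lemma exp_sumD f g : exp_sum f -> exp_sum g -> exp_sum (fun t => f t + g t).
Proof.
by move=> [r fr] [s gs]; exists (r ++ s) => t; rewrite big_cat /= -fr -gs.
Qed.

Lemma exp_sumM f g : exp_sum f -> exp_sum g -> exp_sum (fun t => f t * g t).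
Proof.
move=> [r fr] [s gs]; exists [seq (a.1 * b.1, a.2 + b.2) | a <- r, b <- s] => t.
rewrite fr gs big_allpairs_dep /= mulr_suml; apply: eq_bigr => a _.
rewrite mulr_sumr; apply: eq_bigr => b _.
by rewrite mulrDr expRD mulrACA.
Qed.

Lemma exp_sum_sum (I : Type) (r : seq I) (f : I -> R -> R) :
  (forall k, exp_sum (f k)) -> exp_sum (fun t => \sum_(k <- r) f k t).
Proof.
move=> ef; elim: r => [|k r IHr].
  by apply: exp_sum_ext (exp_sum_cst 0) => t; rewrite big_nil.
by apply: exp_sum_ext (exp_sumD (ef k) IHr) => t; rewrite big_cons.
Qed.

(** On the naturals, distinct exponents give distinct characters, so a linear relation there passes
    to the values at any real t. *)
Lemma exp_sum_eq0 f : exp_sum f -> (forall m : nat, f m%:R = 0) -> forall t, f t = 0.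
Proof.
move=> [r fr] f0 t; rewrite fr.
apply: (@dedekind_independence R nat (fun=> Logic.True) addn 0%N _ r fst
  (fun a m => expR (m%:R * a.2))) => //.
- by move=> a; rewrite mul0r expR0.
- by move=> a x y _ _; rewrite natrD mulrDl expRD.
- by move=> a b /(_ 1%N I); rewrite !mul1r => /expR_inj->.
by move=> m _; rewrite -fr.
Qed.

Variable n : nat.
Implicit Types (Q X : 'M[R]_n) (d : 'rV[R]_n).

Definition exp_curve Q d t := invmx Q *m diag_mx (\row_k expR (t * d 0 k)) *m Q.

Lemma exp_curveD Q d s t : Q \in unitmx ->
  exp_curve Q d (s + t) = exp_curve Q d s *m exp_curve Q d t.
Proof.
move=> QU; rewrite /exp_curve !mulmxA mulmxK // -[X in _ = X *m _]mulmxA mulmx_diag.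
by congr (_ *m diag_mx _ *m _); apply/rowP => k; rewrite !mxE mulrDl expRD.
Qed.

Lemma exp_curve0 Q d : Q \in unitmx -> exp_curve Q d 0 = 1%:M.
Proof.
move=> QU; rewrite /exp_curve (_ : diag_mx _ = 1%:M) ?mulmx1 ?mulVmx //.
by apply/matrixP => k l; rewrite !mxE mul0r expR0.
Qed.

Lemma exp_curve_natmul Q d m : Q \in unitmx ->
  exp_curve Q d m%:R = exp_curve Q d 1 ^+ m.
Proof.
move=> QU; elim: m => [|m IHm]; first by rewrite exp_curve0.
by rewrite -natr1 addrC exp_curveD // IHm exprS.
Qed.

Lemma expmx_curve Q d t : Q \in unitmx ->
  expmx (t *: (invmx Q *m diag_mx d *m Q)) = exp_curve Q d t.
Proof.
move=> QU; rewrite -{2}(invmxK Q) scalemxAl scalemxAr expmx_conj ?unitmx_inv //.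
rewrite invmxK -linearZ expmx_diag; congr (_ *m diag_mx _ *m _).
by apply/rowP => k; rewrite !mxE.
Qed.

(** A polynomial along the curve is an exponential sum in t. Thus a positive element whose powers
    lie in an algebraic group generates a one-parameter subgroup inside it. *)
Lemma points_exp_curve (K : rcfType) (i : {rmorphism K -> R}) (G : set (mxpoly K n)) Q d :
  (forall m : nat, points i G (exp_curve Q d m%:R)) ->
  forall t, points i G (exp_curve Q d t).
Proof.
move=> Gm t p Gp; move: t; apply: exp_sum_eq0; last by move=> m; apply: Gm.
apply: mxeval_ind => [c|k l|f g|f g]; [exact: exp_sum_cst| |exact: exp_sumD|exact: exp_sumM].
apply: (@exp_sum_ext (fun t => \sum_j (invmx Q k j * Q j l) * expR (t * d 0 j))).
  move=> t; rewrite /exp_curve mxE; apply: eq_bigr => j _.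
  by rewrite mul_mx_diag !mxE mulrAC.
by apply: exp_sum_sum => j; apply: exp_sum_exp.
Qed.

Lemma exp_curve_cvg Q d t : mxcvg_to (nbhs t) (exp_curve Q d) (exp_curve Q d t).
Proof.
apply: mxcvg_mul; last exact: mxcvg_cst.
apply: mxcvg_mul; first exact: mxcvg_cst.
move=> k l; rewrite !mxE; under eq_cvg do rewrite !mxE.
case: eqP => _; rewrite ?mulr1n ?mulr0n; last exact: cvg_cst.
apply: (@cvg_comp _ _ _ (fun s => s * d 0 k) expR); last exact: continuous_expR.
by apply: cvgM; [apply: cvg_id|apply: cvg_cst].
Qed.

End ExponentialCurves.

Section SplitComponent.
Variables (K : rcfType) (n : nat) (P : 'M[K]_n).
Hypothesis PU : P \in unitmx.

Definition weight (L : fieldType) (i : {rmorphism K -> L}) (x : 'M[L]_n) k : L :=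
  (map_mx i P *m x *m map_mx i (invmx P)) k k.

Definition diag_in_basis (L : fieldType) (i : {rmorphism K -> L}) (x : 'M[L]_n) :=
  forall k l, k != l -> (map_mx i P *m x *m map_mx i (invmx P)) k l = 0.

Section Field.
Variables (L : fieldType) (i : {rmorphism K -> L}).

Lemma map_unit : map_mx i P \in unitmx.
Proof. by rewrite map_unitmx. Qed.

Lemma map_mulmxV : map_mx i P *m map_mx i (invmx P) = 1%:M.
Proof. by rewrite -map_mxM mulmxV // map_mx1. Qed.

Lemma map_mulVmx : map_mx i (invmx P) *m map_mx i P = 1%:M.
Proof. by rewrite -map_mxM mulVmx // map_mx1. Qed.

Lemma diag_in_basisE x : diag_in_basis i x ->
  x = map_mx i (invmx P) *m diag_mx (\row_k weight i x k) *m map_mx i P.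
Proof.
move=> xd; have -> : diag_mx (\row_k weight i x k) =
    map_mx i P *m x *m map_mx i (invmx P).
  apply/matrixP => k l; rewrite mxE [X in X *+ _]mxE; have [->|kl] := eqVneq k l.
    by rewrite mulr1n.
  by rewrite mulr0n [RHS]xd.
by rewrite !mulmxA map_mulVmx mul1mx -mulmxA map_mulVmx mulmx1.
Qed.

Lemma weight_diag (d : 'rV[L]_n) k :
  weight i (map_mx i (invmx P) *m diag_mx d *m map_mx i P) k = d 0 k.
Proof.
rewrite /weight !mulmxA map_mulmxV mul1mx -mulmxA map_mulmxV mulmx1.
by rewrite mxE eqxx mulr1n.
Qed.

Lemma diag_in_basis_diag (d : 'rV[L]_n) :
  diag_in_basis i (map_mx i (invmx P) *m diag_mx d *m map_mx i P).
Proof.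
move=> k l kl; rewrite !mulmxA map_mulmxV mul1mx -mulmxA map_mulmxV mulmx1.
by rewrite mxE (negbTE kl).
Qed.

Lemma conj_diag_mul (d1 d2 : 'rV[L]_n) :
  map_mx i (invmx P) *m diag_mx d1 *m map_mx i P *m
    (map_mx i (invmx P) *m diag_mx d2 *m map_mx i P) =
  map_mx i (invmx P) *m (diag_mx d1 *m diag_mx d2) *m map_mx i P.
Proof.
by rewrite !mulmxA -[X in X *m diag_mx d2 *m _]mulmxA map_mulmxV mulmx1.
Qed.

Lemma diag_in_basisM x y : diag_in_basis i x -> diag_in_basis i y ->
  diag_in_basis i (x *m y).
Proof.
move=> xd yd; rewrite (diag_in_basisE xd) (diag_in_basisE yd) conj_diag_mul mulmx_diag.
exact: diag_in_basis_diag.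
Qed.

Lemma diag_in_basis_weightM x y k : diag_in_basis i x -> diag_in_basis i y ->
  weight i (x *m y) k = weight i x k * weight i y k.
Proof.
move=> xd yd; rewrite {1}(diag_in_basisE xd) {1}(diag_in_basisE yd).
by rewrite conj_diag_mul mulmx_diag weight_diag !mxE.
Qed.

Lemma diag_in_basisC x y : diag_in_basis i x -> diag_in_basis i y ->
  x *m y = y *m x.
Proof.
move=> xd yd; rewrite (diag_in_basisE xd) (diag_in_basisE yd).
by rewrite !conj_diag_mul diag_mxC.
Qed.

Lemma weight1 k : weight i 1%:M k = 1.
Proof. by rewrite /weight mulmx1 map_mulmxV mxE eqxx. Qed.

Lemma diag_in_basis1 : diag_in_basis i 1%:M.
Proof. by move=> k l kl; rewrite mulmx1 map_mulmxV mxE (negbTE kl). Qed.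

Lemma diag_in_basisV x : x \in unitmx -> diag_in_basis i x -> diag_in_basis i (invmx x).
Proof.
move=> xU xd.
have w0 k : weight i x k != 0.
  apply/eqP => w0; move: xU; rewrite {1}(diag_in_basisE xd) !unitmx_mul => /andP[/andP[_]].
  rewrite unitmxE det_diag unitfE => /prodf_neq0/(_ k isT).
  by rewrite mxE w0 eqxx.
have D : diag_mx (\row_k weight i x k) *m diag_mx (\row_k (weight i x k)^-1) = 1%:M.
  by rewrite mulmx_diag; apply/matrixP => k l; rewrite !mxE divff.
pose y := map_mx i (invmx P) *m diag_mx (\row_k (weight i x k)^-1) *m map_mx i P.
have xy : x *m y = 1%:M.
  by rewrite [X in X *m _](diag_in_basisE xd) conj_diag_mul D mulmx1 map_mulVmx.
by rewrite -[invmx x]mulmx1 -xy mulKmx //; apply: diag_in_basis_diag.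
Qed.

End Field.

Variable S : set (mxpoly K n).
Hypothesis Sgrp : mx_group (geom_points S).
Hypothesis Sdiag : forall (L : rcfType) (i : {rmorphism K -> L}) x, points i S x ->
  diag_in_basis i x.

Lemma torus_diagE (L : rcfType) (i : {rmorphism K -> L}) x : points i S x ->
  x = map_mx i (invmx P) *m diag_mx (\row_k weight i x k) *m map_mx i P.
Proof. by move=> /Sdiag/diag_in_basisE. Qed.

Lemma weightM (L : rcfType) (i : {rmorphism K -> L}) x y k :
  points i S x -> points i S y -> weight i (x *m y) k = weight i x k * weight i y k.
Proof. by move=> /Sdiag xd /Sdiag; apply: diag_in_basis_weightM. Qed.

Lemma weight_neq0 (L : rcfType) (i : {rmorphism K -> L}) x k :
  points i S x -> weight i x k != 0.
Proof.
move=> Sx; apply/eqP => w0.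
have := weight1 i k; rewrite -(mulmxV (geom_points_unit Sgrp Sx)) weightM //.
  by rewrite w0 mul0r => /eqP; rewrite eq_sym oner_eq0.
exact: geom_points_inv.
Qed.

(** A first order substitute for the component of the identity; the two are identified in
    [sa_component_positive_part]. *)
Definition positive_part (L : rcfType) (i : {rmorphism K -> L}) (x : 'M[L]_n) :=
  points i S x /\ forall k, 0 < weight i x k.

Lemma elementary_positive_part X : mxterm X ->
  elementary (fun L i e => positive_part i (X L i e)).
Proof. by move=> pX; rewrite /positive_part /weight; elem. Qed.

Lemma positive_part1 (L : rcfType) (i : {rmorphism K -> L}) : positive_part i 1%:M.
Proof. by split=> [|k]; [apply: geom_points1|rewrite weight1 ltr01]. Qed.

Lemma positive_partM (L : rcfType) (i : {rmorphism K -> L}) x y :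
  positive_part i x -> positive_part i y -> positive_part i (x *m y).
Proof.
move=> [Sx x0] [Sy y0]; split=> [|k]; first exact: geom_points_mul.
by rewrite weightM ?mulr_gt0.
Qed.

Lemma positive_partV (L : rcfType) (i : {rmorphism K -> L}) x :
  positive_part i x -> positive_part i (invmx x).
Proof.
move=> [Sx x0]; have SVx := geom_points_inv Sgrp Sx; split=> // k.
have := weight1 i k; rewrite -(mulmxV (geom_points_unit Sgrp Sx)) weightM // => h.
by rewrite -(pmulr_rgt0 _ (x0 k)) h ltr01.
Qed.

Lemma positive_part_comm (L : rcfType) (i : {rmorphism K -> L}) x y :
  points i S x -> points i S y -> x *m y = y *m x.
Proof.
by move=> /Sdiag xd /Sdiag; apply: diag_in_basisC.
Qed.

Variables (R : realType) (iR : {rmorphism K -> R}).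

Lemma positive_part_curve x : positive_part iR x ->
  exists d, x = exp_curve (map_mx iR P) d 1 /\
    forall t, positive_part iR (exp_curve (map_mx iR P) d t).
Proof.
move=> [Sx x0]; pose d := \row_k ln (weight iR x k).
have dx : x = exp_curve (map_mx iR P) d 1.
  rewrite {1}(torus_diagE Sx) /exp_curve -map_invmx; congr (_ *m diag_mx _ *m _).
  by apply/rowP => k; rewrite !mxE mul1r lnK // posrE.
exists d; split=> // t; split; last first.
  by move=> k; rewrite /exp_curve -map_invmx weight_diag mxE expR_gt0.
move: t; apply: points_exp_curve => m; rewrite exp_curve_natmul ?map_unit // -dx.
elim: m => [|m IHm]; first by rewrite expr0; apply: geom_points1.
by rewrite exprS; apply: geom_points_mul.
Qed.

Lemma weight_closed (k : 'I_n) (Z : set K) : closed Z ->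
  closed [set x : 'M[K]_n | Z (weight idfun x k)].
Proof.
move=> Zc; apply: (@closed_comp _ _ (fun x : 'M[K]_n => weight idfun x k)) Zc.
move=> x _; rewrite /weight.
have : mxcvg_to (nbhs x) (fun x : 'M[K]_n => map_mx idfun P *m x *m map_mx idfun (invmx P))
    (map_mx idfun P *m x *m map_mx idfun (invmx P)).
  apply: mxcvg_mul; last exact: mxcvg_cst.
  apply: mxcvg_mul; first exact: mxcvg_cst.
  by move=> a b; apply: coord_continuous.
exact.
Qed.

Lemma sa_points_map (phi : sa_description K n) (L : rcfType) (i : {rmorphism K -> L})
    (x : 'M[K]_n) : sa_points i phi (map_mx i x) <-> sa_points idfun phi x.
Proof.
apply: eq_iff; apply: eq_has => c.
have E p : mxeval i p (map_mx i x) = i (mxeval idfun p x) by apply: mxeval_map.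
by congr andb; apply: eq_all => p; rewrite E ?fmorph_eq0 ?rcf_morph_gt0.
Qed.

Lemma positive_part_map (L : rcfType) (i : {rmorphism K -> L}) (x : 'M[K]_n) :
  positive_part i (map_mx i x) <-> positive_part idfun x.
Proof.
have [phi phiP] := mxelementary_sa elementary_positive_part.
by rewrite !phiP; apply: sa_points_map.
Qed.

(** Closedness quantifies over sets. For a semialgebraic set this formulation with a radius is first
    order, hence can be carried to R. *)
Lemma closed_in_elementary (phi : sa_description K n) :
  closed_in (sa_points idfun phi) [set x | positive_part idfun x] ->
  forall x, positive_part idfun x -> ~ sa_points idfun phi x ->
  exists e : K, 0 < e /\ forall y, positive_part idfun y ->
    (forall k l, y k l - x k l < e /\ x k l - y k l < e) -> ~ sa_points idfun phi y.
Proof.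
move=> [Z Zc phiZ] x Cx nx.
have nZx : (~` Z) x by move=> Zx; apply: nx; rewrite phiZ.
have : nbhs x (~` Z) by apply: open_nbhs_nbhs; split=> //; apply: closed_openC.
move=> /nbhs_ballP[e e0 xeZ]; exists e; split=> // y Cy yx; rewrite phiZ => -[_ Zy].
apply: (xeZ y) Zy; split=> // k l; have [h1 h2] := yx k l.
by rewrite /ball /= ltr_norml h2 andbT ltrNl opprB.
Qed.

(* Connectedness transfers to the reals, where points are joined by exponential
   curves. *)
Lemma positive_part_connected :
  sa_connected [set x : 'M[K]_n | positive_part idfun x].
Proof.
set C := [set x | _].
move=> A B [phiA Aphi] [phiB Bphi] cA cB AB AB0.
apply: contrapT => /not_orP[nA nB].
have [x0 [Cx0 nAx0]] : exists x, C x /\ ~ A x.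
  apply: contrapT => h; apply: nA; apply/seteqP; split=> x; first by rewrite -AB; left.
  by move=> Cx; apply: contrapT => nAx; apply: h; exists x.
have [y0 [Cy0 nBy0]] : exists x, C x /\ ~ B x.
  apply: contrapT => h; apply: nB; apply/seteqP; split=> x; first by rewrite -AB; right.
  by move=> Cx; apply: contrapT => nAx; apply: h; exists x.
pose opn (phi : sa_description K n) (L : rcfType) (i : {rmorphism K -> L}) :=
  forall x : 'M[L]_n, positive_part i x -> ~ sa_points i phi x ->
  exists e : L, 0 < e /\ forall y : 'M[L]_n, positive_part i y ->
    (forall k l, y k l - x k l < e /\ x k l - y k l < e) -> ~ sa_points i phi y.
have opnR phi : opn phi K idfun -> opn phi R iR.
  apply: elementary_transfer; rewrite /opn.
  apply: elementary_allmx; apply: elementary_imp.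
    by apply: elementary_positive_part; elem.
  apply: elementary_imp; first by elem.
  apply: elementary_exsc; apply: elementary_and; first by elem.
  apply: elementary_allmx; apply: elementary_imp; last by elem.
  by apply: elementary_positive_part; elem.
have oA : opn phiA R iR.
  by apply: opnR; apply: closed_in_elementary; rewrite -Aphi.
have oB : opn phiB R iR.
  by apply: opnR; apply: closed_in_elementary; rewrite -Bphi.
have cover : forall x : 'M[R]_n, positive_part iR x ->
    sa_points iR phiA x \/ sa_points iR phiB x.
  apply: (@elementary_transfer K (fun L i => forall x : 'M[L]_n, positive_part i x ->
    sa_points i phiA x \/ sa_points i phiB x) _ K idfun R iR).
    apply: elementary_allmx; apply: elementary_imp; last by elem.
    by apply: elementary_positive_part; elem.
  by move=> x Cx; rewrite -Aphi -Bphi; have : C x by []; rewrite -AB.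
have disj : forall x : 'M[R]_n, sa_points iR phiA x -> ~ sa_points iR phiB x.
  apply: (@elementary_transfer K (fun L i => forall x : 'M[L]_n,
    sa_points i phiA x -> ~ sa_points i phiB x) _ K idfun R iR); first by elem.
  by move=> x; rewrite -Aphi -Bphi => Ax Bx; suff : (A `&` B) x by rewrite AB0.
have Cx0R : positive_part iR (map_mx iR x0) by apply/positive_part_map.
have Cy0R : positive_part iR (map_mx iR y0) by apply/positive_part_map.
have [d [zd dC]] := positive_part_curve (positive_partM (positive_partV Cx0R) Cy0R).
(* A curve in the positive part from a point outside A to a point outside B. The two closed sets
   would disconnect the line of parameters. *)
pose c t := map_mx iR x0 *m exp_curve (map_mx iR P) d t.
have Cc t : positive_part iR (c t) by apply: positive_partM.
have c0 : c 0 = map_mx iR x0 by rewrite /c exp_curve0 ?map_unit // mulmx1.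
have c1 : c 1 = map_mx iR y0.
  by rewrite /c -zd mulmxA mulmxV ?mul1mx //; apply: (geom_points_unit Sgrp (proj1 Cx0R)).
have cc t : mxcvg_to (nbhs t) c (c t).
  by apply: mxcvg_mul; [apply: mxcvg_cst|apply: exp_curve_cvg].
have copen phi : opn phi R iR -> open [set t : R | ~ sa_points iR phi (c t)].
  move=> ophi; rewrite openE => t /= nt; have [e [e0 eP]] := ophi _ (Cc t) nt.
  have : \forall s \near t, forall kl : 'I_n * 'I_n, ball (c t kl.1 kl.2) e (c s kl.1 kl.2).
    apply: (@filter_forall R _ (fun kl s => ball (c t kl.1 kl.2) e (c s kl.1 kl.2))
      (nbhs t) (nbhs_filter t)) => kl.
    by have /cvg_ballP/(_ e e0) := cc t kl.1 kl.2.
  apply: filterS => s sP; apply: eP => // k l; have := sP (k, l).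
  rewrite /ball /= ltr_norml => /andP[h1 h2]; split=> //.
  by move: h1; rewrite ltrNl opprB.
have nAB t : ~ sa_points iR phiB (c t) <-> sa_points iR phiA (c t).
  by split=> [|/disj //]; case: (cover _ (Cc t)).
have nBA t : ~ sa_points iR phiA (c t) <-> sa_points iR phiB (c t).
  by split=> [|Bt At]; [case: (cover _ (Cc t))|apply: disj Bt].
have Rconn : connected [set: R] by apply/connected_intervalP.
pose U := [set t : R | ~ sa_points iR phiB (c t)].
have UT : U = setT.
  apply: Rconn.
  - exists 1; apply/nAB; apply: contrapT => /nBA; rewrite c1 sa_points_map -Bphi.
    by [].
  - by exists U; [exact: copen|rewrite setTI].
  - exists U; last by rewrite setTI.
    rewrite -[U]setCK; apply: open_closedC.
    rewrite (_ : ~` U = [set t : R | ~ sa_points iR phiA (c t)]); first exact: copen.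
    apply/seteqP; split=> t /=; first by move=> /contrapT Bt; apply/nBA.
    by move=> /nBA Bt; apply.
have : U 0 by rewrite UT.
by move/nAB; rewrite c0 sa_points_map -Aphi.
Qed.

(** Weights do not vanish on S, so positivity of all of them is both an open and a closed condition;
    a connected set through the identity satisfies it. *)
Lemma sa_component_positive_part :
  sa_component (points idfun S) 1%:M = [set x : 'M[K]_n | positive_part idfun x].
Proof.
have [phi0 phi0P] := mxelementary_sa elementary_positive_part.
apply/seteqP; split=> y /=; last first.
  move=> Cy; exists [set x | positive_part idfun x]; split=> //.
  - by exists phi0; apply/seteqP; split=> x /= /phi0P.
  - exact: positive_part_connected.
  - by move=> x [].
  - exact: positive_part1.
move=> [C [[phi Cphi] Cconn CS C1 Cy]]; split; first exact: CS.
pose A : set 'M[K]_n := C `&` [set x | forall k, 0 < weight idfun x k].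
pose B : set 'M[K]_n := C `&` [set x | exists k, weight idfun x k < 0].
have [|||||||] // := Cconn A B.
- have [psi psiP] : exists psi : sa_description K n, forall (L : rcfType)
      (i : {rmorphism K -> L}) x,
      (sa_points i phi x /\ forall k, 0 < weight i x k) <-> sa_points i psi x.
    by apply: mxelementary_sa => X pX; rewrite /weight; elem.
  by exists psi; rewrite /A Cphi; apply/seteqP; split=> x /= /psiP.
- have [psi psiP] : exists psi : sa_description K n, forall (L : rcfType)
      (i : {rmorphism K -> L}) x,
      (sa_points i phi x /\ exists k, weight i x k < 0) <-> sa_points i psi x.
    by apply: mxelementary_sa => X pX; rewrite /weight; elem.
  by exists psi; rewrite /B Cphi; apply/seteqP; split=> x /= /psiP.
- exists [set x | forall k, 0 <= weight idfun x k].
    rewrite (_ : mkset _ = \bigcap_k [set x | 0 <= weight idfun x k]).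
      by apply: closed_bigI => k _; apply: (@weight_closed k [set x | 0 <= x]); exact: closed_ge.
    by apply/seteqP; split=> x /= h k; [move=> _|]; apply: h.
  apply/seteqP; split=> x [Cx xk]; split=> // k; first exact: ltW.
  by rewrite lt_neqAle eq_sym weight_neq0 ?xk //; apply: CS.
- exists (~` [set x | forall k, 0 < weight idfun x k]).
    rewrite (_ : ~` _ = \bigcup_(k in [set: 'I_n]) [set x | weight idfun x k <= 0]).
      apply: closed_bigcup => [|k _]; first exact: cardinality.finite_finset.
      by apply: (@weight_closed k [set x | x <= 0]); exact: closed_le.
    apply/seteqP; split=> x /=.
      move=> h; apply: contrapT => nk; apply: h => k; rewrite ltNge; apply/negP => xk.
      by apply: nk; exists k.
    by move=> [k _ /= xk] /(_ k); rewrite ltNge xk.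
  apply/seteqP; split=> x [Cx]; first by move=> [k xk]; split=> // /(_ k); rewrite ltNge ltW.
  move=> nx; split=> //=; apply: contrapT => nk; apply: nx => k.
  rewrite lt_neqAle eq_sym weight_neq0 ?andTb; last exact: CS.
  by rewrite leNgt; apply/negP => xk; apply: nk; exists k.
- apply/seteqP; split=> x; first by case=> -[].
  move=> Cx; have [h|nk] := pselect (exists k, weight idfun x k < 0); first by right.
  left; split=> // k; rewrite lt_neqAle eq_sym weight_neq0 ?andTb; last exact: CS.
  by rewrite leNgt; apply/negP => xk; apply: nk; exists k.
- by apply/seteqP; split=> // x [[_ xk] [_ [k]]]; rewrite ltNge ltW // xk.
- by move=> CA; move: Cy; rewrite -CA => -[].
- move=> BC; move: C1; rewrite -BC => -[_ [k]].
  by rewrite weight1 ltNge ler01.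
Qed.

Lemma split_component_positive_part (L : rcfType) (i : {rmorphism K -> L}) :
  split_component i S = [set x | positive_part i x].
Proof.
rewrite /split_component sa_component_positive_part.
exact: (sa_extension_elementary elementary_positive_part).
Qed.

End SplitComponent.

(** The spectral theorem over K[i] gives eigenvalues in K. The product of the X - r over the
    distinct eigenvalues r is a polynomial over K with simple roots that kills q, so q is
    diagonalizable over K. *)
Lemma symmetric_diagonalizable (K : rcfType) n (q : 'M[K]_n) : q^T = q ->
  diagonalizable q.
Proof.
case: n q => [|n] q qT; first by exists 1%:M; rewrite ?unitmx1 //; apply/is_diag_mxP => -[].
pose Q := map_mx (real_complex K) q.
have Qsym : Q \is hermsymmx.
  apply: realsym_hermsym.
    by apply/is_hermitianmxP; rewrite expr0 scale1r map_mx_id // map_trmx qT.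
  by apply/mxOverP => i j; rewrite mxE; apply/complex_realP; exists (q i j).
have /orthomx_spectralP QE := hermitian_normalmx Qsym.
have /mxOverP dreal := hermitian_spectral_diag_real Qsym.
set d := spectral_diag Q in QE dreal; set U := spectralmx Q in QE.
have UU : U \in unitmx := spectral_unit Q.
pose rs := undup [seq complex.Re (d 0 i) | i <- enum 'I_n.+1].
have dE i : d 0 i = real_complex K (complex.Re (d 0 i)).
  by have /complex_realP[x ->] := dreal 0 i.
apply/diagonalizableP; exists rs; first exact: undup_uniq.
apply: mxminpoly_min; apply: (map_mx_inj (f := real_complex K)).
rewrite map_horner_mx rmorph0.
set p := map_poly _ _; rewrite -/Q QE.
rewrite horner_mx_uconjC //.
rewrite horner_mx_diag (_ : map_mx _ _ = 0) ?raddf0 ?mulmx0 ?mul0mx //.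
apply/rowP => i; rewrite !mxE /p rmorph_prod /= horner_prod.
have ir : complex.Re (d 0 i) \in rs.
  by rewrite mem_undup; apply/mapP; exists i; rewrite ?mem_enum.
rewrite (big_rem _ ir) /= rmorphB /= map_polyX map_polyC /= hornerXsubC.
by rewrite -dE subrr mul0r.
Qed.

(** A row v of the basis is a left eigenvector of y y^T with eigenvalue the weight w, and v y y^T
    v^T = w v v^T, where both v y y^T v^T and v v^T are positive sums of squares. *)
Lemma gram_weight_gt0 (K : rcfType) n (P x : 'M[K]_n) (L : rcfType)
    (i : {rmorphism K -> L}) (y : 'M[L]_n) :
  P \in unitmx -> y \in unitmx -> diag_in_basis P i (y *m y^T) ->
  forall k, 0 < weight P i (y *m y^T) k.
Proof.
move=> PU yU yd k; pose v := row k (map_mx i P).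
have vE : v *m (y *m y^T) = weight P i (y *m y^T) k *: v.
  rewrite {1}(diag_in_basisE PU yd) !mulmxA /v -row_mul map_mulmxV //.
  rewrite -!row_mul mul1mx mul_diag_mx; apply/rowP => j; rewrite !mxE.
  by [].
have v0 : v != 0.
  rewrite /v; apply/eqP => v0; have := map_unit PU i; rewrite -row_free_unit.
  move=> /row_freeP[Q /(congr1 (row k))]; rewrite row_mul v0 mul0mx.
  by move=> /rowP/(_ k); rewrite !mxE eqxx => /eqP; rewrite eq_sym oner_eq0.
have sq0 (w : 'rV[L]_n) : w != 0 -> 0 < (w *m w^T) 0 0.
  move=> /rV0Pn[j wj]; rewrite mxE (bigD1 j) //= mxE ltr_pwDl //.
    by rewrite -expr2 exprn_even_gt0.
  by apply: sumr_ge0 => a _; rewrite mxE -expr2 sqr_ge0.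
have vy0 : v *m y != 0.
  by apply: contraNneq v0 => h; rewrite -[v](mulmxK yU) h mul0mx.
have := sq0 _ vy0; rewrite trmx_mul mulmxA -(mulmxA v) vE -scalemxAl mxE.
by rewrite pmulr_lgt0 // sq0.
Qed.

(** * Polynomial functions and Zariski closed sets *)

Section ZariskiClosed.
Variables (D : fieldType) (n : nat).
Implicit Types X Y : set 'M[D]_n.

Definition polyfun (f : 'M[D]_n -> D) := exists p : mxpoly D n, f = mxeval idfun p.

Lemma polyfun_ext f g : f =1 g -> polyfun f -> polyfun g.
Proof. by move=> /funext->. Qed.

Lemma polyfun_cst c : polyfun (fun=> c).
Proof. by exists (mpoly.mpolyC (n * n) c); apply/funext => x; rewrite mxevalC. Qed.

Lemma polyfun_entry k l : polyfun (fun x => x k l).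
Proof.
by exists (mpoly.mpolyX D (mpoly.mnm1 (mxvec_index k l))); apply/funext => x;
  rewrite mxevalX.
Qed.

Lemma polyfunD f g : polyfun f -> polyfun g -> polyfun (fun x => f x + g x).
Proof. by move=> [p ->] [q ->]; exists (p + q); apply/funext => x; rewrite mxevalD. Qed.

Lemma polyfunM f g : polyfun f -> polyfun g -> polyfun (fun x => f x * g x).
Proof. by move=> [p ->] [q ->]; exists (p * q); apply/funext => x; rewrite mxevalM. Qed.

Lemma polyfunB f g : polyfun f -> polyfun g -> polyfun (fun x => f x - g x).
Proof.
move=> pf pg; apply: polyfun_ext (polyfunD pf (polyfunM (polyfun_cst (-1)) pg)) => x.
by rewrite mulN1r.
Qed.

Lemma polyfunX f m : polyfun f -> polyfun (fun x => f x ^+ m).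
Proof.
move=> pf; elim: m => [|m IHm].
  by apply: polyfun_ext (polyfun_cst 1) => x; rewrite expr0.
by apply: polyfun_ext (polyfunM pf IHm) => x; rewrite exprS.
Qed.

Lemma polyfun_sum (I : Type) (r : seq I) (Q : pred I) (f : I -> 'M[D]_n -> D) :
  (forall j, Q j -> polyfun (f j)) -> polyfun (fun x => \sum_(j <- r | Q j) f j x).
Proof.
move=> pf; elim: r => [|j r IHr].
  by apply: polyfun_ext (polyfun_cst 0) => x; rewrite big_nil.
have [Qj|nQj] := boolP (Q j).
  by apply: polyfun_ext (polyfunD (pf j Qj) IHr) => x; rewrite big_cons Qj.
by apply: polyfun_ext IHr => x; rewrite big_cons (negbTE nQj).
Qed.

Lemma polyfun_prod (I : Type) (r : seq I) (f : I -> 'M[D]_n -> D) :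
  (forall j, polyfun (f j)) -> polyfun (fun x => \prod_(j <- r) f j x).
Proof.
move=> pf; elim: r => [|j r IHr].
  by apply: polyfun_ext (polyfun_cst 1) => x; rewrite big_nil.
by apply: polyfun_ext (polyfunM (pf j) IHr) => x; rewrite big_cons.
Qed.

Definition polymap m p (u : 'M[D]_n -> 'M[D]_(m, p)) := forall k l, polyfun (fun x => u x k l).

Lemma polymap_cst m p (a : 'M[D]_(m, p)) : polymap (fun=> a).
Proof. by move=> k l; apply: polyfun_cst. Qed.

Lemma polymap_id : polymap id.
Proof. by move=> k l; apply: polyfun_entry. Qed.

Lemma polymapM m p q (u : 'M[D]_n -> 'M[D]_(m, p)) (v : 'M[D]_n -> 'M[D]_(p, q)) :
  polymap u -> polymap v -> polymap (fun x => u x *m v x).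
Proof.
move=> pu pv k l; apply: (@polyfun_ext (fun x => \sum_j u x k j * v x j l)).
  by move=> x; rewrite mxE.
by apply: polyfun_sum => j _; apply: polyfunM.
Qed.

Lemma polyfun_det m (u : 'M[D]_n -> 'M[D]_m) : polymap u -> polyfun (fun x => \det (u x)).
Proof.
move=> pu; apply: polyfun_sum => s _; apply: polyfunM; first exact: polyfun_cst.
exact: polyfun_prod.
Qed.

(** In determinant 1 the adjugate is the inverse, so inversion is polynomial. *)
Lemma polymap_adj : polymap (fun x => \adj x).
Proof.
move=> k l; apply: (@polyfun_ext (fun x => cofactor x l k)).
  by move=> x; rewrite mxE.
rewrite /cofactor; apply: polyfunM; first exact: polyfun_cst.
apply: (@polyfun_det _ (fun x => row' l (col' k x))) => a b.
apply: (@polyfun_ext (fun x => x (lift l a) (lift k b))); last exact: polyfun_entry.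
by move=> x; rewrite !mxE.
Qed.

Lemma polyfun_mxeval (K : comNzRingType) (i : {rmorphism K -> D}) m (p : mxpoly K m)
    (u : 'M[D]_n -> 'M[D]_m) :
  polymap u -> polyfun (fun x => mxeval i p (u x)).
Proof.
move=> pu; apply: mxeval_ind => //; last exact: polyfunM; last exact: polyfunD.
by move=> c; apply: polyfun_cst.
Qed.

Lemma zariski_closed_points (K : comNzRingType) (i : {rmorphism K -> D})
    (P : set (mxpoly K n)) : zariski_closed (points i P).
Proof.
exists [set q | exists2 p, P p & mxeval i p = mxeval idfun q].
apply/seteqP; split=> x Px; first by move=> q [p Pp pq]; rewrite -pq; apply: Px.
move=> p Pp; have [q pq] := polyfun_mxeval i p polymap_id.
by rewrite -[LHS]/((fun x => mxeval i p x) x) pq; apply: Px; exists p.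
Qed.

Lemma zariski_closed_eq0 f : polyfun f -> zariski_closed [set x | f x = 0].
Proof.
move=> [p ->]; exists [set p]; apply/seteqP; split=> x /=; first by move=> px q ->.
by apply.
Qed.

Lemma zariski_closedI X Y : zariski_closed X -> zariski_closed Y ->
  zariski_closed (X `&` Y).
Proof.
move=> [P ->] [Q ->]; exists (P `|` Q); apply/seteqP; split=> x.
  by move=> [Px Qx] p [/Px|/Qx].
by move=> PQ; split=> p Pp; apply: PQ; [left|right].
Qed.

End ZariskiClosed.

(** Either u lies in the rational span of the lattice, and a multiple of it lies in the lattice, or
    a linear form vanishes on the span and not at u; denominators are cleared in both cases. *)
Lemma rational_span_or_orthogonal n (L : set 'rV[int]_n) (u : 'rV[int]_n) :
  L 0 -> (forall x y, L x -> L y -> L (x + y)) -> (forall x, L x -> L (- x)) ->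
  (exists2 N : nat, (0 < N)%N & L (u *+ N)) \/
  exists z : 'I_n -> int, (forall x, L x -> \sum_j x 0 j * z j = 0) /\
    \sum_j u 0 j * z j != 0.
Proof.
move=> L0 LD LN.
pose q (x : 'rV[int]_n) : 'rV[rat]_n := map_mx intr x.
have qD x y : q (x + y) = q x + q y by rewrite /q map_mxD.
have qMn x m : q (x *+ m) = q x *+ m by rewrite /q raddfMn.
have qN x : q (- x) = - q x by rewrite /q map_mxN.
have q_inj : injective q.
  by move=> x y /matrixP xy; apply/matrixP => a b; have := xy a b;
    rewrite !mxE => /intr_inj.
have LMn x m : L x -> L (x *+ m).
  move=> Lx; elim: m => [|m IHm]; first by rewrite mulr0n.
  by rewrite mulrS; apply: LD.
pose V (v : 'rV[rat]_n) := exists2 N : nat, (0 < N)%N & exists2 x, L x & v *+ N = q x.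
have V0 : V 0.
  by exists 1%N => //; exists 0; rewrite // /q map_mx0 mul0rn.
have VD v w : V v -> V w -> V (v + w).
  move=> [N N0 [x Lx vx]] [M M0 [y Ly wy]]; exists (N * M)%N; first by rewrite muln_gt0 N0.
  exists (x *+ M + y *+ N); first by apply: LD; apply: LMn.
  by rewrite mulrnDl qD !qMn -vx -wy -!mulrnA (mulnC M).
have VZ c v : V v -> V (c *: v).
  move=> [N N0 [x Lx vx]]; exists (N * `|denq c|)%N.
    by rewrite muln_gt0 N0 absz_gt0 denq_neq0.
  have dE : (`|denq c|%N%:R : rat) = (denq c)%:~R.
    by rewrite -[in RHS](gez0_abs (ltW (denq_gt0 c))) pmulrn.
  have E : (c *: v) *+ (N * `|denq c|)%N = (numq c)%:~R *: q x.
    rewrite -vx -!scaler_nat !scalerA natrM dE; congr (_ *: _).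
    have cE : c * (denq c)%:~R = (numq c)%:~R.
      by rewrite -{1}(divq_num_den c) divfK // intr_eq0 denq_neq0.
    by rewrite -cE; ring.
  have Lz (m : nat) : L (x *+ m) by apply: LMn.
  case: (numq c) E => m E.
    by exists (x *+ m) => //; rewrite E qMn -scaler_nat.
  exists (- (x *+ m.+1)); first exact/LN.
  by rewrite E qN qMn NegzE mulrNz scaleNr -scaler_nat.
(* The span [V] is a predicate. A matrix of maximal rank with rows in [V] has [V] as its row
   space. *)
have exA : exists r, `[< exists2 A : 'M[rat]_n, (forall v, (v <= A)%MS -> V v) &
    \rank A = r >].
  exists 0%N; apply/asboolP; exists 0; last by rewrite mxrank0.
  by move=> v; rewrite submx0 => /eqP->.
have bA r : `[< exists2 A : 'M[rat]_n, (forall v, (v <= A)%MS -> V v) &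
    \rank A = r >] -> (r <= n)%N.
  by move=> /asboolP[A _ <-]; apply: rank_leq_row.
case: (ex_maxnP exA bA) => r /asboolP[A AV rA] rmax.
have VA v : V v -> (v <= A)%MS.
  move=> Vv.
  have AvV w : (w <= A + v)%MS -> V w.
    move=> /sub_addsmxP[[a b] /= ->]; apply: VD; first by apply: AV; apply: submxMl.
    by rewrite [b]mx11_scalar mul_scalar_mx; apply: VZ.
  have : (\rank (A + v)%MS <= r)%N by apply: rmax; apply/asboolP; exists (A + v)%MS.
  rewrite -rA => rAv; apply: submx_trans (addsmxSr A v) _.
  by rewrite -(geq_leqif (mxrank_leqif_sup (addsmxSl A v))) // .
have [uA|] := boolP (q u <= A)%MS.
  left; have [N N0 [x Lx ux]] := AV _ uA; exists N => //.
  by rewrite (_ : u *+ N = x) //; apply: q_inj; rewrite qMn.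
rewrite submxE => /matrix0Pn[a [j uj]]; right.
(* A column of the cokernel is a form that vanishes on the rows of [A]; this one does not vanish at
   u. Multiplication by [M] makes it integral. *)
pose w : 'cV[rat]_n := col j (cokermx A).
pose M := (\prod_k denq (w k 0))%R.
have M0 : (M%:~R : rat) != 0.
  by rewrite intr_eq0; apply/prodf_neq0 => k _; apply: denq_neq0.
have zE k : exists z : int, z%:~R = (M%:~R : rat) * w k 0.
  exists (numq (w k 0) * \prod_(l | l != k) denq (w l 0)).
  have cE : w k 0 * (denq (w k 0))%:~R = (numq (w k 0))%:~R.
    by rewrite -{1}(divq_num_den (w k 0)) divfK // intr_eq0 denq_neq0.
  by rewrite /M [in RHS](bigD1 k) //= !intrM -cE; ring.
have /choice[z zP] := zE; exists z.
have sumE (x : 'rV[int]_n) : ((\sum_k x 0 k * z k)%:~R : rat) = M%:~R * (q x *m w) 0 0.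
  rewrite mxE mulr_sumr rmorph_sum /=; apply: eq_bigr => k _.
  by rewrite intrM zP [q x 0 k]mxE mulrCA.
split=> [x Lx|].
  apply/eqP; rewrite -(intr_eq0 rat) sumE mulf_eq0 (negbTE M0) /=.
  have : (q x <= A)%MS by apply: VA; exists 1%N => //; exists x.
  rewrite submxE => /eqP qx0; rewrite -[w]/(col j (cokermx A)) colE mulmxA qx0.
  by rewrite mul0mx mxE.
rewrite -(intr_eq0 rat) sumE mulf_neq0 //.
by rewrite /w colE mulmxA -colE mxE; move: uj; rewrite (ord1 a).
Qed.

(** * Weights and characters of a split torus *)

Section TorusCharacters.
Variables (K : rcfType) (n : nat) (P : 'M[K]_n) (S : set (mxpoly K n)).
Notation rc := (real_complex K).
Hypothesis PU : P \in unitmx.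
Hypothesis Sgrp : mx_group (geom_points S).
Hypothesis SdiagC : forall s, geom_points S s -> diag_in_basis P rc s.

Lemma torus_weight_neq0 s k : geom_points S s -> weight P rc s k != 0.
Proof.
move=> Ss; apply/eqP => w0; have [SU S1 _ SV] := Sgrp.
have := weight1 PU rc k; rewrite -(mulmxV (SU _ Ss)).
rewrite diag_in_basis_weightM // ?w0 ?mul0r; first by move/eqP; rewrite eq_sym oner_eq0.
  exact: SdiagC.
exact/SdiagC/SV.
Qed.

Definition monomial_sum (f : 'rV[K[i]]_n -> K[i]) :=
  exists r : seq (K[i] * {ffun 'I_n -> nat}),
    forall d, f d = \sum_(a <- r) a.1 * \prod_j d 0 j ^+ a.2 j.

Lemma monomial_sum_ext f g : f =1 g -> monomial_sum f -> monomial_sum g.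
Proof. by move=> /funext->. Qed.

Lemma monomial_sum_mono c m : monomial_sum (fun d => c * \prod_j d 0 j ^+ m j).
Proof.
exists [:: (c, [ffun j => m j])] => d; rewrite big_seq1 /=.
by congr (_ * _); apply: eq_bigr => j _; rewrite ffunE.
Qed.

Lemma monomial_sum_cst c : monomial_sum (fun=> c).
Proof.
apply: monomial_sum_ext (monomial_sum_mono c (fun=> 0%N)) => d.
by rewrite big1 ?mulr1.
Qed.

Lemma monomial_sum_var c k : monomial_sum (fun d => c * d 0 k).
Proof.
apply: monomial_sum_ext (monomial_sum_mono c (fun j => (j == k) : nat)) => d.
rewrite (bigD1 k) //= eqxx expr1 big1 ?mulr1 // => j /negbTE->.
by rewrite expr0.
Qed.

Lemma monomial_sumD f g : monomial_sum f -> monomial_sum g ->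
  monomial_sum (fun d => f d + g d).
Proof. by move=> [r fr] [s gs]; exists (r ++ s) => d; rewrite big_cat /= -fr -gs. Qed.

Lemma monomial_sumM f g : monomial_sum f -> monomial_sum g ->
  monomial_sum (fun d => f d * g d).
Proof.
move=> [r fr] [s gs].
exists [seq (a.1 * b.1, [ffun j => (a.2 j + b.2 j)%N]) |
  a : K[i] * {ffun 'I_n -> nat} <- r, b : K[i] * {ffun 'I_n -> nat} <- s] => d.
rewrite fr gs big_allpairs_dep /= mulr_suml; apply: eq_bigr => a _.
rewrite mulr_sumr; apply: eq_bigr => b _; rewrite mulrACA -big_split /=.
by congr (_ * _); apply: eq_bigr => j _; rewrite ffunE exprD.
Qed.

Lemma monomial_sum_sum (I : Type) (r : seq I) (f : I -> 'rV[K[i]]_n -> K[i]) :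
  (forall k, monomial_sum (f k)) -> monomial_sum (fun d => \sum_(k <- r) f k d).
Proof.
move=> mf; elim: r => [|k r IHr].
  by apply: monomial_sum_ext (monomial_sum_cst 0) => d; rewrite big_nil.
by apply: monomial_sum_ext (monomial_sumD (mf k) IHr) => d; rewrite big_cons.
Qed.

Definition of_weights (L : fieldType) (i : {rmorphism K -> L}) (d : 'rV[L]_n) :=
  map_mx i (invmx P) *m diag_mx d *m map_mx i P.

Lemma monomial_sum_mxeval (p : mxpoly K n) :
  monomial_sum (fun d => mxeval rc p (of_weights rc d)).
Proof.
apply: mxeval_ind => [c|k l|f g|f g].
- exact: monomial_sum_cst.
- apply: (@monomial_sum_ext (fun d => \sum_j
    (map_mx rc (invmx P) k j * map_mx rc P j l) * d 0 j)).
    move=> d; rewrite /of_weights mxE; apply: eq_bigr => j _.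
    by rewrite mul_mx_diag [in RHS]mxE mulrAC.
  by apply: monomial_sum_sum => j; apply: monomial_sum_var.
- exact: monomial_sumD.
- exact: monomial_sumM.
Qed.

(** The kernel of restriction to S for the characters of the diagonal torus. *)
Definition trivial_exponents : set 'rV[int]_n :=
  [set v | forall s, geom_points S s -> \prod_j weight P rc s j ^ (v 0 j) = 1].

(** Monomial relations suffice to cut S out of the diagonal torus. An equation of S is a linear
    relation between monomials, that is, between characters of S; by Dedekind it holds at t as soon
    as monomials equal on S are equal at t. *)
Lemma points_of_trivial_exponents (t : 'I_n -> K) :
  (forall j, t j != 0) ->
  (forall v, trivial_exponents v -> \prod_j t j ^ (v 0 j) = 1) ->
  points idfun S (of_weights idfun (\row_j t j)).
Proof.
move=> t0 tv; apply/geom_points_real.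
have -> : map_mx rc (of_weights idfun (\row_j t j)) = of_weights rc (\row_j rc (t j)).
  have mid (M : 'M[K]_n) : map_mx idfun M = M by apply: map_mx_id.
  rewrite /of_weights !mid !map_mxM /= map_diag_mx; congr (_ *m diag_mx _ *m _).
  by apply/rowP => j; rewrite !mxE.
move=> p Sp; have [r rE] := monomial_sum_mxeval p; rewrite rE.
have [_ S1 SM _] := Sgrp.
under eq_bigr => a _ do under eq_bigr => j _ do rewrite mxE.
pose chi (a : K[i] * {ffun 'I_n -> nat}) s := \prod_j weight P rc s j ^+ a.2 j.
apply: (@dedekind_independence _ _ (geom_points S) (@mulmx _ n n n) 1%:M _ r fst chi
  (fun a => \prod_j rc (t j) ^+ a.2 j)) => //.
- by move=> a; apply: big1 => j _; rewrite weight1 // expr1n.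
- move=> a x y Sx Sy; rewrite /chi -big_split /=; apply: eq_bigr => j _.
  by rewrite diag_in_basis_weightM ?exprMn //; apply: SdiagC.
- move=> a b ab.
  have /tv : trivial_exponents (\row_j ((a.2 j)%:Z - (b.2 j)%:Z)).
    move=> s Ss; have := ab s Ss; rewrite /chi => h.
    rewrite (eq_bigr (fun j => weight P rc s j ^+ a.2 j / weight P rc s j ^+ b.2 j)).
      rewrite prodf_div h divff //; apply/prodf_neq0 => j _.
      by rewrite expf_neq0 // torus_weight_neq0.
    by move=> j _; rewrite mxE expfzDr ?torus_weight_neq0 // exprnN.
  rewrite (eq_bigr (fun j => t j ^+ a.2 j / t j ^+ b.2 j)).
    rewrite prodf_div => /(congr1 rc); rewrite fmorph_div !rmorph_prod rmorph1.
    have b0 : \prod_j rc (t j ^+ b.2 j) != 0.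
      by apply/prodf_neq0 => j _; rewrite fmorph_eq0 expf_neq0.
    move=> /divr1_eq; under eq_bigr do rewrite rmorphXn.
    by under [X in _ = X]eq_bigr do rewrite rmorphXn.
  by move=> j _; rewrite mxE expfzDr // exprnN.
move=> s Ss; have sE : s = of_weights rc (\row_j weight P rc s j).
  by apply: diag_in_basisE => //; apply: SdiagC.
rewrite -[RHS](Ss p Sp) [in RHS]sE rE; apply: eq_bigr => a _; congr (_ * _); apply: eq_bigr => j _.
by rewrite mxE.
Qed.

Hypothesis Sconn : zariski_connected (geom_points S).

(** Factor w_k^N - w_l^N. The zero sets of w_k - w_l and of the other factor cover S, and are
    disjoint since the latter is N w_l^(N-1) where the weights agree. By connectedness the one
    through the identity is all of S. *)
Lemma torus_weight_pow_eq N k l : (0 < N)%N ->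
  (forall s, geom_points S s -> weight P rc s k ^+ N = weight P rc s l ^+ N) ->
  forall s, geom_points S s -> weight P rc s k = weight P rc s l.
Proof.
move=> N0 wN; have [_ S1 _ _] := Sgrp.
have pw j : polyfun (fun s => weight P rc s j).
  have h : polymap (fun s : 'M[K[i]]_n => map_mx rc P *m s *m map_mx rc (invmx P)).
    apply: polymapM; last exact: polymap_cst.
    by apply: polymapM; [exact: polymap_cst|exact: polymap_id].
  exact: (h j j).
pose f s := weight P rc s k - weight P rc s l.
pose g s := \sum_(j < N) weight P rc s k ^+ (N.-1 - j) * weight P rc s l ^+ j.
have pf : polyfun f by apply: polyfunB.
have pg : polyfun g by apply: polyfun_sum => j _; apply: polyfunM; apply: polyfunX.
have fg s : geom_points S s -> f s * g s = 0.
  by move=> /wN h; rewrite /f /g -subrXX h subrr.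
have Sc := zariski_closed_points rc S.
have [|| SY|SZ] := Sconn (zariski_closedI Sc (zariski_closed_eq0 pf))
    (zariski_closedI Sc (zariski_closed_eq0 pg)).
- apply/seteqP; split=> s; first by case=> -[].
  by move=> Ss; have /eqP := fg s Ss; rewrite mulf_eq0 => /orP[]/eqP; [left|right].
- apply/seteqP; split=> // s [[Ss /= /eqP]]; rewrite subr_eq0 => /eqP kl [_ /=].
  rewrite /g kl (eq_bigr (fun=> weight P rc s l ^+ N.-1)) => [|j _].
    rewrite sumr_const card_ord => /eqP; rewrite mulrn_eq0 expf_eq0.
    by rewrite (negbTE (torus_weight_neq0 l Ss)) andbF orbF -leqn0 leqNgt N0.
  by rewrite -exprD subnK // -ltnS prednK.
- have : (geom_points S `&` [set s | f s = 0]) 1%:M.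
    by split=> //=; rewrite /f !weight1 // subrr.
  by rewrite SY.
move=> s Ss; apply/eqP; rewrite -subr_eq0; apply/eqP.
have /eqP := fg s Ss; rewrite mulf_eq0 => /orP[/eqP //|/eqP gs].
have : (geom_points S `&` [set s | g s = 0]) s by [].
by rewrite SZ.
Qed.

(* Weights agreeing on the positive part agree on S: if no power of their
   quotient is trivial, some cocharacter takes the value 2 to different powers
   on them; otherwise their quotient takes finitely many values. *)
Lemma torus_weight_eq k l :
  (forall x, positive_part P S idfun x -> weight P idfun x k = weight P idfun x l) ->
  forall s, geom_points S s -> weight P rc s k = weight P rc s l.
Proof.
move=> wkl.
have E0 : trivial_exponents 0 by move=> s _; apply: big1 => j _; rewrite mxE.
have ED u v : trivial_exponents u -> trivial_exponents v -> trivial_exponents (u + v).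
  move=> Lu Lv s Ss; rewrite (eq_bigr (fun j => weight P rc s j ^ (u 0 j) *
    weight P rc s j ^ (v 0 j))); first by rewrite big_split /= Lu // Lv // mulr1.
  by move=> j _; rewrite mxE expfzDr ?torus_weight_neq0.
have EN u : trivial_exponents u -> trivial_exponents (- u).
  move=> Lu s Ss; rewrite (eq_bigr (fun j => (weight P rc s j ^ (u 0 j))^-1)).
    by rewrite prodfV Lu // invr1.
  by move=> j _; rewrite mxE -invr_expz.
have [<-|neq_kl] := eqVneq k l; first by [].
pose u : 'rV[int]_n := delta_mx 0 k - delta_mx 0 l.
have [[N N0 LuN]|[z [zL zu]]] := rational_span_or_orthogonal u E0 ED EN.
  apply: (torus_weight_pow_eq N0) => s Ss; have := LuN s Ss.
  rewrite (bigD1 k) //= (bigD1 l) ?[l == k]eq_sym //= big1 => [|j /andP[jk jl]].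
    rewrite !mulmxnE !mxE !eqxx /= [l == k]eq_sym (negbTE neq_kl) mulr1 subr0 sub0r.
    by rewrite mulNrn !natz -exprnN -exprnP => /divr1_eq.
  by rewrite !mulmxnE !mxE !eqxx /= (negbTE jk) (negbTE jl) subr0 mul0rn expr0z.
pose t j : K := 2 ^ z j.
have t0 j : 0 < t j by rewrite exprz_gt0.
have St : points idfun S (of_weights idfun (\row_j t j)).
  apply: points_of_trivial_exponents => [j|v Lv]; first by rewrite gt_eqF.
  rewrite (eq_bigr (fun j => (2 : K) ^ (v 0 j * z j))); last first.
    by move=> j _; rewrite /t exprz_exp mulrC.
  have := zL v Lv => vz; rewrite -[RHS](expr0z 2) -vz.
  elim/big_rec2: _ => [|j x y _ ->]; first by rewrite expr0z.
  by rewrite expfzDr ?pnatr_eq0.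
have := wkl (of_weights idfun (\row_j t j)).
rewrite !weight_diag // !mxE => h.
have tkl : t k = t l by apply: h; split=> // j; rewrite weight_diag // mxE.
have z_kl : z k = z l.
  have two1 : (1 : K) < 2 by rewrite ltr1n.
  by apply/eqP; rewrite eq_le -!(ler_eXz2l two1) -/(t k) -/(t l) tkl lexx.
case/eqP: zu; rewrite (bigD1 k) //= (bigD1 l) ?[l == k]eq_sym //= big1 => [|j /andP[jk jl]].
  rewrite !mxE !eqxx /= [l == k]eq_sym (negbTE neq_kl) subr0 sub0r addr0 z_kl.
  by rewrite mulN1r mul1r subrr.
by rewrite !mxE !eqxx /= (negbTE jk) (negbTE jl) subr0 mul0r.
Qed.

End TorusCharacters.

(** * Maximality of the torus *)

Section RealImaginary.
Variables (K : rcfType) (n : nat).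
Notation rc := (real_complex K).

Lemma polyfun_real_imaginary (f : 'M[K[i]]_n -> K[i]) : polyfun f ->
  exists p q : mxpoly K n, forall x, f x = mxeval rc p x + 'i%C * mxeval rc q x.
Proof.
move=> [h ->]; elim/mxpoly_ind: h => [c|k l|h h' [p [q hE]] [p' [q' h'E]]|
    h h' [p [q hE]] [p' [q' h'E]]].
- exists (mpoly.mpolyC _ (complex.Re c)), (mpoly.mpolyC _ (complex.Im c)) => x.
  by rewrite !mxevalC /=; case: c => a b; simpc.
- exists (mpoly.mpolyX K (mpoly.mnm1 (mxvec_index k l))), 0 => x.
  by rewrite !mxevalX mxeval0 mulr0 addr0.
- exists (p + p'), (q + q') => x; rewrite !mxevalD hE h'E; ring.
- exists (p * p' - q * q'), (p * q' + q * p') => x.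
  rewrite !(mxevalD, mxevalM, mxevalN) hE h'E.
  have ii : 'i%C * 'i%C = -1 :> K[i] by rewrite -expr2 sqr_i.
  set a := mxeval rc p x; set b := mxeval rc q x.
  set a' := mxeval rc p' x; set b' := mxeval rc q' x.
  transitivity (a * a' + ('i%C * 'i%C) * (b * b') + 'i%C * (a * b' + b * a')); first by ring.
  by rewrite ii; ring.
Qed.

Lemma mxeval_conj (p : mxpoly K n) (x : 'M[K[i]]_n) :
  mxeval rc p (map_mx (@conjc K) x) = conjc (mxeval rc p x).
Proof.
apply: mxeval_map => c /=; by rewrite /conjc oppr0.
Qed.

(** The Zariski closure of a set stable under conjugation is defined over K: if f vanishes on X, so
    do its real and imaginary parts. Without this the enlarged torus would only be defined over
    K[i]. *)
Lemma real_closure_polyfun (X : set 'M[K[i]]_n) (f : 'M[K[i]]_n -> K[i]) :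
  (forall x, X x -> X (map_mx (@conjc K) x)) -> polyfun f ->
  (forall x, X x -> f x = 0) ->
  forall x, points rc [set p | forall y, X y -> mxeval rc p y = 0] x -> f x = 0.
Proof.
move=> Xconj /polyfun_real_imaginary[p [q fE]] fX x Tx.
have pq y : X y -> mxeval rc p y = 0 /\ mxeval rc q y = 0.
  move=> Xy; have h1 := fX _ Xy; have := fX _ (Xconj _ Xy).
  rewrite !fE !mxeval_conj in h1 *.
  case: (mxeval rc p y) (mxeval rc q y) h1 => [a b] [c d] /=.
  rewrite /conjc; simpc => /eqP; rewrite eq_complex /= => /andP[/eqP e1 /eqP e2].
  move=> /eqP; rewrite eq_complex /= => /andP[/eqP e3 /eqP e4].
  have -> : a = 0 by lra.
  have -> : b = 0 by lra.
  have -> : c = 0 by lra.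
  by have -> : d = 0 by lra.
rewrite fE (Tx p) ?(Tx q) ?mulr0 ?addr0 // => y Xy; by have [] := pq y Xy.
Qed.

End RealImaginary.

Section Maximality.
Variables (K : rcfType) (n : nat) (P : 'M[K]_n) (G S : set (mxpoly K n)).
Notation rc := (real_complex K).
Hypothesis PU : P \in unitmx.
Hypothesis Ggrp : mx_group (geom_points G).
Hypothesis Gdet : geom_points G `<=` [set x | \det x = 1].
Hypothesis Gsa : self_adjoint G.
Hypothesis Smax : maximal_split_torus G S.
Hypothesis SdiagC : forall s, geom_points S s -> diag_in_basis P rc s.

Let Sgrp : mx_group (geom_points S). Proof. by case: Smax => -[]. Qed.
Let Sconn : zariski_connected (geom_points S). Proof. by case: Smax => -[]. Qed.
Let SG : geom_points S `<=` geom_points G. Proof. by case: Smax. Qed.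

(* Adjoining to S the positive points of G(K) that are diagonal in an eigenbasis
   of S yields a split torus of G, which is S by maximality. *)
Section LargerTorus.
Variable Q : 'M[K]_n.
Hypothesis QU : Q \in unitmx.
Hypothesis SQ : forall s, geom_points S s -> diag_in_basis Q rc s.

Definition positive_diag (x : 'M[K]_n) :=
  [/\ points idfun G x, diag_in_basis Q idfun x & forall k, 0 < weight Q idfun x k].

Definition torus_base : set 'M[K[i]]_n :=
  [set s *m map_mx rc x | s in geom_points S & x in positive_diag].

(** The Zariski closure of [torus_base], given by its equations over K; by [larger_torus_polyfun]
    all polynomial equations over K[i] follow from these. *)
Definition larger_torus : set (mxpoly K n) :=
  [set p | forall y, torus_base y -> mxeval rc p y = 0].

Lemma map_diag_in_basis (x : 'M[K]_n) : diag_in_basis Q idfun x ->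
  diag_in_basis Q rc (map_mx rc x).
Proof.
move=> xd k l kl; rewrite -!map_mxM mxE.
have := xd k l kl; rewrite !map_mx_id // => ->; exact: rmorph0.
Qed.

Lemma positive_diag1 : positive_diag 1%:M.
Proof.
split=> [||k]; first exact: geom_points1.
  exact: diag_in_basis1.
by rewrite weight1 // ltr01.
Qed.

Lemma positive_diagM x y : positive_diag x -> positive_diag y -> positive_diag (x *m y).
Proof.
move=> [Gx xd x0] [Gy yd y0]; split=> [||k]; first exact: geom_points_mul.
  exact: diag_in_basisM.
by rewrite diag_in_basis_weightM // mulr_gt0.
Qed.

Lemma positive_diagV x : positive_diag x -> positive_diag (invmx x).
Proof.
move=> [Gx xd x0]; have xU := geom_points_unit Ggrp Gx.
have Vd := diag_in_basisV QU xU xd.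
split=> [||k] //; first exact: geom_points_inv.
have := weight1 QU idfun k; rewrite -(mulmxV xU) diag_in_basis_weightM // => h.
by rewrite -(pmulr_rgt0 _ (x0 k)) h ltr01.
Qed.

Lemma torus_base_diag y : torus_base y -> diag_in_basis Q rc y.
Proof.
move=> [s Ss [x [_ xd _] <-]]; apply: diag_in_basisM => //; first exact: SQ.
exact: map_diag_in_basis.
Qed.

Lemma torus_base_torus s : geom_points S s -> torus_base s.
Proof.
by move=> Ss; exists s => //; exists 1%:M; [apply: positive_diag1|rewrite map_mx1 mulmx1].
Qed.

Lemma torus_base_pos x : positive_diag x -> torus_base (map_mx rc x).
Proof.
by move=> xd; have [_ S1 _ _] := Sgrp; exists 1%:M => //; exists x; rewrite ?mul1mx.
Qed.

Lemma torus_baseM x y : torus_base x -> torus_base y -> torus_base (x *m y).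
Proof.
move=> [s Ss [a Pa <-]] [t St [b Pb <-]]; have [_ _ SM _] := Sgrp.
exists (s *m t); first exact: SM.
exists (a *m b); first exact: positive_diagM.
have C : map_mx rc a *m t = t *m map_mx rc a.
  apply: (diag_in_basisC QU); last exact: SQ.
  by case: Pa => _ ad _; apply: map_diag_in_basis.
by rewrite map_mxM !mulmxA -(mulmxA s t) -C !mulmxA.
Qed.

Lemma torus_base_sub y : torus_base y -> geom_points G y.
Proof.
move=> [s Ss [x [Gx _ _] <-]]; have [_ _ GM _] := Ggrp.
by apply: GM; [apply: SG|apply/geom_points_real].
Qed.

Lemma torus_baseV y : torus_base y -> torus_base (invmx y).
Proof.
move=> By; have [s Ss [x Px yE]] := By.
have yU : y \in unitmx by have [GU _ _ _] := Ggrp; apply/GU/torus_base_sub.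
have [_ _ _ SV] := Sgrp; have [SU _ _ _] := Sgrp.
have By' : torus_base (invmx s *m map_mx rc (invmx x)).
  by exists (invmx s); [apply: SV|exists (invmx x) => //; apply: positive_diagV].
suff -> : invmx y = invmx s *m map_mx rc (invmx x) by [].
have xU : x \in unitmx by case: Px => Gx _ _; apply: geom_points_unit Gx.
have C : map_mx rc x *m invmx s = invmx s *m map_mx rc x.
  apply: (diag_in_basisC QU); last by apply/SQ/SV.
  by case: Px => _ ad _; apply: map_diag_in_basis.
have E : y *m (invmx s *m map_mx rc (invmx x)) = 1%:M.
  rewrite -yE !mulmxA -(mulmxA s) C !mulmxA mulmxV ?mul1mx; last exact: SU.
  by rewrite -map_mxM mulmxV // map_mx1.
by rewrite -[LHS]mulmx1 -E mulKmx.
Qed.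

Lemma torus_base_conj y : torus_base y -> torus_base (map_mx (@conjc K) y).
Proof.
move=> [s Ss [x Px <-]]; exists (map_mx (@conjc K) s).
  by move=> p Sp; rewrite mxeval_conj (Ss p Sp) conjc0.
exists x => //; rewrite map_mxM; congr (_ *m _).
by apply/matrixP => a b; rewrite !mxE /= oppr0.
Qed.

Lemma larger_torus_polyfun f : polyfun f -> (forall y, torus_base y -> f y = 0) ->
  forall y, geom_points larger_torus y -> f y = 0.
Proof. by move=> pf fB y Ty; apply: (real_closure_polyfun torus_base_conj pf fB Ty). Qed.

Lemma torus_base_larger y : torus_base y -> geom_points larger_torus y.
Proof. by move=> By p; apply. Qed.

Lemma larger_torus_sub y : geom_points larger_torus y -> geom_points G y.
Proof. by move=> Ty p Gp; apply: Ty => z /torus_base_sub; apply. Qed.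

Lemma larger_torus_diag y : geom_points larger_torus y -> diag_in_basis Q rc y.
Proof.
move=> Ty k l kl; move: y Ty; apply: larger_torus_polyfun.
  have h : polymap (fun s : 'M[K[i]]_n => map_mx rc Q *m s *m map_mx rc (invmx Q)).
    apply: polymapM; last exact: polymap_cst.
    by apply: polymapM; [exact: polymap_cst|exact: polymap_id].
  exact: (h k l).
by move=> y /torus_base_diag; apply.
Qed.

(** The closure of a group is a group: multiply first by an element of the base on the left, then by
    an element of the closure on the right. Inversion is polynomial in determinant 1. *)
Lemma larger_torus_group : mx_group (geom_points larger_torus).
Proof.
have BT : forall x y, torus_base x -> geom_points larger_torus y ->
    geom_points larger_torus (x *m y).
  move=> x y Bx Ty p Tp; move: y Ty; apply: larger_torus_polyfun.
    by apply: polyfun_mxeval; apply: polymapM; [exact: polymap_cst|exact: polymap_id].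
  by move=> y By; apply: Tp; apply: torus_baseM.
have T1 y : geom_points larger_torus y -> \det y = 1.
  by move=> /larger_torus_sub/Gdet.
split=> [y Ty||x y Tx Ty|y Ty].
- by rewrite /= unitmxE T1 // unitr1.
- apply: torus_base_larger; apply: torus_base_torus.
  by have [] := Sgrp.
- move=> p Tp; move: x Tx; apply: larger_torus_polyfun.
    by apply: polyfun_mxeval; apply: polymapM; [exact: polymap_id|exact: polymap_cst].
  by move=> x Bx; apply: BT.
have adjE (z : 'M[K[i]]_n) : \det z = 1 -> invmx z = \adj z.
  by move=> dz; rewrite /invmx unitmxE dz unitr1 invr1 scale1r.
rewrite adjE; last exact: T1.
move=> p Tp; move: y Ty; apply: larger_torus_polyfun.
  by apply: polyfun_mxeval; apply: polymap_adj.
move=> y By; rewrite -adjE; last by apply: Gdet; apply: torus_base_sub.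
by apply: Tp; apply: torus_baseV.
Qed.

Lemma geometric_sum_curve (f : 'M[K[i]]_n -> K[i]) s x : polyfun f ->
  positive_diag x ->
  geometric_sum (real_complex K) (fun j => f (s *m map_mx rc (x ^+ j))).
Proof.
move=> [p ->] [_ xd x0].
have xE j : x ^+ j = invmx Q *m diag_mx (\row_k weight Q idfun x k ^+ j) *m Q.
  elim: j => [|j IHj].
    rewrite expr0 (_ : diag_mx _ = 1%:M) ?mulmx1 ?mulVmx //.
    by apply/matrixP => a b; rewrite !mxE expr0.
  rewrite exprS IHj {1}(diag_in_basisE QU xd).
  have mid (M : 'M[K]_n) : map_mx idfun M = M by apply: map_mx_id.
  have := conj_diag_mul QU idfun (\row_k weight Q idfun x k) (\row_k weight Q idfun x k ^+ j).
  rewrite !mid -mulmxE => ->; rewrite mulmx_diag; congr (_ *m diag_mx _ *m _).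
  by apply/rowP => k; rewrite !mxE exprS.
apply: mxeval_ind => [c|k l|g h|g h].
- exact: geometric_sum_cst.
- pose c m a := (s *m map_mx rc (invmx Q)) k a * map_mx rc Q a m.
  apply: (@geometric_sum_ext _ _ _ (fun j => \sum_a c l a *
      rc (weight Q idfun x a) ^+ j)).
    move=> j; rewrite xE !map_mxM map_diag_mx !mulmxA [RHS]mxE; apply: eq_bigr => a _.
    by rewrite mul_mx_diag [in RHS]mxE /c !mxE rmorphXn mulrAC.
  by apply: geometric_sum_sum => a; apply: geometric_sum_geom.
- exact: geometric_sumD.
- exact: geometric_sumM.
Qed.

(** Of two disjoint closed sets that cover the closure, let Y contain the identity. Y contains S,
    which is connected, and then each s x, by following the points s x^j; so it contains the base,
    and its closure. *)
Lemma larger_torus_connected : zariski_connected (geom_points larger_torus).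
Proof.
have T1 : geom_points larger_torus 1%:M by case: larger_torus_group.
have key Y Z : zariski_closed Y -> zariski_closed Z ->
    Y `|` Z = geom_points larger_torus -> Y `&` Z = set0 -> Y 1%:M -> Z = set0.
  move=> [PY YE] [PZ ZE] YZ YZ0 Y1.
  have Yc : zariski_closed Y by exists PY.
  have Zc : zariski_closed Z by exists PZ.
  have Sc := zariski_closed_points rc S.
  have [_ S1 SM _] := Sgrp.
  have SY s : geom_points S s -> Y s.
    have [||SY0|SZ0] := Sconn (zariski_closedI Sc Yc) (zariski_closedI Sc Zc).
    - rewrite -setIUr YZ; apply/setIidPl => s' Ss'.
      exact/torus_base_larger/torus_base_torus.
    - by rewrite setIACA YZ0 setI0.
    - by have : (geom_points S `&` Y) 1%:M by []; rewrite SY0.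
    move=> Ss; have : (Y `|` Z) s by rewrite YZ; apply/torus_base_larger/torus_base_torus.
    by case=> // Zs; have : (geom_points S `&` Z) s by []; rewrite SZ0.
  have BY y : torus_base y -> Y y.
    move=> By; apply: contrapT => nYy; have [s Ss [x Px yE]] := By.
    have [f PYf fy] : exists2 f, PY f & mxeval idfun f y <> 0.
      apply: contrapT => nf; apply: nYy; rewrite YE => f PYf.
      by apply: contrapT => fy; apply: nf; exists f.
    have [g PZg gs] : exists2 g, PZ g & mxeval idfun g s <> 0.
      apply: contrapT => ng; have : (Y `&` Z) s; last by rewrite YZ0.
      split; first exact: SY.
      by rewrite ZE => g PZg; apply: contrapT => gs; apply: ng; exists g.
    have Px' j : positive_diag (x ^+ j).
      elim: j => [|j IHj]; first by rewrite expr0; apply: positive_diag1.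
      by rewrite exprS; apply: positive_diagM.
    (* Every s x^j is in Y or in Z, so f g vanishes along this sequence. But f is nonzero at j = 1
       and g at j = 0. *)
    have [|fs0|gs0] := geometric_sum_domain
      (@geometric_sum_curve (mxeval idfun f) s x (ex_intro _ f erefl) Px)
      (@geometric_sum_curve (mxeval idfun g) s x (ex_intro _ g erefl) Px).
    - move=> j; have : (Y `|` Z) (s *m map_mx rc (x ^+ j)).
        by rewrite YZ; apply: torus_base_larger; exists s => //; exists (x ^+ j).
      rewrite YE ZE => -[/(_ _ PYf)->|/(_ _ PZg)->]; by rewrite ?mul0r ?mulr0.
    - by apply: fy; rewrite -yE -(fs0 1%N) expr1.
    by apply: gs; rewrite -(gs0 0%N) expr0 map_mx1 mulmx1.
  apply/seteqP; split=> // z Zz.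
  have Tz : geom_points larger_torus z by rewrite -YZ; right.
  have Yz : Y z.
    rewrite YE => f PYf; move: z Tz {Zz}; apply: larger_torus_polyfun; first by exists f.
    by move=> y /BY; rewrite YE; apply.
  by have : (Y `&` Z) z by []; rewrite YZ0.
move=> Y Z Yc Zc YZ YZ0; have : (Y `|` Z) 1%:M by rewrite YZ.
case=> [Y1|Z1]; first by right; apply: (key Y).
by left; apply: (key Z); rewrite 1?setUC 1?setIC.
Qed.

Lemma positive_diag_torus x : positive_diag x -> points idfun S x.
Proof.
move=> Px; have [_ _ maxS] := Smax.
have TS : geom_points larger_torus = geom_points S.
  apply: maxS => [|y|s Ss]; last exact/torus_base_larger/torus_base_torus.
    split; [exact: larger_torus_group|exact: larger_torus_connected|].
    exists Q => //= t Tt; apply/is_diag_mxP => k l kl; rewrite -map_invmx.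
    by apply: larger_torus_diag.
  exact: larger_torus_sub.
by apply/geom_points_real; rewrite -TS; apply/torus_base_larger/torus_base_pos.
Qed.

End LargerTorus.

(** A basis that diagonalizes both S and q = x x^T is needed. S is replaced by one matrix [D] with
    the same eigenspaces; q commutes with [D], both are diagonalizable, and a common eigenbasis
    makes q a positive diagonal point of G, hence a point of S. *)
Lemma gram_in_positive_part_base (x : 'M[K]_n) : points idfun G x ->
  (forall a, positive_part P S idfun a -> a *m (x *m x^T) = (x *m x^T) *m a) ->
  positive_part P S idfun (x *m x^T).
Proof.
move=> Gx comm; set q := x *m x^T.
have mid (M : 'M[K]_n) : map_mx idfun M = M by apply: map_mx_id.
have Gq : points idfun G q by apply: geom_points_mul => //; apply: geom_points_tr.
have xU := geom_points_unit Ggrp Gx.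
have Sdiag (L : rcfType) (i : {rmorphism K -> L}) y : points i S y -> diag_in_basis P i y.
  by move=> Sy; apply: (geom_points_diag PU _ Sy) => t St;
    apply/is_diag_mxP => k l kl; rewrite -map_invmx; apply: SdiagC.
pose sim k l := `[< forall s, geom_points S s -> weight P rc s k = weight P rc s l >].
pose rep k := odflt k [pick l | sim k l].
have sim_rep k : sim k (rep k).
  by rewrite /rep; case: pickP => //= _; apply/asboolP.
have rep_eq k l : sim k l -> rep k = rep l.
  move=> /asboolP kl; rewrite /rep (@eq_pick _ (sim k) (sim l)).
    case: pickP => // /(_ l) /=; rewrite /sim; move/asboolP => []; by [].
  by move=> m; apply/asboolP/asboolP => h s Ss; [rewrite -kl|rewrite kl] => //; apply: h.
(* One number for each class of indices on which the weights of S agree; distinct classes get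
   distinct numbers. *)
pose c k : K := (rep k)%:R.
have c_sim k l : c k = c l -> sim k l.
  move=> /eqP; rewrite /c eqr_nat => /eqP/val_inj rkl; apply/asboolP => s Ss.
  by have /asboolP-> // := sim_rep k; have /asboolP-> // := sim_rep l; rewrite rkl.
pose D := invmx P *m diag_mx (\row_k c k) *m P.
pose q' := P *m q *m invmx P.
(* Commutation with A only tells that w_k and w_l agree on A; [torus_weight_eq] extends this to
   S. *)
have q'sim k l : q' k l != 0 -> sim k l.
  move=> q'kl; apply/asboolP; apply: (torus_weight_eq PU Sgrp SdiagC Sconn) => a Aa.
  have := comm a Aa => /(congr1 (fun M => (P *m M *m invmx P) k l)).
  have [Sa _] := Aa; rewrite {1 2}(torus_diagE PU Sdiag Sa) !mid.
  have -> : P *m (invmx P *m diag_mx (\row_k weight P idfun a k) *m P *m q) *m invmx P =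
      diag_mx (\row_k weight P idfun a k) *m q'.
    by rewrite /q' !mulmxA mulmxV // mul1mx.
  have -> : P *m (q *m (invmx P *m diag_mx (\row_k weight P idfun a k) *m P)) *m invmx P =
      q' *m diag_mx (\row_k weight P idfun a k).
    by rewrite /q' !mulmxA mulmxK.
  rewrite mul_diag_mx mul_mx_diag !mxE mulrC => h; apply: (mulfI q'kl); by rewrite /q' [_ k l]mxE.
have q'c : q' *m diag_mx (\row_k c k) = diag_mx (\row_k c k) *m q'.
  apply/matrixP => k l; rewrite mul_mx_diag mul_diag_mx [LHS]mxE [RHS]mxE mulrC.
  have [->|/q'sim/rep_eq kl] := eqVneq (q' k l) 0; first by rewrite !mulr0.
  by rewrite !mxE /c kl.
have qD : q *m D = D *m q.
  have qE : q = invmx P *m q' *m P by rewrite /q' !mulmxA mulVmx // mul1mx mulmxKV.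
  rewrite /D qE; move: (q') q'c => {q'sim qE} q' q'c.
  by rewrite !mulmxA !mulmxK // -(mulmxA _ q') q'c mulmxA.
have diagD : diagonalizable D.
  exists P => //; apply/diagonalizable_forP => // k l kl.
  by rewrite /D !mulmxA mulmxV // mul1mx mulmxK // mxE (negbTE (contraNneq _ kl)) // => ->.
have diagq : diagonalizable q.
  by apply: symmetric_diagonalizable; rewrite trmx_mul trmxK.
have [Q QU /and3P[/= QD Qq _]] : codiagonalizable [:: D; q].
  apply/codiagonalizableP; split=> A.
    move=> B; rewrite !inE => /orP[]/eqP-> /orP[]/eqP-> //; exact: esym.
  by rewrite !inE => /orP[]/eqP->.
have qQ : diag_in_basis Q idfun q.
  by move=> k l kl; rewrite !mid; move: Qq => /(diagonalizable_forP _ QU); apply.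
have DQ k l : k != l -> (Q *m D *m invmx Q) k l = 0.
  by move=> kl; move: QD => /(diagonalizable_forP _ QU); apply.
have SQ s : geom_points S s -> diag_in_basis Q rc s.
  move=> Ss k l kl; rewrite (diag_in_basisE PU (SdiagC Ss)).
  pose M := map_mx rc (Q *m invmx P).
  pose V := map_mx rc (P *m invmx Q).
  have MV : M *m V = 1%:M by rewrite -map_mxM !mulmxA mulmxKV // mulmxV // map_mx1.
  have Mc a : M k a != 0 -> c a = (Q *m D *m invmx Q) k k.
    move=> Mka; have E : Q *m invmx P *m diag_mx (\row_k c k) =
        diag_mx (\row_a (Q *m D *m invmx Q) a a) *m (Q *m invmx P).
      rewrite (_ : diag_mx (\row_a (Q *m D *m invmx Q) a a) = Q *m D *m invmx Q); last first.
        apply/matrixP => a' b'; have [->|ab] := eqVneq a' b'.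
          by rewrite [LHS]mxE eqxx mulr1n [LHS]mxE.
        by rewrite DQ // mxE (negbTE ab) mulr0n.
      by rewrite /D !mulmxA mulmxKV // mulmxK.
    have Mka' : (Q *m invmx P) k a != 0.
      by apply: contraNneq Mka => h; apply/eqP; rewrite /M [LHS]mxE h; apply: rmorph0.
    move: E Mka' => /matrixP/(_ k a); rewrite mul_mx_diag mul_diag_mx.
    move: (Q *m invmx P) => N; rewrite [LHS]mxE [RHS]mxE [RHS]mulrC => E Mka'.
    by have := mulfI Mka' E; rewrite !mxE.
  have -> : map_mx rc Q *m (map_mx rc (invmx P) *m diag_mx (\row_j weight P rc s j) *m
      map_mx rc P) *m map_mx rc (invmx Q) = M *m diag_mx (\row_j weight P rc s j) *m V.
    by rewrite /M /V !map_mxM !mulmxA.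
  clearbody M V; rewrite mul_mx_diag mxE.
  have [[a0 Ma0]|noa] := pselect (exists a, M k a != 0); last first.
    apply: big1 => a _; rewrite !mxE.
    have [->|Mka] := eqVneq (M k a) 0; first by rewrite !mul0r.
    by case: noa; exists a.
  rewrite (eq_bigr (fun a => weight P rc s a0 * (M k a * V a l))).
    rewrite -mulr_sumr; have /matrixP/(_ k l) := MV; rewrite !mxE => ->.
    by rewrite (negbTE kl) mulr0.
  move=> a _; rewrite !mxE.
  have [->|Mka] := eqVneq (M k a) 0; first by rewrite !mul0r mulr0.
  have /asboolP-> // : sim a a0 by apply: c_sim; rewrite !Mc.
  ring.
have Qdq : positive_diag Q q.
  by split=> // k; apply: gram_weight_gt0.
have Sq : points idfun S q by apply: (positive_diag_torus QU SQ).
by split=> // k; apply: gram_weight_gt0 => //; apply: Sdiag.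
Qed.

Lemma gram_in_positive_part (L : rcfType) (i : {rmorphism K -> L}) (x : 'M[L]_n) :
  points i G x ->
  (forall a, positive_part P S i a -> a *m (x *m x^T) = (x *m x^T) *m a) ->
  positive_part P S i (x *m x^T).
Proof.
move: x; apply: (@elementary_transfer K (fun L i => forall x : 'M[L]_n, points i G x ->
  (forall a, positive_part P S i a -> a *m (x *m x^T) = (x *m x^T) *m a) ->
  positive_part P S i (x *m x^T)) _ K idfun L i); last exact: gram_in_positive_part_base.
apply: elementary_allmx; apply: elementary_imp; first by elem.
apply: elementary_imp; last by apply: elementary_positive_part; elem.
apply: elementary_allmx; apply: elementary_imp; last by elem.
by apply: elementary_positive_part; elem.
Qed.

End Maximality.

(** First and second order conditions at a maximum, without derivatives: divide by t, then by t^2,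
    for t small compared with 1 / [D]. *)
Lemma quadratic_le_cubic (R : realType) (a b C : R) :
  (forall t, `|t| <= 1 -> t * a + t ^+ 2 * b <= `|t| ^+ 3 * C) -> a = 0 /\ b <= 0.
Proof.
move=> h; pose D := `|b| + `|C| + 1.
have D0 : 0 < D by rewrite ltr_wpDl // addr_ge0.
have small e : 0 < e -> exists2 t, 0 < t <= 1 & t * D < e.
  move=> e0; exists (Num.min 1 (e / (2 * D))).
    by rewrite lt_min ltr01 divr_gt0 ?mulr_gt0 //= ge_min lexx.
  apply: (@le_lt_trans _ _ (e / (2 * D) * D)).
    by rewrite ler_pM2r // ge_min lexx orbT.
  have -> : e / (2 * D) * D = e / 2 by field; apply: lt0r_neq0.
  lra.
have bD : `|b| + `|C| <= D by rewrite /D; lra.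
have key s c : `|s| = 1 -> c = s * a -> c <= 0.
  move=> s1 ca; rewrite leNgt; apply/negP => /small[t /andP[t0 t1] tD].
  have tn : `|s * t| = t by rewrite normrM s1 mul1r gtr0_norm.
  have := h (s * t); rewrite tn => /(_ t1).
  have s2 : s ^+ 2 = 1 by rewrite -real_normK ?num_real // s1 expr1n.
  rewrite exprMn s2 mul1r -mulrA mulrCA -ca => ht.
  have h1 : - (t ^+ 2 * `|b|) <= t ^+ 2 * b by rewrite -mulrN ler_wpM2l ?sqr_ge0 // lerNl -normrN ler_norm.
  have h2 : t ^+ 3 * C <= t ^+ 2 * `|C|.
    apply: (@le_trans _ _ (t ^+ 3 * `|C|)); first by rewrite ler_wpM2l ?exprn_ge0 ?ler_norm // ltW.
    by rewrite ler_wpM2r // exprS ler_piMl // exprn_ge0 // ltW.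
  have : t * c <= t * (t * D).
    apply: (@le_trans _ _ (t ^+ 2 * (`|b| + `|C|))); first by rewrite mulrDr; lra.
    by rewrite mulrA -expr2 ler_wpM2l // sqr_ge0.
  by rewrite ler_pM2l // leNgt tD.
have a0 : a = 0.
  apply/eqP; rewrite eq_le (key 1) ?normr1 ?mul1r //=.
  by rewrite -oppr_le0 (key (-1)) ?normrN ?normr1 // mulN1r.
split=> //; rewrite leNgt; apply/negP => /small[t /andP[t0 t1] tD].
have := h t; rewrite gtr0_norm // => /(_ t1); rewrite a0 mulr0 add0r => ht.
have : t ^+ 2 * b <= t ^+ 2 * (t * D).
  apply: (le_trans ht); rewrite mulrA -exprSr ler_wpM2l ?exprn_ge0 // 1?ltW //.
  by apply: le_lt_trans (ler_norm C) _; rewrite /D; have := normr_ge0 b; lra.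
by rewrite ler_pM2l ?exprn_gt0 // leNgt tD.
Qed.

Section ExponentialTaylor.
Variables (R : realType) (n : nat).
Implicit Types X Y N : 'M[R]_n.

Lemma expmx_taylor_bound X : exists2 C, 0 <= C & forall t i j, `|t| <= 1 ->
  `|(expmx (t *: X) - (1%:M + t *: X + (t ^+ 2 / 2) *: (X *m X))) i j| <= `|t| ^+ 3 * C.
Proof.
by exists (expR (mxnorm1 X)); [exact: expR_ge0|move=> *; apply: expmx_taylor].
Qed.

(** This differentiates tr(N exp(tX)) at 0. With suitable N, linear conditions satisfied by the
    curve, such as zero entries or symmetry, pass to X. *)
Lemma expmx_functional X N : (forall t, \tr (N *m expmx (t *: X)) = \tr N) ->
  \tr (N *m X) = 0.
Proof.
move=> h; have [C C0 XC] := expmx_taylor_bound X.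
have [] // := @quadratic_le_cubic R (\tr (N *m X)) (\tr (N *m (X *m X)) / 2)
  (\sum_i \sum_j `|N i j| * C).
move=> t t1; pose D := expmx (t *: X) - (1%:M + t *: X + (t ^+ 2 / 2) *: (X *m X)).
have -> : t * \tr (N *m X) + t ^+ 2 * (\tr (N *m (X *m X)) / 2) = - \tr (N *m D).
  rewrite /D mulmxBr !mulmxDr mulmx1 -!scalemxAr raddfB /= !mxtraceD !mxtraceZ h.
  ring.
apply: (le_trans (ler_norm _)); rewrite normrN /mxtrace.
apply: (le_trans (ler_norm_sum _ _ _)).
rewrite mulr_sumr ler_sum // => i _; rewrite mxE mulr_sumr.
apply: (le_trans (ler_norm_sum _ _ _)); apply: ler_sum => j _.
by rewrite normrM mulrCA ler_wpM2l // XC.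
Qed.

Lemma tr_delta_mul (k l : 'I_n) X : \tr (delta_mx l k *m X) = X k l.
Proof.
rewrite /mxtrace (bigD1 l) //= mxE (bigD1 k) //= mxE !eqxx mul1r.
rewrite !big1 ?addr0 // => [j jl|j jk]; last by rewrite mxE (negbTE jk) andbF mul0r.
by rewrite mxE big1 // => m _; rewrite mxE (negbTE jl) mul0r.
Qed.

Lemma expmx_entry X k l : k != l -> (forall t, expmx (t *: X) k l = 0) -> X k l = 0.
Proof.
move=> kl h; rewrite -tr_delta_mul expmx_functional // => t.
by rewrite tr_delta_mul h -[delta_mx l k]mulmx1 tr_delta_mul mxE (negbTE kl).
Qed.

Lemma expmx_symmetric X : (forall t, (expmx (t *: X))^T = expmx (t *: X)) -> X^T = X.
Proof.
move=> h; apply/matrixP => k l; apply/eqP; rewrite mxE -subr_eq0; apply/eqP.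
have := @expmx_functional X (delta_mx k l - delta_mx l k).
have E (M : 'M[R]_n) : \tr ((delta_mx k l - delta_mx l k) *m M) = M l k - M k l.
  by rewrite mulmxBl raddfB /= !tr_delta_mul.
rewrite E; apply=> t; rewrite E -[in RHS](mulmx1 (_ - _)) E.
by rewrite -{1}(h t) !mxE subrr eq_sym subrr.
Qed.

End ExponentialTaylor.

(** * Coordinates in an eigenbasis *)

Section Coordinates.
Variables (K : rcfType) (n : nat) (P : 'M[K]_n).
Hypothesis PU : P \in unitmx.

Section Field.
Variables (L : fieldType) (i : {rmorphism K -> L}).
Implicit Types X Y : 'M[L]_n.

Definition coords X := map_mx i P *m X *m map_mx i (invmx P).
Definition of_coords X := map_mx i (invmx P) *m X *m map_mx i P.

Lemma coordsK : cancel coords of_coords.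
Proof.
move=> X; rewrite /of_coords /coords !mulmxA map_mulVmx // mul1mx.
by rewrite -mulmxA map_mulVmx // mulmx1.
Qed.

Lemma of_coordsK : cancel of_coords coords.
Proof.
move=> X; rewrite /of_coords /coords !mulmxA map_mulmxV // mul1mx.
by rewrite -mulmxA map_mulmxV // mulmx1.
Qed.

Lemma coordsM X Y : coords (X *m Y) = coords X *m coords Y.
Proof.
rewrite /coords !mulmxA -(mulmxA _ (map_mx i (invmx P)) (map_mx i P)).
by rewrite map_mulVmx // mulmx1.
Qed.

Lemma coordsD X Y : coords (X + Y) = coords X + coords Y.
Proof. by rewrite /coords mulmxDr mulmxDl. Qed.

Lemma coords0 : coords 0 = 0.
Proof. by rewrite /coords mulmx0 mul0mx. Qed.

Lemma coordsN X : coords (- X) = - coords X.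
Proof. by rewrite /coords mulmxN mulNmx. Qed.

Lemma coordsZ c X : coords (c *: X) = c *: coords X.
Proof. by rewrite /coords -scalemxAr -scalemxAl. Qed.

Lemma coords1 : coords 1%:M = 1%:M.
Proof. by rewrite /coords mulmx1 map_mulmxV. Qed.

Lemma coords_sum (I : Type) (r : seq I) (f : I -> 'M[L]_n) :
  coords (\sum_(j <- r) f j) = \sum_(j <- r) coords (f j).
Proof. by elim/big_rec2: _ => [|j X Y _ <-]; [exact: coords0|rewrite coordsD]. Qed.

Lemma coordsX X m : coords (X ^+ m) = coords X ^+ m.
Proof.
elim: m => [|m IHm]; first by rewrite !expr0; exact: coords1.
by rewrite !exprS -!mulmxE coordsM IHm.
Qed.

Definition hadamard (c : 'I_n -> 'I_n -> L) X :=
  of_coords (\matrix_(k, l) (c k l * coords X k l)).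

Lemma coords_hadamard c X k l : coords (hadamard c X) k l = c k l * coords X k l.
Proof. by rewrite /hadamard of_coordsK mxE. Qed.

Lemma coords_inj X Y : (forall k l, coords X k l = coords Y k l) -> X = Y.
Proof. by move=> h; apply: (can_inj coordsK); apply/matrixP. Qed.

Lemma coords_diag_mull x X k l : diag_in_basis P i x ->
  coords (x *m X) k l = weight P i x k * coords X k l.
Proof.
move=> xd; rewrite coordsM mxE (bigD1 k) //= big1 ?addr0 // => m mk.
by rewrite [X in X * _]xd ?mul0r // eq_sym.
Qed.

Lemma coords_diag_mulr x X k l : diag_in_basis P i x ->
  coords (X *m x) k l = coords X k l * weight P i x l.
Proof.
move=> xd; rewrite coordsM mxE (bigD1 l) //= big1 ?addr0 // => m ml.
by rewrite [X in _ * X]xd ?mulr0.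
Qed.

Lemma weight_add x y k : weight P i (x + y) k = weight P i x k + weight P i y k.
Proof. by rewrite /weight mulmxDr mulmxDl mxE. Qed.

Lemma weight_scale c x k : weight P i (c *: x) k = c * weight P i x k.
Proof. by rewrite /weight -scalemxAr -scalemxAl mxE. Qed.

(** A nonzero entry of X^m gives a chain of m + 1 indices with strictly decreasing ranks. These are
    distinct, which is impossible for m = n. *)
Lemma coords_nilpotent X (r : 'I_n -> L) (lt : rel L) : transitive lt -> irreflexive lt ->
  (forall k l, coords X k l != 0 -> lt (r l) (r k)) -> X ^+ n = 0.
Proof.
move=> lt_tr lt_irr h.
suff key m k l : (coords X ^+ m) k l != 0 ->
    exists s : seq 'I_n, [/\ size s = m, path (fun a b => lt (r b) (r a)) k s & last k s = l].
  apply: coords_inj => k l; rewrite coords0 coordsX !mxE; apply/eqP/negPn/negP.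
  move=> /key[s [ss ps _]].
  have tr : transitive (fun a b => lt (r b) (r a)) by move=> b a c h1 h2; apply: lt_tr h2 h1.
  have := sorted_uniq tr (fun a => lt_irr (r a)) (s := k :: s) ps.
  by move=> /card_uniqP us; have := max_card (mem (k :: s)); rewrite us card_ord /= ss ltnn.
elim: m k l => [|m IHm] k l.
  rewrite expr0 mxE; have [<- _|_] := eqVneq k l; first by exists [::].
  by rewrite eqxx.
rewrite exprS -mulmxE mxE => /eqP.
have [[j]|none] := pselect (exists j, coords X k j * (coords X ^+ m) j l != 0); last first.
  case; apply: big1 => j _; apply/eqP/negPn/negP => jP; by apply: none; exists j.
rewrite mulf_eq0 negb_or => /andP[/h kj /IHm[s [ss ps ls]]] _.
by exists (j :: s); rewrite /= ss kj.
Qed.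

End Field.
End Coordinates.

Record torus_setting (K : rcfType) (R : realType) (iR : {rmorphism K -> R}) (n : nat)
    (P : 'M[K]_n) (G S : set (mxpoly K n)) (g a : {vspace 'M[R]_n}) : Prop := TorusSetting {
  basis_unit : P \in unitmx;
  G_group : mx_group (geom_points G);
  G_det : geom_points G `<=` [set x | \det x = 1];
  G_tr : self_adjoint G;
  S_max : maximal_split_torus G S;
  S_diag : forall s, geom_points S s -> diag_in_basis P (real_complex K) s;
  S_sym : forall s, geom_points S s -> s = s^T;
  Lie_g : is_Lie_algebra (points iR G) g;
  Lie_a : is_Lie_algebra (split_component iR S) a }.

(** * The Lie algebras of G and A over the reals *)

Section RealGroup.
Variables (K : rcfType) (R : realType) (iR : {rmorphism K -> R}) (n : nat).
Variables (P : 'M[K]_n) (G S : set (mxpoly K n)) (g a : {vspace 'M[R]_n}).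
Hypothesis HS : torus_setting iR P G S g a.
Let PU : P \in unitmx := basis_unit HS.
Let Ggrp : mx_group (geom_points G) := G_group HS.
Let Gdet : geom_points G `<=` [set x | \det x = 1] := G_det HS.
Let Gsa : self_adjoint G := G_tr HS.
Let Smax : maximal_split_torus G S := S_max HS.
Let SdiagC : forall s, geom_points S s -> diag_in_basis P (real_complex K) s := S_diag HS.
Let Ssym : forall s, geom_points S s -> s = s^T := S_sym HS.
Let g_Lie : is_Lie_algebra (points iR G) g := Lie_g HS.
Let a_Lie : is_Lie_algebra (split_component iR S) a := Lie_a HS.
Notation wt := (weight P iR).

Let Sgrp : mx_group (geom_points S). Proof. by case: Smax => -[]. Qed.
Let SG : geom_points S `<=` geom_points G. Proof. by case: Smax. Qed.

Lemma torus_diag (L : rcfType) (i : {rmorphism K -> L}) x : points i S x ->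
  diag_in_basis P i x.
Proof.
by move=> Sx; apply: (geom_points_diag PU _ Sx) => t St;
  apply/is_diag_mxP => k l kl; rewrite -map_invmx; apply: SdiagC.
Qed.

Lemma split_componentE (L : rcfType) (i : {rmorphism K -> L}) :
  split_component i S = [set x | positive_part P S i x].
Proof. exact: (split_component_positive_part PU Sgrp torus_diag iR). Qed.

Lemma positive_part_G (L : rcfType) (i : {rmorphism K -> L}) x :
  positive_part P S i x -> points i G x.
Proof. by case=> Sx _; apply: (geom_points_sub SG). Qed.

Lemma positive_part_tr (L : rcfType) (i : {rmorphism K -> L}) x :
  positive_part P S i x -> x^T = x.
Proof. by case=> Sx _; apply: (geom_points_sym Ssym Sx). Qed.

Lemma a_expmx X : X \in a <-> forall t, positive_part P S iR (expmx (t *: X)).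
Proof. by rewrite a_Lie split_componentE. Qed.

Lemma a_positive_part X : X \in a -> positive_part P S iR (expmx X).
Proof. by move=> /a_expmx/(_ 1); rewrite scale1r. Qed.

Lemma positive_part_expmx x : positive_part P S iR x -> exists2 X, X \in a & x = expmx X.
Proof.
move=> Ax; have [d [xE Ad]] := positive_part_curve PU Sgrp torus_diag Ax.
pose X := invmx (map_mx iR P) *m diag_mx d *m map_mx iR P.
have XE t : expmx (t *: X) = exp_curve (map_mx iR P) d t.
  by apply: expmx_curve; apply: map_unit.
exists X; first by apply/a_expmx => t; rewrite XE.
by rewrite -[X]scale1r XE.
Qed.

Lemma a_diag X : X \in a -> diag_in_basis P iR X.
Proof.
move=> aX k l kl; apply: expmx_entry => // t.
have E : t *: (map_mx iR P *m X *m map_mx iR (invmx P)) =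
    map_mx iR P *m (t *: X) *m invmx (map_mx iR P).
  by rewrite map_invmx -scalemxAr -scalemxAl.
rewrite E expmx_conj ?map_unit // -map_invmx.
by have [Sx _] := (a_expmx X).1 aX t; apply: (torus_diag Sx).
Qed.

Lemma a_tr X : X \in a -> X^T = X.
Proof.
move=> /a_expmx aX; apply: expmx_symmetric => t; apply: positive_part_tr; exact: aX.
Qed.

Lemma a_weight_expmx X k : X \in a -> wt (expmx X) k = expR (wt X k).
Proof.
move=> aX; rewrite {1}(diag_in_basisE PU (a_diag aX)).
have -> : map_mx iR (invmx P) *m diag_mx (\row_k wt X k) *m map_mx iR P =
    1 *: (invmx (map_mx iR P) *m diag_mx (\row_k wt X k) *m map_mx iR P).
  by rewrite scale1r map_invmx.
rewrite expmx_curve ?map_unit // /exp_curve -map_invmx weight_diag // !mxE mul1r.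
by [].
Qed.

Lemma g_conj h X : points iR G h -> X \in g -> h *m X *m invmx h \in g.
Proof.
move=> Gh /g_Lie gX; apply/g_Lie => t.
have hU := geom_points_unit Ggrp Gh.
have -> : t *: (h *m X *m invmx h) = h *m (t *: X) *m invmx h.
  by rewrite -scalemxAr -scalemxAl.
rewrite expmx_conj //; apply: geom_points_mul => //; last exact: geom_points_inv.
by apply: geom_points_mul.
Qed.

Lemma g_tr X : X \in g -> X^T \in g.
Proof.
move=> /g_Lie gX; apply/g_Lie => t.
by rewrite -linearZ /= expmx_tr; apply: geom_points_tr.
Qed.

(* The multipliers preserving g form an algebra of functions on the pairs of
   indices; it contains the functions exp(w_k(H) - w_l(H)), hence separates any
   two pairs with distinct differences of weights. *)
Definition multiplier (c : 'I_n -> 'I_n -> R) :=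
  forall X, X \in g -> hadamard P iR c X \in g.

Lemma multiplier_ext c d : (forall k l, c k l = d k l) -> multiplier c -> multiplier d.
Proof.
move=> cd mc X gX; suff -> : hadamard P iR d X = hadamard P iR c X by apply: mc.
by apply: (coords_inj PU (i := iR)) => k l; rewrite !coords_hadamard // cd.
Qed.

Lemma multiplier_cst b : multiplier (fun _ _ => b).
Proof.
move=> X gX; suff -> : hadamard P iR (fun _ _ => b) X = b *: X by apply: memvZ.
by apply: (coords_inj PU (i := iR)) => k l; rewrite coords_hadamard // coordsZ [RHS]mxE.
Qed.

Lemma multiplierD c d : multiplier c -> multiplier d ->
  multiplier (fun k l => c k l + d k l).
Proof.
move=> mc md X gX; have := memvD (mc X gX) (md X gX); congr (_ \in g).
by apply: (coords_inj PU (i := iR)) => k l; rewrite coordsD [LHS]mxE !coords_hadamard // mulrDl.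
Qed.

Lemma multiplierM c d : multiplier c -> multiplier d ->
  multiplier (fun k l => c k l * d k l).
Proof.
move=> mc md X gX; have := mc _ (md X gX); congr (_ \in g).
by apply: (coords_inj PU (i := iR)) => k l; rewrite !coords_hadamard // mulrA.
Qed.

Lemma multiplier_sum (I : Type) (r : seq I) (c : I -> 'I_n -> 'I_n -> R) :
  (forall j, multiplier (c j)) -> multiplier (fun k l => \sum_(j <- r) c j k l).
Proof.
move=> mc; elim: r => [|j r IHr].
  by apply: multiplier_ext (multiplier_cst 0) => k l; rewrite big_nil.
by apply: multiplier_ext (multiplierD (mc j) IHr) => k l; rewrite big_cons.
Qed.

Lemma multiplier_prod (I : Type) (r : seq I) (Q : pred I) (c : I -> 'I_n -> 'I_n -> R) :
  (forall j, Q j -> multiplier (c j)) ->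
  multiplier (fun k l => \prod_(j <- r | Q j) c j k l).
Proof.
move=> mc; elim: r => [|j r IHr].
  by apply: multiplier_ext (multiplier_cst 1) => k l; rewrite big_nil.
have [Qj|nQj] := boolP (Q j).
  by apply: multiplier_ext (multiplierM (mc j Qj) IHr) => k l; rewrite big_cons Qj.
by apply: multiplier_ext IHr => k l; rewrite big_cons (negbTE nQj).
Qed.

Lemma multiplier_exp H : H \in a -> multiplier (fun k l => expR (wt H k - wt H l)).
Proof.
move=> aH X gX; have AH := a_positive_part aH.
have AV := positive_partV PU Sgrp torus_diag AH.
have := g_conj (positive_part_G AH) gX; congr (_ \in g).
apply: (coords_inj PU (i := iR)) => k l; rewrite coords_hadamard //.
have [SA _] := AH; have [SV _] := AV.
rewrite (coords_diag_mulr PU _ _ _ (torus_diag SV)) (coords_diag_mull PU _ _ _ (torus_diag SA)).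
have -> : wt (invmx (expmx H)) l = (wt (expmx H) l)^-1.
  have AU := geom_points_unit Ggrp (positive_part_G AH).
  have w0 : wt (expmx H) l != 0 by apply: (weight_neq0 PU Sgrp torus_diag).
  apply: (mulfI w0); rewrite -(weightM PU torus_diag) // mulmxV // weight1 //.
  by rewrite mulfV.
by rewrite !a_weight_expmx // expRD expRN mulrAC.
Qed.

Definition same_root (p q : 'I_n * 'I_n) :=
  `[< forall H, H \in a -> wt H p.1 - wt H p.2 = wt H q.1 - wt H q.2 >].

Lemma same_rootP p q : reflect
  (forall H, H \in a -> wt H p.1 - wt H p.2 = wt H q.1 - wt H q.2) (same_root p q).
Proof. exact: asboolP. Qed.

Lemma same_root_sym p q : same_root p q = same_root q p.
Proof. by apply/same_rootP/same_rootP => h H aH; rewrite h. Qed.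

Lemma same_root_trans : transitive same_root.
Proof. by move=> q p r /same_rootP pq /same_rootP qr; apply/same_rootP => H aH; rewrite pq // qr. Qed.

Lemma same_root_refl p : same_root p p. Proof. exact/same_rootP. Qed.

(** Lagrange interpolation: for each q outside the class of p, an exponential that separates p from
    q yields a factor equal to 1 on the class and 0 at q. *)
Lemma multiplier_class p : multiplier (fun k l => (same_root p (k, l))%:R).
Proof.
have /choice[H HP] : forall q, exists H, H \in a /\ (~~ same_root p q ->
    wt H q.1 - wt H q.2 != wt H p.1 - wt H p.2).
  move=> q; have [sp|nsp] := boolP (same_root p q); first by exists 0; split; rewrite ?mem0v.
  apply: contrapT => nex; move/negP: nsp; apply; apply/same_rootP => H aH.
  apply: contrapT => neq; apply: nex; exists H; split=> // _.
  by apply/eqP => e; apply: neq.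
pose f q k l := expR (wt (H q) k - wt (H q) l).
have mf q : multiplier (f q) by apply: multiplier_exp; case: (HP q).
pose c q k l := (f q p.1 p.2 - f q q.1 q.2)^-1 * (f q k l - f q q.1 q.2).
apply: (@multiplier_ext (fun k l => \prod_(q | ~~ same_root p q) c q k l)); last first.
  apply: multiplier_prod => q _; apply: multiplierM; first exact: multiplier_cst.
  by apply: multiplierD => //; apply: multiplier_cst.
move=> k l; have [/same_rootP spkl|nspkl] := boolP (same_root p (k, l)).
  apply: big1 => q nspq; have [aH /(_ nspq) neq] := HP q.
  rewrite /c /f -(spkl _ aH) mulVf // subr_eq0.
  by apply: contra neq => /eqP/expR_inj->.
by rewrite (bigD1 (k, l)) //= /c subrr mulr0 mul0r.
Qed.

(** The sum runs over all pairs instead of one representative for each class, hence the division by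
    the size of the class. *)
Lemma class_sum (c : 'I_n -> 'I_n -> R) :
  (forall p q, same_root p q -> c p.1 p.2 = c q.1 q.2) ->
  forall k l, c k l = \sum_p c p.1 p.2 / (#|same_root p|)%:R * (same_root p (k, l))%:R.
Proof.
move=> cc k l; have N0 : (#|same_root (k, l)|)%:R != 0 :> R.
  by rewrite pnatr_eq0 -lt0n; apply/card_gt0P; exists (k, l); apply: same_root_refl.
have cardE p : same_root p (k, l) -> #|same_root p| = #|same_root (k, l)|.
  move=> pkl; apply: eq_card => q; rewrite /in_mem /=.
  apply/idP/idP => h; last exact: same_root_trans h.
  by apply: same_root_trans h; rewrite same_root_sym.
rewrite (bigID (fun p => same_root p (k, l))) /= [X in _ + X]big1 ?addr0; last first.
  by move=> p /negbTE->; rewrite mulr0.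
rewrite (eq_bigr (fun=> c k l / (#|same_root (k, l)|)%:R)); last first.
  by move=> p pkl; rewrite cardE // pkl mulr1 (cc _ _ pkl).
rewrite (eq_bigl (mem (same_root (k, l)))) => [|p]; last by rewrite /= same_root_sym.
by rewrite sumr_const -(mulr_natr (_ / _)) mulfVK.
Qed.

End RealGroup.

(** * Root spaces *)

Section NilpotentParts.
Variables (K : rcfType) (n : nat) (P : 'M[K]_n) (G : set (mxpoly K n)).

Definition coords_in (c : rel 'I_n) (L : fieldType) (i : {rmorphism K -> L}) (X : 'M[L]_n) :=
  forall k l, coords P i X k l != 0 -> c k l.

(** The Lie algebra exists over R only. For X supported on a relation that forces nilpotency,
    [expmx_nilpotent] is the exponential, and the condition for all t is a first order form of
    membership in the Lie algebra; see [nilpotent_partE]. *)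
Definition nilpotent_part (c : rel 'I_n) (L : rcfType) (i : {rmorphism K -> L})
    (X : 'M[L]_n) :=
  coords_in c i X /\ forall t : L, points i G (expmx_nilpotent (t *: X)).

Lemma mxterm_coords (X : mx_family K n) : mxterm X ->
  mxterm (fun L i e => coords P i (X L i e)).
Proof. by move=> ?; rewrite /coords; elem. Qed.

Lemma mxterm_expmx_nilpotent (X : mx_family K n) : mxterm X ->
  mxterm (fun L i e => expmx_nilpotent (X L i e)).
Proof.
move=> Xt; apply: mxterm_sum => k; apply: mxterm_scale; last by elem.
apply: (@pterm_ext _ (fun L i e => i (k`!%:R)^-1)); last exact: pterm_cst.
by move=> L i e; rewrite fmorphV rmorph_nat.
Qed.

Lemma elementary_coords_in c X : mxterm X -> elementary (fun L i e => coords_in c i (X L i e)).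
Proof.
move=> Xt; apply: elementary_all => k; apply: elementary_all => l.
apply: (@elementary_ext _ (fun L i e => coords P i (X L i e) k l = 0 \/ c k l)).
  move=> L i e; split=> [[->|//]|h]; first by rewrite eqxx.
  by have [->|/h] := eqVneq (coords P i (X L i e) k l) 0; [left|right].
apply: elementary_or; last exact: elementary_cst.
by have := mxterm_coords Xt => /(_ k l); apply: elementary_eq0.
Qed.

Lemma elementary_nilpotent_part c X : mxterm X ->
  elementary (fun L i e => nilpotent_part c i (X L i e)).
Proof.
move=> Xt; apply: elementary_and; first exact: elementary_coords_in.
apply: elementary_allsc; apply: elementary_points.
apply: mxterm_expmx_nilpotent; apply: mxterm_scale; first exact: pterm_head.
exact: mxterm_behead.
Qed.

Lemma mxterm_hadamard (c : rel 'I_n) (X : mx_family K n) : mxterm X ->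
  mxterm (fun L i e => hadamard P i (fun k l => (c k l)%:R) (X L i e)).
Proof.
move=> Xt; apply: mxterm_mul; last by elem.
apply: mxterm_mul; first by elem.
move=> k l; apply: (@pterm_ext _ (fun L i e => (c k l)%:R * coords P i (X L i e) k l)).
  by move=> L i e; rewrite [RHS]mxE.
by apply: pterm_mul; [apply: pterm_nat|apply: mxterm_coords].
Qed.

End NilpotentParts.

Ltac elem_user ::= first
  [ apply: elementary_nilpotent_part | apply: elementary_coords_in
  | apply: elementary_positive_part
  | apply: mxterm_hadamard | apply: mxterm_expmx_nilpotent ].

Section RootSpaces.
Variables (K : rcfType) (R : realType) (iR : {rmorphism K -> R}) (n : nat).
Variables (P : 'M[K]_n) (G S : set (mxpoly K n)) (g a : {vspace 'M[R]_n}).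
Hypothesis HS : torus_setting iR P G S g a.
Variable Delta : seq (dual a).
Hypothesis Delta_basis : root_basis g Delta.
Notation wt := (weight P iR).
Let PU : P \in unitmx := basis_unit HS.

Lemma weight_dual k : exists w : dual a, forall H : subvs_of a, w H = wt (vsval H) k.
Proof.
pose f (H : subvs_of a) : R^o := wt (vsval H) k.
have fL : linear f by move=> c H1 H2; rewrite /f linearP /= weight_add weight_scale.
pose F : {linear subvs_of a -> R^o} := HB.pack f (GRing.isLinear.Build _ _ _ _ f fL).
by exists (linfun F) => H; rewrite lfunE.
Qed.

Lemma eq_dual (al be : dual a) : (forall H, al H = be H) -> al = be.
Proof. by move=> h; apply/lfunP. Qed.

(** Evaluation at the simple roots is injective, since they span the dual, and the dimensions agree
    because they are free; so it is onto. The resulting [H0] is a canonical point of the open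
    chamber. *)
Lemma dual_basis_point : exists H0 : subvs_of a, forall al, al \in Delta -> al H0 = 1.
Proof.
have [_ /andP[/eqP span_D free_D] _] := Delta_basis.
pose m := size Delta.
pose f (H : subvs_of a) : 'rV[R]_m := \row_j Delta`_j H.
have fL : linear f by move=> c H1 H2; apply/rowP => j; rewrite !mxE linearP.
pose F : {linear subvs_of a -> 'rV[R]_m} := HB.pack f (GRing.isLinear.Build _ _ _ _ f fL).
have ker0 : lker (linfun F) == 0%VS.
  rewrite -subv0; apply/subvP => H; rewrite memv_ker lfunE memv0 => /eqP FH0.
  have al0 (al : dual a) : al H = 0.
    have : al \in <<Delta>>%VS by rewrite span_D memvf.
    move/(coord_span (X := in_tuple Delta)) => ->.
    rewrite sum_lfunE big1 // => j _; rewrite scale_lfunE.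
    have := congr1 (fun v : 'rV[R]_m => v 0 j) FH0; rewrite /= /f !mxE.
    by move=> ->; rewrite scaler0.
  rewrite (coord_vbasis (memvf H)) big1 // => j _.
  by have := al0 (linfun (coord (vbasis fullv) j)); rewrite lfunE /= => ->; rewrite scale0r.
have full : limg (linfun F) = fullv.
  apply/eqP; rewrite eqEdim subvf limg_dim_eq; last by rewrite (eqP ker0) capv0.
  rewrite !dimvf /=; have -> : m = \dim {:dual a} by rewrite -span_D; apply/esym/eqP.
  rewrite dimvf; apply: eq_leq.
  by transitivity (1 * (dim (subvs_of a) * 1))%N; last by rewrite mul1n muln1.
have : const_mx 1 \in limg (linfun F) by rewrite full memvf.
move=> /memv_imgP[H0 _ /rowP FH0]; exists H0 => al aD.
have jm : (index al Delta < m)%N by rewrite index_mem.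
by have := FH0 (Ordinal jm); rewrite lfunE /= !mxE /= nth_index.
Qed.

Variable H0 : subvs_of a.
Hypothesis H0E : forall al, al \in Delta -> al H0 = 1.

Lemma nonneg_combination_H0 (al : dual a) : nonneg_combination Delta al ->
  0 <= (al H0 : R) /\ ((al H0 : R) = 0 -> al = 0).
Proof.
move=> [c alE].
have E (be : dual a) m H : (be *+ m) H = be H *+ m.
  elim: m => [|m IHm]; first by rewrite !mulr0n zero_lfunE.
  by rewrite !mulrS add_lfunE IHm.
have H0c : (al H0 : R) = \sum_(be <- Delta) (c be)%:R.
  rewrite alE sum_lfunE big_seq [RHS]big_seq; apply: eq_bigr => be bD.
  by rewrite E H0E.
rewrite H0c; split; first by apply: sumr_ge0 => be _; apply: ler0n.
move=> /eqP; rewrite psumr_eq0 => [|be _]; last exact: ler0n.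
move=> /allP c0; rewrite alE big_seq big1 // => be /c0 /=.
by rewrite pnatr_eq0 => /eqP->.
Qed.

(** At [H0] a root takes its height as value, the sum of its coefficients on the simple roots.
    Positivity of a root is thus a sign at one point. *)
Lemma root_H0 (al : dual a) : Defs.roots g al ->
  (al H0 : R) != 0 /\ ((0 < (al H0 : R)) = `[< pos_roots g Delta al >]).
Proof.
move=> ral; have [al0 _] := ral; have [_ _ /(_ _ ral) Dc] := Delta_basis.
have h1 : nonneg_combination Delta al -> 0 < (al H0 : R).
  move=> /nonneg_combination_H0[h h']; rewrite lt_def h andbT.
  by apply: contra al0 => /eqP/h'->.
have h2 : nonneg_combination Delta (- al) -> (al H0 : R) < 0.
  move=> /nonneg_combination_H0[]; rewrite opp_lfunE oppr_ge0 => h h'.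
  rewrite lt_def h andbT eq_sym; apply: contra al0 => /eqP e.
  by rewrite -oppr_eq0 h' // e oppr0.
case: Dc => [Dc|Dc].
  rewrite (gt_eqF (h1 Dc)) h1 //; split=> //; apply/esym/asboolP; by split.
rewrite (lt_eqF (h2 Dc)); split=> //; apply/idP/asboolP.
  by move/lt_trans => /(_ _ (h2 Dc)); rewrite ltxx.
by case=> _ /h1.
Qed.

Definition root_rel (al : dual a) : rel 'I_n := fun k l =>
  `[< forall H : subvs_of a, wt (vsval H) k - wt (vsval H) l = al H >].

Definition height_rel : rel 'I_n := fun k l => wt (vsval H0) l < wt (vsval H0) k.

Lemma adE (H : subvs_of a) (X : 'M[R]_n) k l :
  coords P iR (vsval H *m X - X *m vsval H) k l =
  (wt (vsval H) k - wt (vsval H) l) * coords P iR X k l.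
Proof.
have Hd := a_diag HS (subvsP H).
rewrite coordsD coordsN [LHS]mxE [X in _ + X]mxE.
by rewrite (coords_diag_mull PU) // (coords_diag_mulr PU) // mulrBl [X in _ - X]mulrC.
Qed.

Lemma root_spaceE (al : dual a) (X : 'M[R]_n) :
  root_space g al X <-> X \in g /\ coords_in P (root_rel al) iR X.
Proof.
split=> [[gX XE]|[gX Xc]]; split=> //.
  move=> k l kl; apply/asboolP => H; apply: (mulIf kl).
  by rewrite -adE XE coordsZ [LHS]mxE.
move=> H; apply: (coords_inj PU (i := iR)) => k l; rewrite adE coordsZ [RHS]mxE.
by have [->|/Xc/asboolP->] := eqVneq (coords P iR X k l) 0; rewrite ?mulr0.
Qed.

Lemma nilpotent_partE (c : rel 'I_n) (X : 'M[R]_n) : subrel c height_rel ->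
  nilpotent_part P G c iR X <-> X \in g /\ coords_in P c iR X.
Proof.
move=> ch; rewrite /nilpotent_part.
have E : coords_in P c iR X -> forall t, expmx (t *: X) = expmx_nilpotent (t *: X).
  move=> Xc t; apply: expmx_nilpotentE.
  apply: (@coords_nilpotent _ _ _ PU _ iR (t *: X) (fun k => wt (vsval H0) k) (fun x y => x < y)).
  - by move=> y x z; apply: lt_trans.
  - by move=> x; rewrite ltxx.
  by move=> k l; rewrite coordsZ mxE mulf_eq0 negb_or => /andP[_ /Xc/ch].
split=> [[Xc gX]|[gX Xc]]; split=> //.
  by apply/(Lie_g HS X) => t; rewrite E.
by move=> t; rewrite -E //; move: t; apply/(Lie_g HS X).
Qed.

Lemma pos_root_rel (al : dual a) : pos_roots g Delta al -> subrel (root_rel al) height_rel.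
Proof.
move=> pal k l /asboolP kl; rewrite /height_rel -subr_gt0 kl.
by have [ral _] := pal; have [_ ->] := root_H0 ral; apply/asboolP.
Qed.

(** Over R the root space coincides with an elementary condition, so its F-extension is the same
    condition over F. Positivity of the root makes its vectors nilpotent. *)
Lemma root_space_FE (F : rcfType) (iF : {rmorphism K -> F}) (al : dual a) :
  pos_roots g Delta al -> root_space_F iR iF g al = [set X | nilpotent_part P G (root_rel al) iF X].
Proof.
move=> pal; rewrite /root_space_F.
have -> : root_space g al = [set X | nilpotent_part P G (root_rel al) iR X].
  apply/seteqP; split=> X; first by move/root_spaceE/nilpotent_partE; apply; apply: pos_root_rel.
  by move=> h; apply/root_spaceE/nilpotent_partE => //; apply: pos_root_rel.
apply: (@sa_extension_elementary K n (fun L i X => nilpotent_part P G (root_rel al) i X)).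
exact: elementary_nilpotent_part.
Qed.

Lemma roots_pair (al : dual a) : Defs.roots g al -> exists p : 'I_n * 'I_n, root_rel al p.1 p.2.
Proof.
move=> [_ [X X0 /root_spaceE[_ Xc]]]; apply: contrapT => no; move/negP: X0; apply.
apply/eqP; apply: (coords_inj PU (i := iR)) => k l; rewrite coords0 [RHS]mxE.
by apply/eqP/negPn/negP => kl; apply: no; exists (k, l); apply: Xc kl.
Qed.

Lemma root_rel_inj (al be : dual a) k l : root_rel al k l -> root_rel be k l -> al = be.
Proof. by move=> /asboolP h1 /asboolP h2; apply: eq_dual => H; rewrite -h1 -h2. Qed.

Lemma finite_roots : finite_set (Defs.roots g (a := a)).
Proof.
have /choice[w wE] := weight_dual.
apply: (@sub_finite_set _ _ ((fun p : 'I_n * 'I_n => w p.1 - w p.2) @` setT)); last first.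
  exact: finite_image.
move=> al /roots_pair[p /asboolP palE]; exists p => //.
by apply: eq_dual => H; rewrite add_lfunE opp_lfunE !wE palE.
Qed.

Lemma root_rel_hadamard (al : dual a) X : Defs.roots g al -> X \in g ->
  hadamard P iR (fun k l => (root_rel al k l)%:R) X \in g.
Proof.
move=> /roots_pair[[k0 l0] /= kl0] gX; apply: (multiplier_ext HS _ (multiplier_class HS (k0, l0))) => //.
move=> k l; congr (_%:R); congr nat_of_bool; apply/(same_rootP iR P a)/asboolP => /= h.
  by move=> H; move/asboolP: kl0 => <-; rewrite -h // subvsP.
move=> H aH; by rewrite -(vsprojK aH) h; move/asboolP: kl0 => ->.
Qed.

End RootSpaces.

(** * The sum of the positive root spaces *)

Section PositiveRootSum.
Variables (K : rcfType) (R : realType) (iR : {rmorphism K -> R}) (n : nat).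
Variables (P : 'M[K]_n) (G S : set (mxpoly K n)) (g a : {vspace 'M[R]_n}).
Hypothesis HS : torus_setting iR P G S g a.
Variable Delta : seq (dual a).
Hypothesis Delta_basis : root_basis g Delta.
Variable H0 : subvs_of a.
Hypothesis H0E : forall al, al \in Delta -> al H0 = 1.
Notation wt := (weight P iR).
Let PU : P \in unitmx := basis_unit HS.
Notation higher := (height_rel iR P H0).
Notation root_rel := (root_rel iR P).
Notation nilp := (nilpotent_part P G).
Let hh : subrel higher higher. Proof. by []. Qed.

(** The candidate root is w_k - w_l. Projecting X to the coordinates on which this difference is the
    same stays in g, and gives a root vector that is nonzero at (k, l). *)
Lemma height_root X k l : X \in g -> higher k l -> coords P iR X k l != 0 ->
  exists2 al, pos_roots g Delta al & root_rel al k l.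
Proof.
move=> gX hkl Xkl; have [wk wkE] := weight_dual iR P a k.
have [wl wlE] := weight_dual iR P a l.
pose al : dual a := wk - wl.
have alE H : (al H : R) = wt (vsval H) k - wt (vsval H) l.
  by rewrite /al add_lfunE opp_lfunE wkE wlE.
have al0 : 0 < (al H0 : R) by rewrite alE subr_gt0.
have ral : Defs.roots g al.
  split; first by apply: contraTneq al0 => ->; rewrite zero_lfunE ltxx.
  exists (hadamard P iR (fun k' l' => (same_root iR P a (k, l) (k', l'))%:R) X).
    apply: contra Xkl => /eqP E; apply/eqP.
    have := congr1 (fun M => coords P iR M k l) E.
    by rewrite coords_hadamard // same_root_refl mul1r coords0 [X in _ = X]mxE.
  apply/(root_spaceE HS); split; first exact: (multiplier_class HS).
  move=> k' l'; rewrite coords_hadamard //.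
  case: (same_rootP iR P a (k, l) (k', l')) => [same _|_]; last by rewrite mul0r eqxx.
  by apply/asboolP => H; rewrite alE -(same _ (subvsP H)).
exists al; last by apply/asboolP => H; rewrite alE.
by have [_] := root_H0 Delta_basis H0E ral; rewrite al0 => /esym/asboolP.
Qed.

(** Over an extension the nilpotent parts are not given as a vector space; closure under addition of
    a root component comes from R by transfer. *)
Lemma nilpotent_part_add (al : dual a) : pos_roots g Delta al ->
  forall (L : rcfType) (i : {rmorphism K -> L}) X Y,
  nilp higher i X -> nilp (root_rel al) i Y -> nilp higher i (X + Y).
Proof.
move=> pal L i; apply: (@elementary_transfer K (fun L i => forall X Y,
  nilp higher i X -> nilp (root_rel al) i Y -> nilp higher i (X + Y)) _ R iR).
  by elem.
have sub : subrel (root_rel al) higher by apply: (pos_root_rel Delta_basis H0E pal).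
move=> X Y /(nilpotent_partE HS _ hh)[gX Xc] /(nilpotent_partE HS _ sub)[gY Yc].
apply/(nilpotent_partE HS _ hh); split; first exact: memvD.
move=> k l; rewrite coordsD [X in X != _]mxE.
have [->|/Xc//] := eqVneq (coords P iR X k l) 0; rewrite add0r => /Yc; exact: sub.
Qed.

Lemma nilpotent_part_root (al : dual a) : pos_roots g Delta al ->
  forall (L : rcfType) (i : {rmorphism K -> L}) X, nilp higher i X ->
  nilp (root_rel al) i (hadamard P i (fun k l => (root_rel al k l)%:R) X).
Proof.
move=> pal L i; apply: (@elementary_transfer K (fun L i => forall X,
  nilp higher i X ->
  nilp (root_rel al) i (hadamard P i (fun k l => (root_rel al k l)%:R) X)) _ R iR).
  by elem.
have sub : subrel (root_rel al) higher by apply: (pos_root_rel Delta_basis H0E pal).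
have [ral _] := pal.
move=> X /(nilpotent_partE HS _ hh)[gX Xc].
apply/(nilpotent_partE HS _ sub); split; first exact: (root_rel_hadamard HS).
by move=> k l; rewrite coords_hadamard //; case: (root_rel al k l); rewrite ?mulr0n ?mul0r ?eqxx.
Qed.

Lemma nilpotent_part_no_root k l :
  ~ (exists2 al, pos_roots g Delta al & root_rel al k l) ->
  forall (L : rcfType) (i : {rmorphism K -> L}) X, nilp higher i X ->
  coords P i X k l = 0.
Proof.
move=> no L i; apply: (@elementary_transfer K (fun L i => forall X,
  nilp higher i X -> coords P i X k l = 0) _ R iR).
  apply: elementary_allmx; apply: elementary_imp; first by elem.
  by apply: elementary_eq0; apply: mxterm_coords; elem.
move=> X /(nilpotent_partE HS _ hh)[gX Xc]; apply/eqP/negPn/negP => Xkl.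
by apply: no; apply: (height_root gX (Xc _ _ Xkl) Xkl).
Qed.

Lemma nilpotent_part0 (L : rcfType) (i : {rmorphism K -> L}) : nilp higher i 0.
Proof.
apply: (@elementary_transfer K (fun L i => nilp higher i 0) _ R iR).
  by elem.
apply/(nilpotent_partE HS _ hh); split; first exact: mem0v.
by move=> k l; rewrite coords0 [X in X != _]mxE eqxx.
Qed.

(** In coordinates the root spaces have disjoint supports, which cover the supports of all nilpotent
    parts. The components of X are therefore its restrictions to these supports. *)
Lemma pos_root_sum_FE (F : rcfType) (iF : {rmorphism K -> F}) :
  pos_root_sum_F iR iF g Delta = [set X | nilp higher iF X].
Proof.
have finp : finite_set (pos_roots g Delta).
  by apply: sub_finite_set (finite_roots HS) => al [].
apply/seteqP; split=> X /=.
  move=> [Y YP ->]; rewrite fsbig_finite //= big_seq.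
  elim/big_rec: _ => [|al Z]; first exact: nilpotent_part0.
  rewrite in_fset_set // inE => pal NZ; rewrite addrC.
  apply: (nilpotent_part_add pal) => //.
  by have := YP _ pal; rewrite (root_space_FE HS Delta_basis H0E).
move=> NX; exists (fun al => hadamard P iF (fun k l => (root_rel al k l)%:R) X).
  move=> al pal; rewrite (root_space_FE HS Delta_basis H0E) //=.
  exact: nilpotent_part_root.
rewrite fsbig_finite //=; apply: (coords_inj PU (i := iF)) => k l.
rewrite coords_sum summxE.
rewrite (eq_bigr (fun al => (root_rel al k l)%:R * coords P iF X k l)); last first.
  by move=> al _; rewrite coords_hadamard.
have [[al pal alkl]|no] := pselect (exists2 al, pos_roots g Delta al & root_rel al k l).
  have alin : al \in fset_set (pos_roots g Delta) by rewrite in_fset_set // inE.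
  rewrite (bigD1_seq al alin (fset_uniq _)) /= alkl mul1r big1 ?addr0 //.
  move=> be beal; case: (boolP (root_rel be k l)) => [bekl|_]; last by rewrite mul0r.
  by move: beal; rewrite (root_rel_inj bekl alkl) eqxx.
by rewrite (nilpotent_part_no_root no NX) big1 // => al _; rewrite mulr0.
Qed.

End PositiveRootSum.

(** * The Cartan decomposition *)

Section SecondOrder.
Variable R : realType.

(** An expansion of order two at 0 with cubic remainder on [-1, 1]. It is stable under sums and
    products, so expansions of matrix products need no derivatives. *)
Definition jet2 (f : R -> R) (a b c : R) := exists2 C, 0 <= C & forall t, `|t| <= 1 ->
  `|f t - (a + b * t + c * t ^+ 2)| <= C * `|t| ^+ 3.

Lemma jet2_cst a : jet2 (fun=> a) a 0 0.
Proof.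
by exists 0 => // t _; rewrite !mul0r !addr0 subrr normr0.
Qed.

Lemma jet2D f g a b c a' b' c' : jet2 f a b c -> jet2 g a' b' c' ->
  jet2 (fun t => f t + g t) (a + a') (b + b') (c + c').
Proof.
move=> [C C0 fC] [D D0 gD]; exists (C + D); first exact: addr_ge0.
move=> t t1 /=; rewrite [X in _ <= X]mulrDl.
have -> : f t + g t - (a + a' + (b + b') * t + (c + c') * t ^+ 2) =
  (f t - (a + b * t + c * t ^+ 2)) + (g t - (a' + b' * t + c' * t ^+ 2)) by ring.
by apply: le_trans (ler_normD _ _) _; apply: lerD; [apply: fC|apply: gD].
Qed.

Lemma jet2M f g a b c a' b' c' : jet2 f a b c -> jet2 g a' b' c' ->
  jet2 (fun t => f t * g t) (a * a') (a * b' + b * a') (a * c' + b * b' + c * a').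
Proof.
move=> [C C0 fC] [D D0 gD].
pose A := `|a| + `|b| + `|c|; pose A' := `|a'| + `|b'| + `|c'|.
have A0 : 0 <= A by rewrite !addr_ge0.
have A'0 : 0 <= A' by rewrite !addr_ge0.
exists (A * A' + A * D + C * A' + C * D); first by rewrite !addr_ge0 // mulr_ge0.
move=> t t1 /=; have t0 : 0 <= `|t| by [].
have [p pE] : exists p, p = a + b * t + c * t ^+ 2 by eexists.
have [q qE] : exists q, q = a' + b' * t + c' * t ^+ 2 by eexists.
have poly x y z : `|x + y * t + z * t ^+ 2| <= `|x| + `|y| + `|z|.
  apply: le_trans (ler_normD _ _) _; apply: lerD.
    apply: le_trans (ler_normD _ _) _; apply: lerD => //.
    by rewrite normrM ler_piMr.
  by rewrite normrM normrX ler_piMr // expr_le1.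
have pA : `|p| <= A by rewrite pE; apply: poly.
have qA : `|q| <= A' by rewrite qE; apply: poly.
have := fC t t1; have := gD t t1; rewrite -pE -qE => gq fp.
(* With p and q the quadratic parts of f and g, the first summand is what remains of p q beyond
   degree two. *)
have -> : f t * g t - (a * a' + (a * b' + b * a') * t + (a * c' + b * b' + c * a') * t ^+ 2) =
  (b * c' + c * b' + c * c' * t) * t ^+ 3 + p * (g t - q) + (f t - p) * q + (f t - p) * (g t - q).
  by rewrite pE qE; ring.
have T3 : `|t| ^+ 3 * `|t| ^+ 3 <= `|t| ^+ 3 by rewrite ler_piMr ?exprn_ge0 // exprn_ile1.
have -> : (A * A' + A * D + C * A' + C * D) * `|t| ^+ 3 =
  A * A' * `|t| ^+ 3 + A * D * `|t| ^+ 3 + C * A' * `|t| ^+ 3 + C * D * `|t| ^+ 3 by ring.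
apply: le_trans (ler_normD _ _) _; apply: lerD; last first.
  rewrite normrM; apply: le_trans (ler_pM _ _ fp gq) _ => //.
  by rewrite mulrACA ler_wpM2l // mulr_ge0.
apply: le_trans (ler_normD _ _) _; apply: lerD; last first.
  rewrite normrM; apply: le_trans (ler_pM _ _ fp qA) _ => //.
  by rewrite mulrAC.
apply: le_trans (ler_normD _ _) _; apply: lerD; last first.
  by rewrite normrM; apply: le_trans (ler_pM _ _ pA gq) _ => //; rewrite mulrA.
rewrite normrM normrX ler_wpM2r ?exprn_ge0 //.
have h1 : `|b * c' + c * b' + c * c' * t| <= `|b| * `|c'| + `|c| * `|b'| + `|c| * `|c'|.
  apply: le_trans (ler_normD _ _) _; apply: lerD.
    by apply: le_trans (ler_normD _ _) _; rewrite !normrM.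
  by rewrite !normrM ler_piMr // mulr_ge0.
apply: (le_trans h1); rewrite /A /A' !mulrDl !mulrDr.
have e (x y : R) : 0 <= `|x| * `|y| by rewrite mulr_ge0.
have := e a a'; have := e a b'; have := e a c'; have := e b a'; have := e b b'.
have := e b c'; have := e c a'; have := e c b'; have := e c c'; lra.
Qed.

Lemma jet2_sum (I : Type) (r : seq I) (f : I -> R -> R) a b c :
  (forall j, jet2 (f j) (a j) (b j) (c j)) ->
  jet2 (fun t => \sum_(j <- r) f j t) (\sum_(j <- r) a j) (\sum_(j <- r) b j)
    (\sum_(j <- r) c j).
Proof.
move=> fj; elim: r => [|j r IHr].
  by rewrite !big_nil; under [fun t => _]eq_fun do rewrite big_nil; apply: jet2_cst.
rewrite !big_cons; under [fun t => _]eq_fun do rewrite big_cons.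
exact: jet2D.
Qed.

Lemma jet2_max f a b c : jet2 f a b c -> (forall t, f t <= a) -> b = 0 /\ c <= 0.
Proof.
move=> [C C0 fC] fa; apply: (@quadratic_le_cubic _ b c C) => t t1.
have := fC t t1; rewrite ler_distl => /andP[h _]; have := fa t; lra.
Qed.

Section Matrices.
Variable n : nat.
Implicit Types A B C X Z H : 'M[R]_n.

Definition mxjet2 (u : R -> 'M[R]_n) A B C :=
  forall k l, jet2 (fun t => u t k l) (A k l) (B k l) (C k l).

Lemma mxjet2_cst A : mxjet2 (fun=> A) A 0 0.
Proof. by move=> k l; rewrite !mxE; apply: jet2_cst. Qed.

Lemma mxjet2M u v A B C A' B' C' : mxjet2 u A B C -> mxjet2 v A' B' C' ->
  mxjet2 (fun t => u t *m v t) (A *m A') (A *m B' + B *m A')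
    (A *m C' + B *m B' + C *m A').
Proof.
move=> uA vA k l; rewrite !mxE; under [fun t => _]eq_fun do rewrite mxE.
by rewrite -!big_split /=; apply: jet2_sum => j; apply: jet2M.
Qed.

Lemma mxjet2_tr u A B C : mxjet2 u A B C -> mxjet2 (fun t => (u t)^T) A^T B^T C^T.
Proof. by move=> uA k l; rewrite !mxE; under [fun t => _]eq_fun do rewrite mxE. Qed.

Lemma mxjet2_expmx Z : mxjet2 (fun t => expmx (t *: Z)) 1%:M Z (2^-1 *: (Z *m Z)).
Proof.
have [C C0 ZC] := expmx_taylor_bound Z; move=> k l; exists C => // t t1.
have := ZC t k l t1; rewrite [X in _ <= X]mulrC.
suff -> : (expmx (t *: Z) - (1%:M + t *: Z + (t ^+ 2 / 2) *: (Z *m Z))) k l =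
  expmx (t *: Z) k l - ((1%:M : 'M[R]_n) k l + Z k l * t +
    (2^-1 *: (Z *m Z)) k l * t ^+ 2) by [].
by rewrite !mxE; ring.
Qed.

Lemma jet2_tr u A B C : mxjet2 u A B C -> jet2 (fun t => \tr (u t)) (\tr A) (\tr B) (\tr C).
Proof. by move=> uA; apply: jet2_sum. Qed.

(* First and second order conditions at a maximum of k |-> tr(k X k^T H). *)
Lemma conjugation_max X H Z :
  (forall t, \tr (expmx (t *: Z) *m X *m (expmx (t *: Z))^T *m H) <= \tr (X *m H)) ->
  \tr ((Z *m X + X *m Z^T) *m H) = 0 /\
  \tr ((2^-1 *: (Z *m Z) *m X + Z *m X *m Z^T + X *m (2^-1 *: (Z *m Z)^T)) *m H) <= 0.
Proof.
have jZ := mxjet2_expmx Z.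
have j1 := mxjet2M jZ (mxjet2_cst X).
have j2 := mxjet2M j1 (mxjet2_tr jZ).
have := jet2_tr (mxjet2M j2 (mxjet2_cst H)).
rewrite !(mulmx0, mul1mx, mulmx1, trmx1, add0r, addr0) => j /(jet2_max j)[].
rewrite linearZ /= => j1' j2'; rewrite addrC; split=> //.
by rewrite addrC [X in _ + X]addrC addrA.
Qed.

End Matrices.
End SecondOrder.

Lemma orthogonal_entry (L : rcfType) n (k : 'M[L]_n) i j :
  k *m k^T = 1%:M -> `|k i j| <= 1.
Proof.
move=> /matrixP/(_ i i); rewrite !mxE eqxx mulr1n => h.
rewrite -(@expr_le1 _ 2) // real_normK ?num_real // -h (bigD1 j) //= mxE -expr2 lerDl.
by apply: sumr_ge0 => l _; rewrite mxE -expr2 sqr_ge0.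
Qed.

(** The orthogonal points of G, flattened into rows, form a closed subset of a cube, on which a
    continuous function attains its maximum. *)
Lemma orthogonal_max (K : rcfType) (R : realType) (i : {rmorphism K -> R}) n
    (G : set (mxpoly K n)) (X H : 'M[R]_n) : points i G 1%:M ->
  exists k0, [/\ points i G k0, k0 *m k0^T = 1%:M & forall k, points i G k ->
    k *m k^T = 1%:M -> \tr (k *m X *m k^T *m H) <= \tr (k0 *m X *m k0^T *m H)].
Proof.
move=> G1; pose E := [set v : 'rV[R]_(n * n) | points i G (vec_mx v) /\
  vec_mx v *m (vec_mx v)^T = 1%:M].
pose mxcont (u : 'rV[R]_(n * n) -> 'M[R]_n) := forall k l, continuous (fun v => u v k l).
have cid : mxcont vec_mx.
  move=> k l; rewrite (_ : (fun v => _) = (fun v : 'rV[R]_(n * n) => v 0 (mxvec_index k l))).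
    exact: coord_continuous.
  by apply/funext => v; rewrite mxE.
have ctr u : mxcont u -> mxcont (fun v => (u v)^T).
  move=> cu k l; rewrite (_ : (fun v => _) = (fun v => u v l k)); first exact: cu.
  by apply/funext => v; rewrite mxE.
have ccst M : mxcont (fun=> M) by move=> k l; apply: cst_continuous.
have csum (I : Type) (r : seq I) (f : I -> 'rV[R]_(n * n) -> R) :
    (forall j, continuous (f j)) -> continuous (fun v => \sum_(j <- r) f j v).
  by move=> cf v; apply: (cvg_sumr (nbhs_filter v)) => j; apply: cf.
have cmul u u' : mxcont u -> mxcont u' -> mxcont (fun v => u v *m u' v).
  move=> cu cu' k l; rewrite (_ : (fun v => _) = (fun v => \sum_j u v k j * u' v j l)).
    by apply: csum => j v; exact: (cvgM (cu k j v) (cu' j l v)).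
  by apply/funext => v; rewrite mxE.
have cE : closed E.
  rewrite (_ : E = (\bigcap_(p in G) [set v | mxeval i p (vec_mx v) \in [set 0 : R]]) `&`
    \bigcap_(kl in [set: 'I_n * 'I_n])
      [set v | (vec_mx v *m (vec_mx v)^T) kl.1 kl.2 \in [set (1%:M : 'M[R]_n) kl.1 kl.2]]).
    apply: closedI; apply: closed_bigI => j _.
      rewrite (_ : [set v | _] = (fun v => mxeval i j (vec_mx v)) @^-1` [set 0]); last first.
        by apply/funext => v; rewrite /= inE.
      apply: preimage_closed; last exact: closed_eq.
      suff c : continuous (fun v : 'rV[R]_(n * n) => mxeval i j (vec_mx v)).
        by move=> v _; apply: c.
      apply: (@mxeval_ind K n R i _ vec_mx
        (fun f : 'rV[R]_(n * n) -> R => continuous f)).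
      - by move=> c; apply: cst_continuous.
      - exact: cid.
      - by move=> f g cf cg v; exact: (cvgD (cf v) (cg v)).
      - by move=> f g cf cg v; exact: (cvgM (cf v) (cg v)).
    rewrite (_ : [set v | _] = (fun v => (vec_mx v *m (vec_mx v)^T) j.1 j.2) @^-1`
      [set (1%:M : 'M[R]_n) j.1 j.2]); last first.
      by apply/funext => v; rewrite /= inE.
    apply: preimage_closed; last exact: closed_eq.
    by move=> v _; apply: cmul => //; apply: ctr.
  apply/seteqP; split=> v [h1 h2]; split.
  - by move=> p Gp; rewrite /= inE; apply: h1.
  - by move=> j _; rewrite /= inE h2.
  - by move=> p Gp; have := h1 p Gp; rewrite /= inE.
  - by apply/matrixP => k l; have := h2 (k, l) Logic.I; rewrite /= inE.
have cptE : compact E.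
  have cpt := @rV_compact R (n * n) (fun=> `[(-1 : R), 1]%classic)
    (fun=> @segment_compact R _ _).
  apply: (subclosed_compact cE cpt) => v [_ vv] j /=.
  rewrite in_itv /= -ler_norml.
  by case/mxvec_indexP: j => k l; have := orthogonal_entry k l vv; rewrite mxE.
have [||v] := compact_EVT_max (f := fun v : 'rV[R]_(n * n) => \tr (vec_mx v *m X *m (vec_mx v)^T *m H)) _ cptE.
- by exists (mxvec 1%:M); rewrite /E /= mxvecK mul1mx trmx1.
- apply: continuous_subspaceT; apply: csum => j.
  by apply: (cmul) => //; apply: (cmul); [apply: (cmul)|apply: ctr].
rewrite inE => -[Gv vv] vmax; exists (vec_mx v); split=> // k Gk kk.
by have := vmax (mxvec k); rewrite mxvecK; apply; rewrite inE /E /= mxvecK.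
Qed.

Lemma mxtrace_gram (L : nzRingType) n (W : 'M[L]_n) :
  \tr (W *m W^T) = \sum_i \sum_j W i j ^+ 2.
Proof. by apply: eq_bigr => i _; rewrite mxE; apply: eq_bigr => j _; rewrite mxE expr2. Qed.

Lemma mxtrace_gram_ge0 (L : realDomainType) n (W : 'M[L]_n) : 0 <= \tr (W *m W^T).
Proof. by rewrite mxtrace_gram; do 2!apply: sumr_ge0 => ? _; apply: sqr_ge0. Qed.

Lemma sqr_mxtrace_eq0 (L : realDomainType) n (W : 'M[L]_n) : \tr (W *m W^T) = 0 -> W = 0.
Proof.
rewrite mxtrace_gram => W0.
have pos i : 0 <= \sum_j W i j ^+ 2 by apply: sumr_ge0 => j _; apply: sqr_ge0.
move/eqP: W0; rewrite psumr_eq0 // => /allP W0; apply/matrixP => i j.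
have /W0 /= : i \in index_enum 'I_n by rewrite mem_index_enum.
rewrite psumr_eq0 => [/allP Wi|k _]; last exact: sqr_ge0.
have /Wi /= : j \in index_enum 'I_n by rewrite mem_index_enum.
by rewrite sqrf_eq0 mxE => /eqP.
Qed.

Lemma mxtrace_bracket (L : comNzRingType) n (X Z H : 'M[L]_n) :
  \tr ((Z *m X - X *m Z) *m H) = \tr (X *m (H *m Z - Z *m H)).
Proof.
rewrite mulmxBl mulmxBr !linearB /= !mulmxA; congr (_ - _).
by rewrite -(mulmxA Z) mxtrace_mulC.
Qed.

Lemma mxtrace_second_order (L : realFieldType) n (X Z H : 'M[L]_n) : X *m H = H *m X ->
  \tr ((2^-1 *: (Z *m Z) *m X - Z *m X *m Z + X *m (2^-1 *: (Z *m Z))) *m H) =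
  \tr (Z *m (Z *m X - X *m Z) *m H).
Proof.
move=> XH; have e : \tr (X *m (Z *m Z) *m H) = \tr (Z *m Z *m X *m H).
  by rewrite mxtrace_mulC (mulmxA H X) -XH mxtrace_mulC !mulmxA.
rewrite -scalemxAl -scalemxAr 2!mulmxDl mulNmx -!scalemxAl mulmxBr mulmxBl.
rewrite !mxtraceD mxtraceZ mxtraceZ !raddfN /= e !mulmxA.
by field.
Qed.

Section RealCartan.
Variables (K : rcfType) (R : realType) (iR : {rmorphism K -> R}) (n : nat).
Variables (P : 'M[K]_n) (G S : set (mxpoly K n)) (g a : {vspace 'M[R]_n}).
Hypothesis HS : torus_setting iR P G S g a.
Variable Delta : seq (dual a).
Hypothesis Delta_basis : root_basis g Delta.
Variable H0 : subvs_of a.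
Hypothesis H0E : forall al, al \in Delta -> al H0 = 1.
Notation wt := (weight P iR).
Let PU : P \in unitmx := basis_unit HS.
Implicit Types X E Z : 'M[R]_n.

(** The logarithm is taken in an eigenbasis. At integers the resulting curve runs through the powers
    of h h^T, which are symmetric points of G; both properties extend to all times by independence
    of exponentials. *)
Lemma gram_log h : points iR G h ->
  exists X, [/\ X \in g, X^T = X & expmx X = h *m h^T].
Proof.
move=> Gh; set q := h *m h^T.
have qT : q^T = q by rewrite trmx_mul trmxK.
have Gq : points iR G q.
  by apply: (geom_points_mul (G_group HS)) => //; apply: (geom_points_tr (G_tr HS)).
have hU := geom_points_unit (G_group HS) Gh.
have mid (M : 'M[R]_n) : map_mx idfun M = M by apply: map_mx_id.
have [Q QU /(diagonalizable_forP _ QU) qQ] := symmetric_diagonalizable qT.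
have qd : diag_in_basis Q idfun q by move=> k l kl; rewrite !mid; apply: qQ.
have q0 := gram_weight_gt0 h QU hU qd.
pose d := \row_k ln (weight Q idfun q k).
have e1 : exp_curve Q d 1 = q.
  rewrite [RHS](diag_in_basisE QU qd) !mid /exp_curve; congr (_ *m diag_mx _ *m _); apply/rowP => k.
  by rewrite !mxE mul1r lnK // posrE; apply: q0.
have em m : exp_curve Q d m%:R = q ^+ m by rewrite exp_curve_natmul // e1.
have qm m : points iR G (q ^+ m).
  elim: m => [|m IHm]; first exact: (geom_points1 (G_group HS)).
  by rewrite exprS; apply: (geom_points_mul (G_group HS)).
have Gcurve : forall t, points iR G (exp_curve Q d t).
  by apply: points_exp_curve => m; rewrite em.
pose X := invmx Q *m diag_mx d *m Q.
have XE t : expmx (t *: X) = exp_curve Q d t by apply: expmx_curve.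
exists X; split; last by rewrite -[X]scale1r XE.
  by apply/(Lie_g HS) => t; rewrite XE.
apply: expmx_symmetric => t; rewrite XE; apply/matrixP => k l.
have cE s k' l' : exp_curve Q d s k' l' =
    \sum_m (invmx Q k' m * Q m l') * expR (s * d 0 m).
  rewrite /exp_curve mxE; apply: eq_bigr => m _.
  by rewrite mul_mx_diag !mxE mulrAC.
apply/eqP; rewrite mxE -subr_eq0; apply/eqP; move: t.
apply: (@exp_sum_eq0 _ (fun t => exp_curve Q d t l k - exp_curve Q d t k l)).
  have ce k' l' : exp_sum (fun t => exp_curve Q d t k' l').
    apply: (exp_sum_ext (fun s => esym (cE s k' l'))); apply: exp_sum_sum => m.
    exact: exp_sum_exp.
  apply: exp_sumD => //.
  apply: (@exp_sum_ext _ (fun t => -1 * exp_curve Q d t k l)) => [t|]; first by rewrite mulN1r.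
  by apply: exp_sumM => //; apply: exp_sum_cst.
move=> m; rewrite em; have qmT : (q ^+ m)^T = q ^+ m.
  elim: m => [|m IHm]; first by rewrite expr0; exact: trmx1.
  by rewrite {1}exprS -mulmxE trmx_mul IHm qT mulmxE -exprSr.
by rewrite -{1}qmT mxE subrr.
Qed.

Lemma expmx_skew Z t : Z \in g -> Z^T = - Z ->
  points iR G (expmx (t *: Z)) /\ expmx (t *: Z) *m (expmx (t *: Z))^T = 1%:M.
Proof.
move=> gZ ZT; split; first by move/(Lie_g HS): gZ.
by rewrite -expmx_tr linearZ /= ZT scalerN expmxN.
Qed.

(** Elements of a are symmetric, so transposition exchanges the root spaces of al and - al. *)
Lemma root_vector_tr (al : dual a) E : root_space g al E -> forall H : subvs_of a,
  vsval H *m E^T - E^T *m vsval H = - ((al H : R) *: E^T).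
Proof.
move=> [_ EE] H; have HT := a_tr HS (subvsP H).
have := congr1 trmx (EE H); rewrite linearB linearZ /= !trmx_mul HT => <-.
by rewrite opprB.
Qed.

Lemma root_bracket (al : dual a) E : root_space g al E -> forall H : subvs_of a,
  vsval H *m (E - E^T) - (E - E^T) *m vsval H = (al H : R) *: (E + E^T).
Proof.
move=> Er H; have [_ EE] := Er; have ET := root_vector_tr Er H.
rewrite mulmxBr mulmxBl scalerDr -EE -[_ *: E^T]opprK -ET.
by rewrite opprD addrACA -opprD.
Qed.

Lemma expmx_commute X H : X *m H = H *m X -> expmx X *m expmx H = expmx H *m expmx X.
Proof. by move=> XH; apply: expmx_comm; apply/esym/expmx_comm. Qed.

Section Maximum.
Variable X : 'M[R]_n.
Hypothesis gX : X \in g.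
Hypothesis XT : X^T = X.
Hypothesis Xmax : forall k, points iR G k -> k *m k^T = 1%:M ->
  \tr (k *m X *m k^T *m vsval H0) <= \tr (X *m vsval H0).

Lemma mxtrace_symmetric E : \tr (X *m E^T) = \tr (X *m E).
Proof. by rewrite -mxtrace_tr trmx_mul trmxK XT mxtrace_mulC. Qed.

(** The skew element Z = E - E^T generates a curve in the compact group. The first order condition
    along it reads al(H0) tr(X (E + E^T)) = 0, and al(H0) is nonzero. *)
Lemma maximum_root (al : dual a) E : Defs.roots g al -> root_space g al E -> \tr (X *m E) = 0.
Proof.
move=> ral Er; have [al0 _] := root_H0 Delta_basis H0E ral.
have [gE EE] := Er; have ET := root_vector_tr Er.
pose Z := E - E^T.
have gZ : Z \in g by rewrite memvB // (g_tr HS).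
have ZT : Z^T = - Z by rewrite /Z linearB /= trmxK opprB.
have [|h _] := @conjugation_max _ _ X (vsval H0) Z.
  by move=> t; have [GZ ZZ] := expmx_skew t gZ ZT; apply: Xmax.
have E1 := root_bracket Er H0.
have : \tr ((Z *m X + X *m Z^T) *m vsval H0) = \tr (X *m ((al H0 : R) *: (E + E^T))).
  by rewrite -E1 -/Z ZT mulmxN mxtrace_bracket.
rewrite h -scalemxAr linearZ /= mulmxDr linearD /= mxtrace_symmetric.
move/esym/eqP; rewrite scaler_eq0 (negbTE al0) /= -mulr2n mulrn_eq0 /=.
by move/eqP.
Qed.

(** Decomposing ad H along root vectors shows that X is trace orthogonal to [H, g]. Now W = [X, H]
    is in g and skew, so tr(W W^T) = - tr(W W) = - tr(X [H, W]) = 0. *)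
Lemma maximum_commutes H : H \in a -> X *m H = H *m X.
Proof.
move=> aH; pose c k l := wt H k - wt H l.
have cE Y : hadamard P iR c Y = H *m Y - Y *m H.
  apply: (coords_inj PU (i := iR)) => k l; rewrite coords_hadamard //.
  by have := adE HS (vsproj a H) Y k l; rewrite vsprojK // => ->.
have cls p q : same_root iR P a p q -> c p.1 p.2 = c q.1 q.2.
  by move=> /same_rootP; apply.
have mc : multiplier iR P g c.
  apply: (multiplier_ext HS (fun k l => esym (class_sum cls k l))).
  apply: (multiplier_sum HS) => p; apply: (multiplierM HS).
    exact: (multiplier_cst HS).
  exact: (multiplier_class HS).
have tr0 Y : Y \in g -> \tr (X *m hadamard P iR c Y) = 0.
  move=> gY; pose Yp p := hadamard P iR (fun k l => (same_root iR P a p (k, l))%:R) Y.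
  have -> : hadamard P iR c Y = \sum_p (c p.1 p.2 / (#|same_root iR P a p|)%:R) *: Yp p.
    apply: (coords_inj PU (i := iR)) => k l; rewrite coords_hadamard //.
    rewrite coords_sum summxE (class_sum cls) mulr_suml; apply: eq_bigr => p _.
    by rewrite coordsZ [RHS]mxE coords_hadamard // mulrA.
  rewrite mulmx_sumr raddf_sum /= big1 // => p _; rewrite -scalemxAr linearZ /=.
  have [->|cp] := eqVneq (c p.1 p.2) 0; first by rewrite !mul0r.
  have [->|Y0] := eqVneq (Yp p) 0; first by rewrite mulmx0 linear0 mulr0.
  have [wk wkE] := weight_dual iR P a p.1; have [wl wlE] := weight_dual iR P a p.2.
  pose al : dual a := wk - wl.
  have alE H' : (al H' : R) = wt (vsval H') p.1 - wt (vsval H') p.2.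
    by rewrite /al add_lfunE opp_lfunE wkE wlE.
  have Yr : root_space g al (Yp p).
    apply/(root_spaceE HS); split; first exact: (multiplier_class HS).
    move=> k l; rewrite /Yp coords_hadamard //.
    case: (same_rootP iR P a p (k, l)) => [same _|_]; last by rewrite mul0r eqxx.
    by apply/asboolP => H'; rewrite alE (same _ (subvsP H')).
  rewrite (maximum_root _ Yr) ?mulr0 //; split; last by exists (Yp p).
  apply: contra cp => /eqP al0; apply/eqP.
  by have := alE (vsproj a H); rewrite al0 zero_lfunE vsprojK.
pose W := X *m H - H *m X.
have HT := a_tr HS aH.
have WE : W = - hadamard P iR c X by rewrite cE opprB.
have gW : W \in g by rewrite WE memvN mc.
have WT : W^T = - W by rewrite /W linearB /= !trmx_mul XT HT opprB.
have W0 : W = 0.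
  apply: sqr_mxtrace_eq0; rewrite WT mulmxN linearN /=; apply/eqP.
  rewrite oppr_eq0; apply/eqP.
  rewrite -[RHS](tr0 _ gW) cE; rewrite {1}/W; move: (W) => V.
  by rewrite -opprB mulNmx linearN /= mxtrace_bracket -linearN /= -mulmxN opprB.
by apply/eqP; rewrite -subr_eq0 -/W W0.
Qed.

(** Maximality of the torus enters here, through x = exp(tX / 2), for which x x^T = exp(tX) commutes
    with A. *)
Lemma maximum_in_a : X \in a.
Proof.
apply/(a_expmx HS) => t.
have gt s : points iR G (expmx (s *: X)) by move/(Lie_g HS): gX.
have xx : expmx (t / 2 *: X) *m (expmx (t / 2 *: X))^T = expmx (t *: X).
  by rewrite -expmx_tr linearZ /= XT -expmxD -splitr.
rewrite -xx; apply: (gram_in_positive_part PU (G_group HS) (G_det HS) (G_tr HS)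
  (S_max HS) (S_diag HS)) => // b /(positive_part_expmx HS)[H aH ->].
rewrite xx; apply: expmx_commute.
by rewrite -scalemxAr -scalemxAl maximum_commutes.
Qed.

(** Let Z = E - E^T and W = E + E^T for a vector E of the simple root. Since al(H0) = 1, the second
    order condition along Z becomes - al(X) tr(W W) / 2 <= 0. *)
Lemma maximum_dominant (al : dual a) (Y : subvs_of a) : al \in Delta -> vsval Y = X ->
  0 <= (al Y : R).
Proof.
move=> alD YX; have [/(_ _ alD) ral _ _] := Delta_basis; have [al0 [E E0 Er]] := ral.
have [gE EE] := Er; have ET := root_vector_tr Er.
pose Z := E - E^T; pose W := E + E^T.
have gZ : Z \in g by rewrite memvB // (g_tr HS).
have ZT : Z^T = - Z by rewrite /Z linearB /= trmxK opprB.
have WT : W^T = W by rewrite /W linearD /= trmxK addrC.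
have E1 := root_bracket Er; rewrite -/Z -/W in E1.
have [|_ h] := @conjugation_max _ _ X (vsval H0) Z.
  by move=> t; have [GZ ZZ] := expmx_skew t gZ ZT; apply: Xmax.
have aX : X \in a by rewrite -YX subvsP.
have XH : X *m vsval H0 = vsval H0 *m X by apply/maximum_commutes/subvsP.
have H0T := a_tr HS (subvsP H0).
pose H := vsval H0.
have t1 : \tr ((2^-1 *: (Z *m Z) *m X + Z *m X *m Z^T + X *m (2^-1 *: (Z *m Z)^T)) *m H) =
    \tr (Z *m (Z *m X - X *m Z) *m H).
  have ZZ : (Z *m Z)^T = Z *m Z by rewrite trmx_mul ZT mulmxN mulNmx opprK.
  by rewrite ZZ ZT mulmxN; apply: mxtrace_second_order.
have E2 : Z *m X - X *m Z = - ((al Y : R) *: W) by rewrite -E1 YX opprB.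
have t2 : \tr (Z *m W *m H) = 2^-1 * \tr (W *m W).
  have s1 : \tr (Z *m W *m H) = \tr (H *m Z *m W) by rewrite mxtrace_mulC mulmxA.
  have s2 : \tr (Z *m W *m H) = - \tr (Z *m H *m W).
    rewrite -mxtrace_tr !trmx_mul H0T WT ZT !mulmxN linearN /=; congr (- _).
    by rewrite mulmxA mxtrace_mulC mulmxA.
  have := congr1 (fun M => \tr (M *m W)) (E1 H0).
  rewrite /= mulmxBl linearB /= -/H -s1 (_ : \tr (Z *m H *m W) = - \tr (Z *m W *m H)); last by rewrite s2 opprK.
  rewrite H0E // scale1r => e; rewrite -e; lra.
move: h; rewrite -/H t1 E2 mulmxN mulNmx -scalemxAr -scalemxAl linearN linearZ /= t2 oppr_le0.
(* If W were 0, E would be a root vector for both al and - al, hence 0. *)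
have W0 : 0 < \tr (W *m W).
  rewrite -{2}WT lt_def mxtrace_gram_ge0 andbT.
  apply: contra E0 => /eqP/sqr_mxtrace_eq0 W0.
  have EN : E^T = - E by apply/eqP; rewrite -addr_eq0 addrC -/W W0.
  have := ET H0; rewrite EN mulmxN mulNmx scalerN opprK opprK H0E // scale1r addrC.
  rewrite -opprB; have := EE H0; rewrite H0E // scale1r => -> /eqP.
  by rewrite -subr_eq0 -opprD oppr_eq0 -mulr2n -scaler_nat scaler_eq0 pnatr_eq0.
by rewrite /GRing.scale /= mulrA pmulr_lge0 // mulrC pmulr_rge0 // invr_gt0 ltr0n.
Qed.

End Maximum.

Lemma real_cartan h : points iR G h -> exists k1 k2, exists2 Y : subvs_of a,
  [/\ points iR G k1, k1 *m k1^T = 1%:M, points iR G k2 & k2 *m k2^T = 1%:M] &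
  (forall al, al \in Delta -> 0 <= (al Y : R)) /\ h = k1 *m expmx (vsval Y) *m k2.
Proof.
move=> Gh; have [X [gX XT Xh]] := gram_log Gh.
have [k0 [Gk0 kk kmax]] := orthogonal_max X (vsval H0) (geom_points1 (G_group HS) iR).
have k0V : invmx k0 = k0^T.
  by rewrite -[RHS]mul1mx -(mulVmx (geom_points_unit (G_group HS) Gk0)) -mulmxA kk mulmx1.
have kk' : k0^T *m k0 = 1%:M by rewrite -k0V mulVmx // (geom_points_unit (G_group HS) Gk0).
pose X' := k0 *m X *m k0^T.
have gX' : X' \in g by rewrite /X' -k0V (g_conj HS).
have X'T : X'^T = X' by rewrite /X' !trmx_mul trmxK XT mulmxA.
have X'max k : points iR G k -> k *m k^T = 1%:M ->
    \tr (k *m X' *m k^T *m vsval H0) <= \tr (X' *m vsval H0).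
  move=> Gk kkT; have := kmax (k *m k0).
  rewrite trmx_mul /X' !mulmxA; apply; first exact: (geom_points_mul (G_group HS)).
  by rewrite -(mulmxA k) kk mulmx1.
have aX' := maximum_in_a gX' X'T X'max.
pose Y := vsproj a (2^-1 *: X').
have YE : vsval Y = 2^-1 *: X' by rewrite vsprojK // memvZ.
have AY := a_positive_part HS (subvsP Y).
have GY := positive_part_G HS AY.
have YU := geom_points_unit (G_group HS) GY.
pose b := expmx (vsval Y).
have bT : b^T = b by apply: (positive_part_tr HS AY).
have bb : b *m b = expmx X'.
  rewrite /b YE -expmxD (_ : 2^-1 + 2^-1 = 1 :> R) ?scale1r //; by field.
(* As b^2 = k0 h h^T k0^T, the matrix b^-1 k0 h is orthogonal. *)
pose k2 := invmx b *m (k0 *m h).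
have Gk0T := geom_points_tr (G_tr HS) Gk0.
exists k0^T, k2, Y; split.
- exact: Gk0T.
- by rewrite trmxK kk'.
- apply: (geom_points_mul (G_group HS)); first exact: (geom_points_inv (G_group HS)).
  exact: (geom_points_mul (G_group HS)).
- rewrite /k2 !trmx_mul trmx_inv bT !mulmxA -(mulmxA _ h) -Xh.
  rewrite -(mulmxA (invmx b) k0) -(mulmxA (invmx b)) .
  have -> : k0 *m expmx X *m k0^T = b *m b by rewrite bb /X' -k0V expmx_conj // (geom_points_unit (G_group HS) Gk0).
  by rewrite mulmxA mulVmx // mul1mx mulmxV.
- move=> al alD; have -> : Y = 2^-1 *: vsproj a X' by rewrite /Y linearZ.
  rewrite linearZ /=; apply: mulr_ge0; first by rewrite invr_ge0 ler0n.
  by apply: (maximum_dominant gX' X'T X'max alD); rewrite vsprojK.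
by rewrite /k2 -/b !mulmxA mulmxK // kk' mul1mx.
Qed.

End RealCartan.

(** * Block triangular elements *)

Section PolynomialLogarithm.
Variable L : numFieldType.
Implicit Types p q Y T : {poly L}.

Definition exp_poly n Y : {poly L} := \sum_(k < n) (k`!%:R^-1)%:P * Y ^+ k.

Lemma poly_root0 p : p.[0] = 0 -> exists q, p = 'X * q.
Proof.
move=> /eqP/factor_theorem[q ->]; exists q.
by rewrite subr0 mulrC.
Qed.

(** A truncated logarithm of 1 + X by successive approximation: since exp has derivative 1 at 0,
    subtracting c X^(j+1) from Y removes the error term of that degree. Having the logarithm as a
    polynomial in N keeps track of its support. *)
Lemma exp_poly_log n : exists2 Y, Y.[0] = 0 & exists T, exp_poly n Y = 1 + 'X + 'X^n * T.
Proof.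
case: n => [|n].
  by exists 0; [rewrite horner0|exists (-(1 + 'X)); rewrite /exp_poly big_ord0 expr0; ring].
suff key j : (j <= n)%N -> exists2 Y, Y.[0] = 0 &
    exists T, exp_poly n.+1 Y = 1 + 'X + 'X^(j.+1) * T by apply: key.
elim: j => [_|j IHj jn].
  exists 0; first by rewrite horner0.
  exists (-1); rewrite /exp_poly big_ord_recl expr0 fact0 invr1 mulr1 big1 ?addr0.
    by rewrite expr1; ring.
  by move=> k _; rewrite expr0n /= mulr0.
have [Y Y0 [T YT]] := IHj (ltnW jn); pose c := T.[0].
pose Y' := Y - c%:P * 'X^(j.+1).
have Y'0 : Y'.[0] = 0 by rewrite /Y' !hornerE Y0 expr0n /= mulr0 subr0.
(* The difference quotient of the truncated exponential between Y and Y'. Both vanish at 0, so its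
   constant term is that of the linear part, namely 1. *)
pose D : {poly L} := \sum_(k < n.+1) (k`!%:R^-1)%:P * \sum_(l < k) Y' ^+ (k.-1 - l) * Y ^+ l.
have YD : exp_poly n.+1 Y' = exp_poly n.+1 Y - c%:P * 'X^(j.+1) * D.
  have -> : c%:P * 'X^(j.+1) = Y - Y' by rewrite /Y'; ring.
  rewrite /exp_poly /D mulr_sumr -sumrB; apply: eq_bigr => k _.
  rewrite -[Y' ^+ k](subrK (Y ^+ k)) subrXX.
  set s := \sum_(_ < k) _; ring.
have D0 : D.[0] = 1.
  have dk k : ((k`!%:R^-1)%:P * \sum_(l < k) Y' ^+ (k.-1 - l) * Y ^+ l).[0] = (k == 1)%:R.
    case: k => [|[|k]]; first by rewrite big_ord0 mulr0 horner0.
      by rewrite big_ord1 !expr0 !mulr1 hornerC invr1.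
    rewrite hornerM horner_sum big1 ?mulr0 // => l _.
    rewrite hornerM !horner_exp Y0 Y'0 -exprD subnK ?expr0n //.
    by have := ltn_ord l; rewrite ltnS.
  rewrite /D horner_sum; under eq_bigr do rewrite dk.
  have n1 : (1 < n.+1)%N by rewrite ltnS (leq_ltn_trans _ jn).
  rewrite (bigD1 (Ordinal n1)) //= big1 ?addr0 // => k k1.
  by rewrite -[X in (X == _)%N]/(val k) -[X in (_ == X)%N]/(val (Ordinal n1)) val_eqE (negbTE k1).
have /poly_root0[T' TT'] : (T - c%:P * D).[0] = 0 by rewrite !hornerE D0 mulr1 subrr.
exists Y' => //; exists T'; rewrite YD YT [in RHS]exprSr -[in RHS]mulrA -TT'; ring.
Qed.

Lemma expmx_nilpotent_surj (n : nat) (N : 'M[L]_n.+1) : N ^+ n.+1 = 0 ->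
  exists q, \sum_(k < n.+1) (k`!%:R)^-1 *: (N *m horner_mx N q) ^+ k = 1%:M + N.
Proof.
move=> Nn; have [Y /poly_root0[q Yq] [T YT]] := exp_poly_log n.+1; exists q.
have NY : N *m horner_mx N q = horner_mx N Y by rewrite Yq rmorphM /= horner_mx_X mulmxE.
have := congr1 (horner_mx N) YT.
rewrite !(rmorphD, rmorphM) /= rmorph1 rmorphXn /= horner_mx_X Nn mul0r addr0 => <-.
rewrite /exp_poly rmorph_sum; apply: eq_bigr => k _.
by rewrite rmorphM /= horner_mx_C rmorphXn /= -NY -mulmxE mul_scalar_mx.
Qed.

End PolynomialLogarithm.

Lemma poly_natural_roots (L : numDomainType) (q : {poly L}) :
  (forall m : nat, q.[m%:R] = 0) -> q = 0.
Proof.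
move=> q0; apply/eqP/negPn/negP => qn0.
have := @max_poly_roots _ q [seq m%:R | m <- iota 0 (size q)] qn0.
rewrite size_map size_iota ltnn => h; suff : false by [].
apply: h; first by apply/allP => _ /mapP[m _ ->]; rewrite /root q0.
by rewrite map_inj_uniq ?iota_uniq // => m m' /eqP; rewrite eqr_nat => /eqP.
Qed.

Section CoordsIn.
Variables (K : rcfType) (n : nat) (P : 'M[K]_n).
Hypothesis PU : P \in unitmx.
Variables (L : fieldType) (i : {rmorphism K -> L}).
Implicit Types (c d e : rel 'I_n) (X Y : 'M[L]_n).

Lemma coords_in_sub c d X : subrel c d -> coords_in P c i X -> coords_in P d i X.
Proof. by move=> cd Xc k l /Xc/cd. Qed.

Lemma coords_inM c d e X Y : (forall k l m, c k l -> d l m -> e k m) ->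
  coords_in P c i X -> coords_in P d i Y -> coords_in P e i (X *m Y).
Proof.
move=> cde Xc Yd k m; rewrite coordsM // mxE => XY.
have [[l]|none] := pselect (exists l, coords P i X k l * coords P i Y l m != 0).
  by rewrite mulf_eq0 negb_or => /andP[/Xc h1 /Yd]; apply: cde.
move: XY; rewrite big1 ?eqxx // => l _; apply/eqP/negPn/negP => h.
by apply: none; exists l.
Qed.

Lemma coords_inD c X Y : coords_in P c i X -> coords_in P c i Y -> coords_in P c i (X + Y).
Proof.
move=> Xc Yc k l; rewrite coordsD [X in X != _]mxE.
by have [->|/Xc//] := eqVneq (coords P i X k l) 0; rewrite add0r => /Yc.
Qed.

Lemma coords_inZ c b X : coords_in P c i X -> coords_in P c i (b *: X).
Proof.
by move=> Xc k l; rewrite coordsZ [X in X != _]mxE mulf_eq0 negb_or => /andP[_ /Xc].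
Qed.

Lemma coords_in1 c : reflexive c -> coords_in P c i 1%:M.
Proof.
move=> cr k l; rewrite coords1 // mxE; have [->|] := eqVneq k l; first by [].
by rewrite eqxx.
Qed.

Lemma coords_in_sum c (I : Type) (r : seq I) (X : I -> 'M[L]_n) :
  (forall j, coords_in P c i (X j)) -> coords_in P c i (\sum_(j <- r) X j).
Proof.
move=> Xc; elim/big_rec: _ => [k l|j Y _ Yc]; last exact: coords_inD.
by rewrite coords0 [X in X != _]mxE eqxx.
Qed.

Lemma coords_inX c X m : reflexive c -> transitive c -> coords_in P c i X ->
  coords_in P c i (X ^+ m).
Proof.
move=> cr ct Xc; elim: m => [|m IHm]; first by rewrite expr0; exact: coords_in1.
by rewrite exprS -mulmxE; apply: coords_inM Xc IHm => k l k'; apply: ct.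
Qed.

Lemma coords_in_horner c q X : reflexive c -> transitive c -> coords_in P c i X ->
  coords_in P c i (\sum_(k < size q) q`_k *: X ^+ k).
Proof.
by move=> cr ct Xc; apply: coords_in_sum => k; apply/coords_inZ/coords_inX.
Qed.

End CoordsIn.

Lemma unipotent_log (L : rcfType) n (N : 'M[L]_n) : N ^+ n = 0 ->
  exists q : {poly L}, expmx_nilpotent (N *m \sum_(k < size q) q`_k *: N ^+ k) = 1%:M + N.
Proof.
case: n N => [|n] N Nn; first by exists 0; apply/matrixP => -[].
have [q qE] := expmx_nilpotent_surj Nn; exists q; rewrite -qE /expmx_nilpotent.
have -> : horner_mx N q = \sum_(k < size q) q`_k *: N ^+ k.
  rewrite -{1}(coefK q) poly_def rmorph_sum; apply: eq_bigr => k _.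
  by rewrite -mul_polyC rmorphM rmorphXn /= horner_mx_C horner_mx_X -mulmxE mul_scalar_mx.
by [].
Qed.

Section RealParabolic.
Variables (K : rcfType) (R : realType) (iR : {rmorphism K -> R}) (n : nat).
Variables (P : 'M[K]_n) (G S : set (mxpoly K n)) (g a : {vspace 'M[R]_n}).
Hypothesis HS : torus_setting iR P G S g a.
Variable H0 : subvs_of a.
Notation wt := (weight P iR).
Let PU : P \in unitmx := basis_unit HS.
Notation higher := (height_rel iR P H0).

Definition weight_rel : rel 'I_n := fun k l =>
  `[< forall H : subvs_of a, wt (vsval H) k = wt (vsval H) l >].

Lemma weight_relP k l : reflect (forall H : subvs_of a, wt (vsval H) k = wt (vsval H) l)
  (weight_rel k l).
Proof. exact: asboolP. Qed.

Lemma commutant_coords_in X : coords_in P weight_rel iR X <->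
  forall b, positive_part P S iR b -> X *m b = b *m X.
Proof.
split=> [Xc b /(positive_part_expmx HS)[H aH ->]|Xc k l kl].
  apply: (coords_inj PU (i := iR)) => k l.
  have [Sb _] := a_positive_part HS aH; have bd := torus_diag HS Sb.
  rewrite (coords_diag_mulr PU _ _ _ bd) (coords_diag_mull PU _ _ _ bd).
  have [->|/Xc/weight_relP kl] := eqVneq (coords P iR X k l) 0; first by rewrite mul0r mulr0.
  by rewrite mulrC !(a_weight_expmx HS) // -(vsprojK aH) kl.
apply/weight_relP => H; have Ab := a_positive_part HS (subvsP H).
have := Xc _ Ab => /(congr1 (fun M => coords P iR M k l)) /=.
have [Sb _] := Ab; have bd := torus_diag HS Sb.
rewrite (coords_diag_mulr PU _ _ _ bd) (coords_diag_mull PU _ _ _ bd) mulrC => /(mulIf kl).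
by rewrite !(a_weight_expmx HS) ?subvsP // => /expR_inj/esym.
Qed.

Lemma height_nilpotent X : coords_in P higher iR X -> X ^+ n = 0.
Proof.
move=> Xc; apply: (@coords_nilpotent _ _ _ PU _ iR X (fun k => wt (vsval H0) k) (fun x y => x < y)).
- by move=> y x z; apply: lt_trans.
- by move=> x; rewrite ltxx.
exact: Xc.
Qed.

(** For the logarithm X of u, an equation of G at exp(tX) is a polynomial in t, which vanishes at
    every natural m because exp(mX) = u^m. *)
Lemma unipotent_Lie u : points iR G u -> coords_in P higher iR (u - 1%:M) ->
  exists2 X, nilpotent_part P G higher iR X & u = expmx_nilpotent X.
Proof.
set N := u - 1%:M => Gu Nc; have Nn := height_nilpotent Nc.
have [q qE] := unipotent_log Nn; set Y := \sum_(k < size q) _ in qE.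
have Xc : coords_in P higher iR (N *m Y).
  pose le_rel : rel 'I_n := fun k l => wt (vsval H0) l <= wt (vsval H0) k.
  apply: (coords_inM PU (c := higher) (d := le_rel)) (Nc) _.
    by move=> k l m kl lm; apply: le_lt_trans lm kl.
  apply: (coords_in_horner PU) => [k|l k m kl lm|]; first exact: lexx.
    exact: le_trans lm kl.
  by apply: coords_in_sub Nc => k l; apply: ltW.
have uE : u = expmx_nilpotent (N *m Y) by rewrite qE addrC subrK.
exists (N *m Y) => //; split=> // t p Gp; set X := N *m Y in Xc uE *.
have Xn t' : expmx_nilpotent (t' *: X) = expmx (t' *: X).
  apply/esym/expmx_nilpotentE/height_nilpotent.
  exact: coords_inZ.
have [r rE] : exists r : {poly R}, forall t, r.[t] = mxeval iR p (expmx_nilpotent (t *: X)).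
  apply: (@mxeval_ind K n R iR R (fun t => expmx_nilpotent (t *: X))
    (fun f => exists r : {poly R}, forall t, r.[t] = f t)).
  - by move=> c; exists (iR c)%:P => t'; rewrite hornerC.
  - move=> k l; exists (\sum_(m < n) ((m`!%:R)^-1 * (X ^+ m) k l) *: 'X^m) => t'.
    rewrite -[expmx_nilpotent _]/(expmx_part n _) expmx_partZ.
    rewrite horner_sum summxE; apply: eq_bigr => m _.
    by rewrite hornerZ hornerXn [RHS]mxE mulrAC (mulrC (t' ^+ m)).
  - by move=> f f' [r rE] [r' r'E]; exists (r + r') => t'; rewrite hornerD rE r'E.
  - by move=> f f' [r rE] [r' r'E]; exists (r * r') => t'; rewrite hornerM rE r'E.
rewrite -rE (_ : r = 0) ?horner0 //; apply: poly_natural_roots => m.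
rewrite rE Xn expmx_natmul -[X]scale1r -Xn scale1r -uE.
suff : points iR G (u ^+ m) by apply.
elim: m => [|m IHm]; first exact: (geom_points1 (G_group HS)).
by rewrite exprS; apply: (geom_points_mul (G_group HS)).
Qed.

Definition parabolic_rel : rel 'I_n := fun k l => higher k l || weight_rel k l.

Lemma weight_part_limit h : points iR G h -> coords_in P parabolic_rel iR h ->
  points iR G (hadamard P iR (fun k l => (weight_rel k l)%:R) h).
Proof.
move=> Gh hc; set l0 := hadamard _ _ _ _.
pose b m := expmx (- (m%:R : R) *: vsval H0); pose b' m := expmx ((m%:R : R) *: vsval H0).
have Ab c : positive_part P S iR (expmx (c *: vsval H0)).
  by apply: (a_positive_part HS); rewrite memvZ // subvsP.
pose u m := b m *m h *m b' m.
have Gu m : points iR G (u m).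
  apply: (geom_points_mul (G_group HS)); last exact/(positive_part_G HS)/Ab.
  by apply: (geom_points_mul (G_group HS)) => //; apply/(positive_part_G HS)/Ab.
apply: (points_closed (u := u) _ Gu).
have cu : mxcvg (fun m => coords P iR (u m)) (coords P iR l0).
  move=> k l; rewrite /l0 coords_hadamard //.
  pose c := wt (vsval H0) k - wt (vsval H0) l.
  have E m : coords P iR (u m) k l = expR (- c) ^+ m * coords P iR h k l.
    have [S1 _] := Ab (- (m%:R : R)); have [S2 _] := Ab (m%:R : R).
    rewrite /u (coords_diag_mulr PU _ _ _ (torus_diag HS S2)).
    rewrite (coords_diag_mull PU _ _ _ (torus_diag HS S1)).
    rewrite !(a_weight_expmx HS) ?memvZ ?subvsP // !weight_scale.
    rewrite mulrAC -expRD -expRM_natl; congr (expR _ * _); rewrite /c; ring.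
  rewrite (_ : (fun m => _) = (fun m => expR (- c) ^+ m * coords P iR h k l)); last first.
    exact/funext.
  have [h0|hkl] := eqVneq (coords P iR h k l) 0.
    by rewrite h0 mulr0; under eq_fun do rewrite mulr0; apply: cvg_cst.
  have [/weight_relP kl|nkl] := boolP (weight_rel k l).
    have c0 : c = 0 by rewrite /c kl subrr.
    rewrite c0 oppr0 expR0 mul1r; under eq_fun do rewrite expr1n mul1r.
    exact: cvg_cst.
  have c0 : 0 < c.
    by have := hc _ _ hkl; rewrite /parabolic_rel (negbTE nkl) orbF /c subr_gt0.
  apply: cvgMr_tmp; apply: cvg_expr.
  by rewrite ger0_norm ?expR_ge0 // expR_lt1 oppr_lt0.
have cv : mxcvg (fun m => of_coords P iR (coords P iR (u m)))
    (of_coords P iR (coords P iR l0)).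
  by apply: mxcvg_mul; [apply: mxcvg_mul; [exact: mxcvg_cst|exact: cu]|exact: mxcvg_cst].
by rewrite coordsK // in cv; apply: (mxcvg_ext cv) => m; rewrite coordsK.
Qed.

Lemma real_parabolic h : points iR G h -> coords_in P parabolic_rel iR h ->
  exists X b m, [/\ nilpotent_part P G higher iR X, positive_part P S iR b,
    points iR G m /\ m *m m^T = 1%:M,
    forall b', positive_part P S iR b' -> m *m b' = b' *m m
    & h = expmx_nilpotent X *m b *m m].
Proof.
move=> Gh hc; have := weight_part_limit Gh hc.
have [l0 l0E] : exists l0, l0 = hadamard P iR (fun k l => (weight_rel k l)%:R) h by eexists.
rewrite -l0E => Gl.
have lc : coords_in P weight_rel iR l0.
  by move=> k l; rewrite l0E coords_hadamard //; case: (weight_rel k l); rewrite ?mulr0n ?mul0r ?eqxx.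
have lU := geom_points_unit (G_group HS) Gl.
have lA := (commutant_coords_in l0).1 lc.
have lVA b : positive_part P S iR b -> invmx l0 *m b = b *m invmx l0.
  move=> Ab; apply: (can_inj (mulKmx lU)); rewrite mulmxA mulmxV // mul1mx.
  by rewrite mulmxA lA // mulmxK.
have lVc := (commutant_coords_in (invmx l0)).2 lVA.
pose u := h *m invmx l0.
have Gu : points iR G u.
  by apply: (geom_points_mul (G_group HS)) => //; apply: (geom_points_inv (G_group HS)).
have [X NX uE] : exists2 X, nilpotent_part P G higher iR X & u = expmx_nilpotent X.
  (* Removing the block diagonal part [l0] from h leaves entries in [higher] only, and the block
     diagonal [invmx l0] preserves this support. *)
  apply: unipotent_Lie => //; have -> : u - 1%:M = (h - l0) *m invmx l0.
    by rewrite mulmxBl mulmxV.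
  apply: (coords_inM PU (c := higher) (d := weight_rel)) lVc.
    by move=> k l m kl /weight_relP lm; rewrite /height_rel -lm.
  move=> k l; rewrite coordsD coordsN [X in X != _]mxE [X in _ + X]mxE l0E coords_hadamard //.
  have [kl|nkl] := boolP (weight_rel k l); first by rewrite mul1r subrr eqxx.
  by rewrite mulr0n mul0r subr0 => /hc; rewrite /parabolic_rel (negbTE nkl) orbF.
have lT b : positive_part P S iR b -> l0^T *m b = b *m l0^T.
  move=> Ab; have bT := positive_part_tr HS Ab.
  by rewrite -{1}bT -{2}bT -!trmx_mul lA.
have Aq : positive_part P S iR (l0 *m l0^T).
  apply: (gram_in_positive_part PU (G_group HS) (G_det HS) (G_tr HS) (S_max HS) (S_diag HS)) => //.
  by move=> b Ab; rewrite mulmxA -lA // -!mulmxA lT.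
have [H aH qE] := positive_part_expmx HS Aq.
pose b := expmx (2^-1 *: H).
have Ab : positive_part P S iR b by apply: (a_positive_part HS); rewrite memvZ.
have bb : b *m b = l0 *m l0^T.
  rewrite qE /b -expmxD (_ : 2^-1 + 2^-1 = 1 :> R) ?scale1r //; by field.
have Gb := positive_part_G HS Ab.
have bU := geom_points_unit (G_group HS) Gb.
have bT := positive_part_tr HS Ab.
have bC b' : positive_part P S iR b' -> invmx b *m b' = b' *m invmx b.
  move=> Ab'; apply: (can_inj (mulKmx bU)); rewrite mulmxA mulmxV // mul1mx.
  have [Sb _] := Ab; have [Sb' _] := Ab'.
  by rewrite mulmxA (positive_part_comm PU (torus_diag HS) Sb Sb') mulmxK.
exists X, b, (invmx b *m l0); split=> //.
- split; first by apply: (geom_points_mul (G_group HS)) => //; apply: (geom_points_inv (G_group HS)).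
  rewrite trmx_mul trmx_inv bT !mulmxA -(mulmxA _ l0) -bb.
  by rewrite !mulmxA mulVmx // mul1mx mulmxV.
- by move=> b' Ab'; rewrite -mulmxA lA // !mulmxA bC.
by rewrite -uE /u -!mulmxA (mulmxA b) mulmxV // mul1mx mulVmx // mulmx1.
Qed.

End RealParabolic.

(** * Transfer to all real closed extensions *)

Ltac elem_user ::= first
  [ apply: elementary_nilpotent_part | apply: elementary_coords_in
  | apply: elementary_positive_part
  | apply: mxterm_hadamard | apply: mxterm_expmx_nilpotent
  | apply: elementary_all_seq => ? ? ].

Section Transfer.
Variables (K : rcfType) (R : realType) (iR : {rmorphism K -> R}) (n : nat).
Variables (P : 'M[K]_n) (G S : set (mxpoly K n)) (g a : {vspace 'M[R]_n}).
Hypothesis HS : torus_setting iR P G S g a.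
Variable Delta : seq (dual a).
Hypothesis Delta_basis : root_basis g Delta.
Variable H0 : subvs_of a.
Hypothesis H0E : forall al, al \in Delta -> al H0 = 1.
Variable chi : dual a -> mxpoly K n.
Hypothesis chi_roots : root_characters iR S g chi.
Let PU : P \in unitmx := basis_unit HS.
Let Sgrp : mx_group (geom_points S). Proof. by case: (S_max HS) => -[]. Qed.
Notation higher := (height_rel iR P H0).
Notation parabolic := (parabolic_rel iR P H0).
Notation root_rel := (root_rel iR P).
Notation Apart := (positive_part P S).

Lemma positive_part_exp b : Apart iR b -> exists H : subvs_of a, b = expmx (vsval H).
Proof.
by move=> /(positive_part_expmx HS)[X aX ->]; exists (vsproj a X); rewrite vsprojK.
Qed.

Lemma positive_part_of_exp (H : subvs_of a) : Apart iR (expmx (vsval H)).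
Proof. exact: (a_positive_part HS (subvsP H)). Qed.

Lemma chi_exp al (H : subvs_of a) : Defs.roots g al ->
  mxeval iR (chi al) (expmx (vsval H)) = expR (al H : R).
Proof. by move=> /chi_roots[_]; apply. Qed.

Lemma chiM al : Defs.roots g al -> forall (L : rcfType) (i : {rmorphism K -> L}) x y,
  points i S x -> points i S y ->
  mxeval i (chi al) (x *m y) = mxeval i (chi al) x * mxeval i (chi al) y.
Proof.
move=> /chi_roots[[_ chM] _] L i; apply: (@elementary_transfer K (fun L i => forall x y : 'M[L]_n,
  points i S x -> points i S y ->
  mxeval i (chi al) (x *m y) = mxeval i (chi al) x * mxeval i (chi al) y) _ K idfun).
  by elem.
move=> x y Sx Sy; have e z : mxeval (real_complex K) (chi al) (map_mx (real_complex K) z) =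
    real_complex K (mxeval idfun (chi al) z) by apply: mxeval_map.
apply: (fmorph_inj (real_complex K)); rewrite rmorphM.
transitivity (mxeval (real_complex K) (chi al) (map_mx (real_complex K) (x *m y))).
  exact/esym/e.
rewrite map_mxM chM; [|exact/geom_points_real|exact/geom_points_real].
by congr (_ * _); apply: e.
Qed.

Lemma chi1 al : Defs.roots g al -> forall (L : rcfType) (i : {rmorphism K -> L}),
  mxeval i (chi al) 1%:M = 1.
Proof.
move=> /chi_roots[[ch1 _] _] L i.
apply: (@elementary_transfer K (fun L i => mxeval i (chi al) (1%:M : 'M[L]_n) = 1) _ K idfun).
  by elem.
apply: (fmorph_inj (real_complex K)); rewrite rmorph1 -[RHS]ch1.
by rewrite -(map_mx1 (real_complex K)); apply/esym/mxeval_map.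
Qed.

Lemma chi_gt0 al : Defs.roots g al -> forall (L : rcfType) (i : {rmorphism K -> L}) b,
  Apart i b -> 0 < mxeval i (chi al) b.
Proof.
move=> ral L i; apply: (@elementary_transfer K (fun L i => forall b : 'M[L]_n,
  Apart i b -> 0 < mxeval i (chi al) b) _ R iR); first by elem.
by move=> b /positive_part_exp[H ->]; rewrite chi_exp // expR_gt0.
Qed.

Lemma chiV al : Defs.roots g al -> forall (L : rcfType) (i : {rmorphism K -> L}) b,
  Apart i b -> mxeval i (chi al) (invmx b) = (mxeval i (chi al) b)^-1.
Proof.
move=> ral L i b Ab; have chb := chi_gt0 ral Ab.
have [Sb _] := Ab; have [SVb _] := positive_partV PU Sgrp (torus_diag HS) Ab.
apply: (mulfI (lt0r_neq0 chb)); rewrite -chiM // mulfV ?lt0r_neq0 // mulmxV ?chi1 //.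
exact: (geom_points_unit (G_group HS) (positive_part_G HS Ab)).
Qed.

Lemma chi_weight al k l : Defs.roots g al -> root_rel al k l ->
  forall (L : rcfType) (i : {rmorphism K -> L}) b, Apart i b ->
  weight P i b k = mxeval i (chi al) b * weight P i b l.
Proof.
move=> ral /asboolP kl L i; apply: (@elementary_transfer K (fun L i => forall b : 'M[L]_n,
  Apart i b -> weight P i b k = mxeval i (chi al) b * weight P i b l) _ R iR).
  by rewrite /weight; elem.
move=> b /positive_part_exp[H ->]; rewrite chi_exp // !(a_weight_expmx HS) ?subvsP //.
by rewrite -expRD -kl subrK.
Qed.

Lemma chi_dominant al : pos_roots g Delta al ->
  forall (L : rcfType) (i : {rmorphism K -> L}) b, Apart i b ->
  (forall be, be \in Delta -> 1 <= mxeval i (chi be) b) -> 1 <= mxeval i (chi al) b.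
Proof.
move=> [ral [c alE]] L i; apply: (@elementary_transfer K (fun L i => forall b : 'M[L]_n,
  Apart i b -> (forall be, be \in Delta -> 1 <= mxeval i (chi be) b) ->
  1 <= mxeval i (chi al) b) _ R iR); first by elem.
have [rD _ _] := Delta_basis.
move=> b /positive_part_exp[H ->] hD; rewrite chi_exp // -expR0 ler_expR alE sum_lfunE big_seq.
apply: sumr_ge0 => be bD; have := hD _ bD; rewrite chi_exp; last exact: rD.
rewrite -expR0 ler_expR => h; elim: (c be) => [|m IHm]; first by rewrite mulr0n zero_lfunE.
by rewrite mulrS add_lfunE addr_ge0.
Qed.

(** A weight is a combination of simple roots with real coefficients x_j, which has no meaning as a
    monomial over L. An integer N at least the sum of the |x_j| gives a bound that is first order,
    with N independent of L. *)
Lemma chi_weight_bound k : exists N, forall (L : rcfType) (i : {rmorphism K -> L}) b c,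
  Apart i b -> 1 <= c -> (forall be, be \in Delta ->
    mxeval i (chi be) b <= c /\ 1 <= c * mxeval i (chi be) b) ->
  weight P i b k <= c ^+ N.
Proof.
have [rD /andP[/eqP span_D free_D] _] := Delta_basis.
have [w wE] := weight_dual iR P a k.
have : w \in <<Delta>>%VS by rewrite span_D memvf.
move/(coord_span (X := in_tuple Delta)) => wD.
pose x j := coord (in_tuple Delta) j w.
pose N := Num.bound (\sum_j `|x j : R|); exists N => L i.
apply: (@elementary_transfer K (fun L i => forall (b : 'M[L]_n) c,
  Apart i b -> 1 <= c -> (forall be, be \in Delta ->
    mxeval i (chi be) b <= c /\ 1 <= c * mxeval i (chi be) b) ->
  weight P i b k <= c ^+ N) _ R iR); first by rewrite /weight; elem.
move=> b c /positive_part_exp[H ->] c1 hD.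
have c0 : 0 < c by apply: lt_le_trans c1.
have lc0 : 0 <= ln c by rewrite ln_ge0.
rewrite (a_weight_expmx HS) ?subvsP // -wE -[c]lnK ?posrE // -expRM_natl ler_expR.
have NX : \sum_j `|x j : R| <= N%:R by apply/ltW/archi_boundP/sumr_ge0.
apply: (@le_trans _ _ ((\sum_j `|x j : R|) * ln c)); last by rewrite ler_wpM2r.
rewrite wD sum_lfunE mulr_suml ler_sum // => j _; rewrite scale_lfunE -/(x j).
apply: (le_trans (ler_norm _)); rewrite normrM ler_wpM2l //.
have jD : (in_tuple Delta)`_j \in Delta by apply: mem_nth.
have [] := hD _ jD; rewrite chi_exp; last exact: rD.
move=> h1 h2; rewrite ler_norml -[X in _ && X]ler_expR lnK ?posrE // h1 andbT.
by rewrite -ler_expR expRN lnK ?posrE // -[X in X <= _]mulr1 ler_pdivrMl.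
Qed.

(** The difference d = w_l - w_k is nonnegative at H0 and not identically zero. It is then positive
    somewhere in the closed chamber, and unbounded along the corresponding ray. *)
Lemma chamber_unbounded k l : ~~ parabolic k l ->
  forall (L : rcfType) (i : {rmorphism K -> L}) (T : L), exists b, [/\ Apart i b,
    forall be, be \in Delta -> 1 <= mxeval i (chi be) b
    & T * weight P i b k <= weight P i b l].
Proof.
rewrite /parabolic_rel negb_or => /andP[nh nw] L i.
(* Nested binary conjunctions are the form that [elem] decomposes. *)
suff : forall T : L, exists b : 'M[L]_n, Apart i b /\
    ((forall be, be \in Delta -> 1 <= mxeval i (chi be) b) /\
    T * weight P i b k <= weight P i b l).
  by move=> h T; have [b [Ab [b1 b2]]] := h T; exists b.
apply: (@elementary_transfer K (fun L i => forall T : L, exists b : 'M[L]_n, Apart i b /\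
    ((forall be, be \in Delta -> 1 <= mxeval i (chi be) b) /\
    T * weight P i b k <= weight P i b l)) _ R iR); first by rewrite /weight; elem.
have [rD _ _] := Delta_basis.
pose d (H : subvs_of a) := weight P iR (vsval H) l - weight P iR (vsval H) k.
have [H [HD dH]] : exists H : subvs_of a, (forall be, be \in Delta -> 0 <= (be H : R)) /\ 0 < d H.
  have [lt0|le0] := ltP 0 (d H0).
    by exists H0; split=> // be bD; rewrite H0E.
  have d0 : d H0 = 0.
    apply/eqP; rewrite eq_le le0 /d subr_ge0 leNgt.
    by move: nh; rewrite /height_rel.
  have [H1 dH1] : exists H1, 0 < d H1.
    apply: contrapT => no; move/negP: nw; apply; apply/weight_relP => H.
    have dle H' : d H' <= 0 by rewrite leNgt; apply/negP => h; apply: no; exists H'.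
    have dN : d (- H) = - d H by rewrite /d linearN /= /weight mulmxN mulNmx !mxE; ring.
    have := dle H; have := dle (- H); rewrite dN /d; lra.
  (* In this case d vanishes at H0, so adding a multiple of H0 that makes H1 dominant leaves d(H1)
     unchanged. *)
  exists (H1 + (\sum_(be <- Delta) `|be H1 : R|) *: H0); split.
    move=> be bD; rewrite linearD linearZ /= H0E // /GRing.scale /= mulr1.
    rewrite -lerBlDl sub0r; apply: (le_trans (ler_norm _)); rewrite normrN.
    rewrite (big_rem be) //= lerDl; apply: sumr_ge0 => ? _; exact: normr_ge0.
  rewrite /d linearD linearZ /= !weight_add !weight_scale.
  have : d H1 + (\sum_(be <- Delta) `|be H1 : R|) * d H0 > 0 by rewrite d0 mulr0 addr0.
  by rewrite /d; congr (0 < _); ring.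
(* At this point d is |T|, and exp |T| >= 1 + |T| >= T. *)
move=> T; exists (expmx (vsval ((`|T| / d H) *: H))); split; first exact: positive_part_of_exp.
have s0 : 0 <= `|T| / d H by rewrite divr_ge0 // ltW.
split.
  move=> be bD; rewrite chi_exp; last exact: rD.
  by rewrite -expR0 ler_expR linearZ /=; apply: mulr_ge0 => //; apply: HD.
rewrite !(a_weight_expmx HS) ?subvsP // !linearZ /= !weight_scale.
have -> : `|T| / d H * weight P iR (vsval H) l = `|T| + `|T| / d H * weight P iR (vsval H) k.
  have dE : weight P iR (vsval H) l = d H + weight P iR (vsval H) k by rewrite subrK.
  by rewrite dE mulrDr mulfVK // lt0r_neq0.
rewrite expRD ler_wpM2r ?expR_ge0 //; apply: (le_trans (ler_norm _)).
by apply: le_trans (expR_ge1Dx _); rewrite lerDr.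
Qed.

Lemma cartan_decomposition (L : rcfType) (i : {rmorphism K -> L}) h : points i G h ->
  exists k1 b k2, [/\ points i G k1 /\ k1 *m k1^T = 1%:M,
    points i G k2 /\ k2 *m k2^T = 1%:M, Apart i b,
    forall be, be \in Delta -> 1 <= mxeval i (chi be) b & h = k1 *m b *m k2].
Proof.
suff : forall h : 'M[L]_n, points i G h -> exists k1 b k2 : 'M[L]_n,
    (points i G k1 /\ k1 *m k1^T = 1%:M) /\ ((points i G k2 /\ k2 *m k2^T = 1%:M) /\
    (Apart i b /\ ((forall be, be \in Delta -> 1 <= mxeval i (chi be) b) /\
     h = k1 *m b *m k2))).
  by move=> H /H[k1 [b [k2 [? [? [? [? ?]]]]]]]; exists k1, b, k2.
apply: (@elementary_transfer K (fun L i => forall h : 'M[L]_n, points i G h ->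
    exists k1 b k2 : 'M[L]_n,
    (points i G k1 /\ k1 *m k1^T = 1%:M) /\ ((points i G k2 /\ k2 *m k2^T = 1%:M) /\
    (Apart i b /\ ((forall be, be \in Delta -> 1 <= mxeval i (chi be) b) /\
     h = k1 *m b *m k2)))) _ R iR); first by elem.
have [rD _ _] := Delta_basis.
move=> {}h /(real_cartan HS Delta_basis H0E)[k1 [k2 [Y [Gk1 k1k1 Gk2 k2k2] [YD hE]]]].
exists k1, (expmx (vsval Y)), k2; do !split => //; try exact: (positive_part_of_exp Y).1.
  by case: (positive_part_of_exp Y).
by move=> be bD; rewrite chi_exp -?expR0 ?ler_expR; [exact: YD|exact: rD].
Qed.

Lemma parabolic_decomposition (L : rcfType) (i : {rmorphism K -> L}) h : points i G h ->
  coords_in P parabolic i h -> exists X b m, [/\ nilpotent_part P G higher i X,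
    Apart i b, points i G m /\ m *m m^T = 1%:M,
    forall b', Apart i b' -> m *m b' = b' *m m & h = expmx_nilpotent X *m b *m m].
Proof.
suff : forall h : 'M[L]_n, points i G h -> coords_in P parabolic i h ->
    exists X b m : 'M[L]_n, nilpotent_part P G higher i X /\ (Apart i b /\
    ((points i G m /\ m *m m^T = 1%:M) /\
    ((forall b', Apart i b' -> m *m b' = b' *m m) /\ h = expmx_nilpotent X *m b *m m))).
  by move=> H /H{}H /H[X [b [m [? [? [? [? ?]]]]]]]; exists X, b, m.
apply: (@elementary_transfer K (fun L i => forall h : 'M[L]_n, points i G h ->
    coords_in P parabolic i h ->
    exists X b m : 'M[L]_n, nilpotent_part P G higher i X /\ (Apart i b /\
    ((points i G m /\ m *m m^T = 1%:M) /\
    ((forall b', Apart i b' -> m *m b' = b' *m m) /\ h = expmx_nilpotent X *m b *m m)))) _ R iR).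
  by elem.
by move=> {}h Gh /(real_parabolic HS Gh)[X [b [m [? ? ? ? ?]]]]; exists X, b, m.
Qed.

End Transfer.

(** * Integral points and the building *)

Section ConvexSubring.
Variables (F : rcfType) (O : {pred F}).
Hypothesis O_subring : GRing.subring_closed O.
Hypothesis O_convex : order_convex O.

Lemma O1 : 1 \in O. Proof. by case: O_subring. Qed.

Lemma OB x y : x \in O -> y \in O -> x - y \in O.
Proof. by case: O_subring => _ OB _; apply: OB. Qed.

Lemma O0 : 0 \in O. Proof. by rewrite -(subrr 1) OB // O1. Qed.

Lemma ON x : x \in O -> - x \in O.
Proof. by move=> Ox; rewrite -sub0r OB // O0. Qed.

Lemma OD x y : x \in O -> y \in O -> x + y \in O.
Proof. by move=> Ox Oy; rewrite -[y]opprK OB // ON. Qed.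

Lemma OM x y : x \in O -> y \in O -> x * y \in O.
Proof. by case: O_subring => _ _; apply. Qed.

Lemma OX x m : x \in O -> x ^+ m \in O.
Proof. by move=> Ox; elim: m => [|m IHm]; rewrite ?expr0 ?O1 // exprS OM. Qed.

Lemma Osum (I : Type) (r : seq I) (Q : pred I) (f : I -> F) :
  (forall j, Q j -> f j \in O) -> \sum_(j <- r | Q j) f j \in O.
Proof. by move=> fO; elim/big_ind: _ => //; [exact: O0|exact: OD]. Qed.

Lemma Oprod (I : Type) (r : seq I) (Q : pred I) (f : I -> F) :
  (forall j, Q j -> f j \in O) -> \prod_(j <- r | Q j) f j \in O.
Proof. by move=> fO; elim/big_ind: _ => //; [exact: O1|exact: OM]. Qed.

Lemma O_le x y : y \in O -> `|x| <= y -> x \in O.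
Proof.
by move=> Oy; rewrite ler_norml => /andP[h1 h2]; apply: (O_convex (ON Oy) Oy).
Qed.

Lemma O_norm x : (`|x| \in O) = (x \in O).
Proof.
apply/idP/idP => h; first exact: O_le h (lexx _).
by case: (ger0P x) => // _; apply: ON.
Qed.

(** |x| <= 1 + x^2, and O is convex. *)
Lemma O_sqr x : x ^+ 2 \in O -> x \in O.
Proof.
move=> Ox; apply: (O_le (OD O1 Ox)); rewrite -[x ^+ 2]real_normK ?num_real //.
have := sqr_ge0 (`|x| - 1); have := normr_ge0 x; rewrite !expr2; lra.
Qed.

Section Integral.
Variable n : nat.
Notation integral := (@integral_mx F O n).
Implicit Types x y : 'M[F]_n.

Lemma integral1 : integral 1%:M.
Proof. by move=> i j; rewrite mxE; case: eqP => _; rewrite ?O1 ?O0. Qed.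

Lemma integralM x y : integral x -> integral y -> integral (x *m y).
Proof. by move=> Ox Oy i j; rewrite mxE; apply: Osum => k _; apply: OM. Qed.

Lemma integral_tr x : integral x -> integral x^T.
Proof. by move=> Ox i j; rewrite mxE. Qed.

Lemma integral_det m (x : 'M[F]_m) : integral_mx O x -> \det x \in O.
Proof.
move=> Ox; apply: Osum => s _; apply: OM; first by apply: OX; apply: ON; exact: O1.
exact: Oprod.
Qed.

Lemma integral_inv x : \det x = 1 -> integral x -> integral (invmx x).
Proof.
move=> dx Ox; rewrite /invmx unitmxE dx unitr1 invr1 scale1r => i j.
rewrite mxE /cofactor; apply: OM; first by apply: OX; apply: ON; exact: O1.
by apply: integral_det => k l; rewrite !mxE.
Qed.

Lemma integral_orthogonal x : x *m x^T = 1%:M -> integral x.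
Proof. by move=> xx i j; apply: (O_le O1); apply: orthogonal_entry. Qed.

Lemma integral_gram x : integral (x *m x^T) -> integral x.
Proof.
move=> Oxx i j; apply: O_sqr; apply: (O_le (Oxx i i)).
rewrite ger0_norm ?sqr_ge0 // mxE (bigD1 j) //= mxE -expr2 lerDl.
by apply: sumr_ge0 => k _; rewrite mxE -expr2 sqr_ge0.
Qed.

Variables (K : rcfType) (R : realType) (iR : {rmorphism K -> R}) (iF : {rmorphism K -> F}).

(** The embedding in R bounds c by a natural number. This bound is an inequality in K, so it holds
    in F, and O contains the naturals. *)
Lemma O_base c : iF c \in O.
Proof.
have ON' m : (m%:R : F) \in O.
  by elim: m => [|m IHm]; rewrite ?mulr0n ?O0 // -natr1 OD ?O1.
apply: (O_le (ON' (Num.bound `|iR c|))); rewrite ler_norml.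
have : `|iR c| <= (Num.bound `|iR c|)%:R by apply/ltW/archi_boundP.
rewrite ler_norml; set m := Num.bound _ => /andP[h1 h2].
have e1 : 0 <= c + m%:R by rewrite -(rcf_morph_ge0 iR) rmorphD rmorph_nat -lerBlDr sub0r.
have e2 : 0 <= m%:R - c by rewrite -(rcf_morph_ge0 iR) rmorphB rmorph_nat subr_ge0.
move: e1 e2; rewrite -!(rcf_morph_ge0 iF) rmorphD rmorphB rmorph_nat subr_ge0 => e1 ->.
by rewrite andbT -sub0r lerBlDr.
Qed.

Lemma integral_map (M : 'M[K]_n) : integral (map_mx iF M).
Proof. by move=> i j; rewrite mxE O_base. Qed.

Lemma O_mxeval (p : mxpoly K n) x : integral x -> mxeval iF p x \in O.
Proof.
move=> Ox; apply: (@mxeval_ind K n F iF unit (fun=> x) (fun f => f tt \in O)).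
- by move=> c; apply: O_base.
- by move=> k l; apply: Ox.
- by move=> f f'; apply: OD.
- by move=> f f'; apply: OM.
Qed.

Lemma integral_coords (P : 'M[K]_n) x : P \in unitmx ->
  integral (coords P iF x) <-> integral x.
Proof.
move=> PU; split=> Ox; last by do !apply: integralM => //; apply: integral_map.
by rewrite -(coordsK PU iF x); do !apply: integralM => //; apply: integral_map.
Qed.

End Integral.
End ConvexSubring.

Section Building.
Variables (K : rcfType) (R : realType) (F : rcfType).
Variables (iR : {rmorphism K -> R}) (iF : {rmorphism K -> F}) (n : nat).
Variables (P : 'M[K]_n) (G S : set (mxpoly K n)) (g a : {vspace 'M[R]_n}).
Hypothesis HS : torus_setting iR P G S g a.
Variable Delta : seq (dual a).
Hypothesis Delta_basis : root_basis g Delta.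
Variable H0 : subvs_of a.
Hypothesis H0E : forall al, al \in Delta -> al H0 = 1.
Variable chi : dual a -> mxpoly K n.
Hypothesis chi_roots : root_characters iR S g chi.
Variable O : {pred F}.
Hypothesis O_subring : GRing.subring_closed O.
Hypothesis O_convex : order_convex O.
Hypothesis O_proper : exists x : F, x \notin O.
Let PU : P \in unitmx := basis_unit HS.
Let Sgrp : mx_group (geom_points S). Proof. by case: (S_max HS) => -[]. Qed.
Let Ggrp := G_group HS.
Notation higher := (height_rel iR P H0).
Notation parabolic := (parabolic_rel iR P H0).
Notation root_rel := (root_rel iR P).
Notation Apart := (positive_part P S iF).
Notation wt := (weight P iF).
Notation integral := (@integral_mx F O n).
Notation GF := (points iF G).
Implicit Types (x y h b u m : 'M[F]_n).

Lemma G_det1 x : GF x -> \det x = 1.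
Proof. exact: (geom_points_det1 (G_det HS)). Qed.

Lemma G_unit x : GF x -> x \in unitmx.
Proof. exact: (geom_points_unit Ggrp). Qed.

Lemma A_G b : Apart b -> GF b. Proof. exact: (positive_part_G HS). Qed.

Lemma A_inv b : Apart b -> Apart (invmx b).
Proof. exact: (positive_partV PU Sgrp (torus_diag HS)). Qed.

Lemma A_weight_inv b k : Apart b -> wt (invmx b) k = (wt b k)^-1.
Proof.
move=> Ab; have [Sb b0] := Ab; have [SVb _] := A_inv Ab.
apply: (mulfI (lt0r_neq0 (b0 k))).
rewrite -(weightM PU (torus_diag HS)) // mulmxV ?weight1 // ?mulfV ?lt0r_neq0 //.
exact/G_unit/A_G.
Qed.

Lemma integral_A b : Apart b -> (forall k, wt b k \in O) -> integral b.
Proof.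
move=> [Sb _] Ob; have bd := torus_diag HS Sb.
apply/(integral_coords O_subring O_convex iR iF b PU) => k l.
have [->|kl] := eqVneq k l; first exact: Ob.
by rewrite [coords P iF b k l]bd // O0.
Qed.

Lemma chi_integral_A b : Apart b -> integral b -> forall al, Defs.roots g al ->
  mxeval iF (chi al) b \in O /\ (mxeval iF (chi al) b)^-1 \in O.
Proof.
move=> Ab Ob al ral; split; first exact: (O_mxeval O_subring O_convex iR).
rewrite -(chiV HS chi_roots) //; apply: (O_mxeval O_subring O_convex iR).
exact/(integral_inv O_subring)/Ob/G_det1/A_G.
Qed.

Lemma N_F_ge1 b al : Apart b -> Defs.roots g al ->
  1 <= Num.max (mxeval iF (chi al) b) (mxeval iF (chi al) b)^-1.
Proof.
move=> Ab ral; have c0 := chi_gt0 HS chi_roots ral Ab; rewrite le_max.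
by have [//|c1] := leP 1 (mxeval iF (chi al) b); rewrite invf_ge1 // ltW ?orbT.
Qed.

(** N dominates all characters, hence its powers dominate the weights. Conversely the characters of
    b b are the squares of those of b, and O contains x with x^2. The product b b appears because it
    is the point b.Id. *)
Lemma N_F_integral b : Apart b ->
  (forall be, be \in Delta -> 1 <= mxeval iF (chi be) b) ->
  1 <= N_F iF g chi b /\ (N_F iF g chi b \in O <-> integral (b *m b)).
Proof.
move=> Ab bD; have fin := finite_roots HS; have [rD _ _] := Delta_basis.
have NE : N_F iF g chi b = \prod_(al <- fset_set (Defs.roots g (a := a)))
    Num.max (mxeval iF (chi al) b) (mxeval iF (chi al) b)^-1.
  by rewrite /N_F fsbig_finite.
have inR al : al \in fset_set (Defs.roots g (a := a)) -> Defs.roots g al.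
  by rewrite in_fset_set // inE.
have N1 : 1 <= N_F iF g chi b.
  rewrite NE big_seq; elim/big_ind: _ => // [x y x1 y1|al /inR ral]; last exact: N_F_ge1.
  by apply: mulr_ege1.
split=> //; have c0 al : Defs.roots g al -> 0 < mxeval iF (chi al) b.
  by move=> ral; apply: (chi_gt0 HS chi_roots ral Ab).
have Abb : Apart (b *m b) by apply: (positive_partM PU Sgrp (torus_diag HS)).
split=> [ON|Obb].
  have bound al : Defs.roots g al -> mxeval iF (chi al) b <= N_F iF g chi b.
    move=> ral; rewrite NE (big_rem al) /=; last by rewrite in_fset_set // inE.
    rewrite -[X in X <= _]mulr1; apply: ler_pM; [exact/ltW/c0|exact: ler01|by rewrite le_max lexx|].
    rewrite big_seq; elim/big_ind: _ => // [x y x1 y1|be]; first exact: mulr_ege1.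
    by move=> /mem_rem/inR; apply: N_F_ge1.
  have Ob : integral b.
    apply: integral_A => // k; have [M /(_ _ iF b (N_F iF g chi b) Ab N1)h] :=
      chi_weight_bound HS Delta_basis chi_roots k.
    apply: (O_le O_subring O_convex (OX O_subring M ON)).
    have [_ b0] := Ab; rewrite gtr0_norm // h // => be beD.
    split; first exact/bound/rD.
    by apply: mulr_ege1; rewrite ?bD.
  exact: integralM.
rewrite NE big_seq; apply: (Oprod O_subring) => al /inR ral.
have [] := chi_integral_A Abb Obb ral; have [Sb _] := Ab.
rewrite (chiM chi_roots) // -expr2 -exprVn => /(O_sqr O_subring O_convex) h1.
move=> /(O_sqr O_subring O_convex) h2.
by rewrite /Num.max; case: ifP.
Qed.

Lemma split_componentFE : A_F iF S = [set b | Apart b].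
Proof. exact: (split_componentE HS). Qed.

Lemma K_FP k : K_F iF G k <-> GF k /\ k *m k^T = 1%:M.
Proof.
split=> [[Gk [kk _]]|[Gk kk]]; first by split.
by split=> //; split=> //; apply: G_det1.
Qed.

(** If [b] is the Weyl vector from Id to y, then y is conjugate to b b by an orthogonal matrix. Its
    entries are bounded by 1, so conjugation by it preserves integrality. *)
Lemma dist_integral y : X_F iF G y ->
  dist iF O G S g Delta chi 1%:M y = Lambda0 O <-> integral y.
Proof.
move=> [h Gh <-]; rewrite /dist /delta_F; set D := [set b | _].
have Dex : exists b, D b.
  have [k1 [b [k2 [Kk1 Kk2 Ab bD hE]]]] :=
    cartan_decomposition HS Delta_basis H0E chi_roots Gh.
  exists b; split; first by split=> //; rewrite split_componentFE.
  exists 1%:M, h; split=> //; first exact: (geom_points1 Ggrp).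
    by rewrite trmx1 mulmx1.
  rewrite invmx1 mul1mx hE.
  exists (k1 *m b); last by exists k2 => //; apply/K_FP.
  by exists k1; [apply/K_FP|exists b].
have := xgetPex 1%:M Dex; move: (xget _ _) => b [[]]; rewrite split_componentFE => /= Ab bD.
move=> [h1 [h2 [Gh1 Gh2 e1 e2]]] [_ [k1 /K_FP[Gk1 kk1] [_ -> <-]] [k2 /K_FP[Gk2 kk2] hE]].
have [N1 NO] := N_F_integral Ab bD.
have Nn0 : N_F iF g chi b != 0 by rewrite lt0r_neq0 // (lt_le_trans ltr01).
have NV : (N_F iF g chi b)^-1 \in O.
  apply: (O_le O_subring O_convex (O1 O_subring)).
  by rewrite ger0_norm ?invr_ge0 ?(le_trans ler01) // invf_le1 // (lt_le_trans ltr01).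
have bT := positive_part_tr HS Ab.
have [kk kkE] : exists kk, kk = h1 *m k1 by eexists.
have kkT : kk *m kk^T = 1%:M.
  by rewrite kkE trmx_mul !mulmxA -(mulmxA h1) kk1 mulmx1 -e1.
have kkT' : kk^T *m kk = 1%:M by apply: mulmx1C.
have yE : h *m h^T = kk *m (b *m b) *m kk^T.
  have h2E : h2 = h1 *m (k1 *m b *m k2) by rewrite hE mulKVmx // G_unit.
  rewrite e2 h2E kkE !trmx_mul bT !mulmxA.
  by rewrite -(mulmxA _ k2) kk2 mulmx1.
have bbE : b *m b = kk^T *m (h *m h^T) *m kk.
  by rewrite yE !mulmxA kkT' mul1mx -!mulmxA kkT' mulmx1.
have Okk : integral kk by apply: (integral_orthogonal O_subring O_convex).
have Okk' := integral_tr Okk.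
(* As N >= 1, its inverse is in O; so N is a unit of O exactly when it lies in O. *)
transitivity (N_F iF g chi b \in O); last first.
  rewrite NO; split=> Ob; last first.
    by rewrite bbE; apply: integralM => //; apply: integralM.
  by rewrite yE; apply: integralM => //; apply: integralM.
rewrite /oppval /Lambda0 /valuation; split=> [E|ON].
  have : [set 1 * u | u in integral_units O] 1.
    by exists 1; rewrite ?mulr1 //; split; rewrite ?oner_neq0 ?invr1 ?O1.
  by rewrite -E => -[u [_ Ou _] e]; rewrite -[N_F _ _ _ _]mulr1 -e mulVKf.
have V0 : (N_F iF g chi b)^-1 != 0 by rewrite invr_eq0.
apply/seteqP; split=> _ [u [u0 Ou OVu] <-]; last first.
  exists (N_F iF g chi b * u); last by rewrite mulKf // mul1r.
  by split; rewrite ?mulf_neq0 ?invfM ?OM.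
exists ((N_F iF g chi b)^-1 * u); last by rewrite mul1r.
by split; rewrite ?mulf_neq0 ?invfM ?invrK ?OM.
Qed.

Lemma building_oE : building_o iF O G S g Delta chi = X_F iF G `&` [set y | integral y].
Proof.
apply/seteqP; split=> y [Xy yP]; split=> //.
  by apply/(dist_integral Xy).
by apply/(dist_integral Xy).
Qed.

Lemma building_actM x y c : building_act x (building_act y c) = building_act (x *m y) c.
Proof.
apply/seteqP; split=> t /=.
  by move=> [w [z cz wE] <-]; exists z; rewrite // -wE trmx_mul !mulmxA.
move=> [z cz <-]; exists (y *m z *m y^T); first by exists z.
by rewrite trmx_mul !mulmxA.
Qed.

Lemma building_act1 c : building_act (1%:M : 'M[F]_n) c = c.
Proof.
apply/seteqP; split=> [_ [z cz <-]|z cz]; first by rewrite mul1mx trmx1 mulmx1.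
by exists z => //; rewrite mul1mx trmx1 mulmx1.
Qed.

Notation o := (building_o iF O G S g Delta chi).

Lemma building_act_o h : GF h -> building_act h o = o <-> integral h.
Proof.
move=> Gh; rewrite building_oE; split=> [E|Oh].
  apply: (integral_gram O_subring O_convex).
  have : (X_F iF G `&` [set y | integral y]) (h *m 1%:M *m h^T).
    rewrite -E; exists 1%:M => //; split; last exact: integral1.
    by exists 1%:M; [exact: (geom_points1 Ggrp)|rewrite trmx1 mulmx1].
  by rewrite mulmx1 => -[].
have act k : GF k -> integral k -> forall y, (X_F iF G `&` [set y | integral y]) y ->
    (X_F iF G `&` [set y | integral y]) (k *m y *m k^T).
  move=> Gk Ok _ [[x Gx <-] Ox]; split.
    exists (k *m x); first exact: (geom_points_mul Ggrp).
    by rewrite trmx_mul !mulmxA.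
  by apply: integralM => //; [apply: integralM|apply: integral_tr].
apply/seteqP; split=> [_ [y oy <-]|y oy]; first exact: act.
have hU := G_unit Gh; exists (invmx h *m y *m (invmx h)^T).
  apply: act => //; first exact: (geom_points_inv Ggrp).
  exact: (integral_inv O_subring (G_det1 Gh)).
by rewrite trmx_inv !mulmxA mulmxV // mul1mx mulmxKV // unitmx_tr.
Qed.

Definition in_chamber b :=
  Apart b /\ forall al, pos_roots g Delta al -> (mxeval iF (chi al) b)^-1 \in O.

Lemma Lambda_le0 c : c != 0 -> Lambda_le O (Lambda0 O) (oppval O c) <-> c^-1 \in O.
Proof.
move=> c0; have V1 d : valuation O d d.
  by exists 1; rewrite ?mulr1 //; split; rewrite ?oner_neq0 ?invr1 ?O1.
split=> [[x [y [x0 y0 E1 E2 yx]]]|Oc]; last first.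
  by exists 1, c^-1; split; rewrite ?oner_neq0 ?invr_eq0 // divr1.
have [u [_ Ou _] e1] : valuation O 1 x by rewrite -[valuation O 1]/(Lambda0 O) E1.
have [u' [_ Ou' _] e2] : valuation O y c^-1 by rewrite -E2; apply: (V1 c^-1).
rewrite -e2 -[y](divfK x0) -e1 mul1r; rewrite -e1 mul1r in yx.
by apply: (OM O_subring) => //; apply: (OM O_subring).
Qed.

Lemma Weyl_chamber0E : Weyl_chamber0 iF O G S g Delta chi =
  [set building_act b o | b in in_chamber].
Proof.
rewrite /Weyl_chamber0 split_componentFE; congr (image _ _).
apply/seteqP; split=> b [Ab bP]; split=> // al pal; have [ral _] := pal.
  by apply/Lambda_le0; [apply/lt0r_neq0/(chi_gt0 HS chi_roots ral Ab)|apply: bP].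
by apply/Lambda_le0; [apply/lt0r_neq0/(chi_gt0 HS chi_roots ral Ab)|apply: bP].
Qed.

Lemma stabilizerE h : pointwise_stabilizer iF G (Weyl_chamber0 iF O G S g Delta chi) h <->
  GF h /\ forall b, in_chamber b -> integral (invmx b *m h *m b).
Proof.
have act b : GF h -> in_chamber b ->
    building_act h (building_act b o) = building_act b o <-> integral (invmx b *m h *m b).
  move=> Gh [/A_G Gb _]; have bU := G_unit Gb.
  rewrite -building_act_o; last first.
    by do !apply: (geom_points_mul Ggrp) => //; apply: (geom_points_inv Ggrp).
  rewrite building_actM; split=> [E|E].
    by rewrite -mulmxA -building_actM E building_actM mulVmx // building_act1.
  by rewrite -{2}E building_actM !mulmxA mulmxV // mul1mx.
rewrite Weyl_chamber0E; split=> [[Gh hP]|[Gh hP]]; split=> //.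
  by move=> b Cb; apply/act => //; apply: hP; exists b.
by move=> _ [b Cb <-]; apply/act => //; apply: hP.
Qed.

Lemma stabilizer_parabolic h : GF h ->
  (forall b, in_chamber b -> integral (invmx b *m h *m b)) -> coords_in P parabolic iF h.
Proof.
move=> Gh hP k l hkl; apply/negPn/negP => npar; have [T0 /negP] := O_proper; apply.
set c := coords P iF h k l in hkl.
(* With this constant, the (k, l) coordinate of b^-1 h b, of absolute value |c| w_l / w_k, exceeds
   the absolute value of an element outside O. *)
have [b [Ab bD bT]] := chamber_unbounded HS Delta_basis H0E chi_roots npar iF (`|T0| / `|c|).
have [_ b0] := Ab.
have Cb : in_chamber b.
  split=> // al pal; have c1 := chi_dominant HS Delta_basis chi_roots pal Ab bD.
  apply: (O_le O_subring O_convex (O1 O_subring)).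
  by rewrite ger0_norm ?invr_ge0 ?(le_trans ler01) // invf_le1 // (lt_le_trans ltr01).
have [Sb _] := Ab; have [SVb _] := A_inv Ab.
have /(integral_coords O_subring O_convex iR iF _ PU)/(_ k l) := hP b Cb.
rewrite (coords_diag_mulr PU _ _ _ (torus_diag HS Sb)).
rewrite (coords_diag_mull PU _ _ _ (torus_diag HS SVb)) A_weight_inv // -/c => Oe.
rewrite -(O_norm O_subring O_convex) in Oe.
apply: (O_le O_subring O_convex Oe).
rewrite !normrM normfV (gtr0_norm (b0 k)) (gtr0_norm (b0 l)).
have c0 : 0 < `|c| by rewrite normr_gt0.
have -> : (wt b k)^-1 * `|c| * wt b l = (wt b l / wt b k) * `|c| by ring.
by rewrite -ler_pdivrMr // ler_pdivlMr.
Qed.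

Lemma unipotent_FE u : U_F iR iF g Delta u <->
  exists2 X, nilpotent_part P G higher iF X & u = expmx_nilpotent X.
Proof.
rewrite /U_F (pos_root_sum_FE HS Delta_basis H0E).
by split=> [[X NX <-]|[X NX ->]]; exists X.
Qed.

Lemma M_FP m : M_F iF G S m <->
  (GF m /\ m *m m^T = 1%:M) /\ forall b, Apart b -> m *m b = b *m m.
Proof.
rewrite /M_F split_componentFE; split=> [[/K_FP Km mA]|[Km mA]]; split=> //.
exact/K_FP.
Qed.

Lemma unipotent_diag X k : coords_in P higher iF X ->
  coords P iF (expmx_nilpotent X) k k = 1.
Proof.
move=> Xc; have n0 : (0 < n)%N by apply: leq_ltn_trans (ltn_ord k).
rewrite /expmx_nilpotent coords_sum summxE (bigD1 (Ordinal n0)) //= big1 ?addr0.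
  by rewrite coordsZ expr0 coords1 // !mxE eqxx invr1 mulr1.
move=> [[|j] jn] // _; rewrite coordsZ mxE exprS -mulmxE.
have : coords_in P higher iF (X *m X ^+ j).
  pose le_rel : rel 'I_n := fun k l => weight P iR (vsval H0) l <= weight P iR (vsval H0) k.
  apply: (coords_inM PU (c := higher) (d := le_rel)) (Xc) _.
    by move=> k' l m kl lm; apply: le_lt_trans lm kl.
  apply: (coords_inX PU) => [k'|l k' m kl lm|]; first exact: lexx.
    exact: le_trans lm kl.
  by apply: coords_in_sub Xc => k' l; apply: ltW.
move=> /(_ k k); rewrite /height_rel ltxx.
by case: eqVneq => [->|_ /(_ isT)//]; rewrite mulr0.
Qed.

(** The orthogonal m can be cancelled. In the eigenbasis the diagonal of u b consists of the weights
    of b, because u is unipotent; so b is integral, then u. *)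
Lemma factors_integral X b m : nilpotent_part P G higher iF X -> Apart b ->
  m *m m^T = 1%:M -> integral (expmx_nilpotent X *m b *m m) ->
  integral (expmx_nilpotent X) /\ integral b.
Proof.
move=> [Xc _] Ab mm; set u := expmx_nilpotent X => Oh.
have Oub : integral (u *m b).
  rewrite -[u *m b]mulmx1 -mm mulmxA; apply: integralM => //.
  exact/integral_tr/(integral_orthogonal O_subring O_convex).
have [Sb _] := Ab.
have Ob : integral b.
  apply: integral_A => // k.
  have /(integral_coords O_subring O_convex iR iF _ PU)/(_ k k) := Oub.
  by rewrite (coords_diag_mulr PU _ _ _ (torus_diag HS Sb)) unipotent_diag // mul1r.
split=> //; rewrite -[u](mulmxK (G_unit (A_G Ab))).
by apply: integralM => //; apply: (integral_inv O_subring (G_det1 (A_G Ab))).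
Qed.

(** At a nonzero coordinate of X, the ratio w_l / w_k is the inverse of a positive root character,
    which is in O on the chamber. This is a reflexive and transitive condition on (k, l), so the
    coordinates of exp X satisfy it too. *)
Lemma nilpotent_chamber X b : nilpotent_part P G higher iF X -> in_chamber b ->
  integral (expmx_nilpotent X) -> integral (invmx b *m expmx_nilpotent X *m b).
Proof.
move=> NX [Ab bC] Ou; have [Sb b0] := Ab; have [SVb _] := A_inv Ab.
pose c : rel 'I_n := fun k l => wt b l / wt b k \in O.
have Xc : coords_in P c iF X.
  move=> k l Xkl; have [al pal kl] : exists2 al, pos_roots g Delta al & root_rel al k l.
    apply: contrapT => no; move/eqP: Xkl; apply.
    exact: (nilpotent_part_no_root HS Delta_basis H0E no NX).
  have [ral _] := pal; rewrite /c (chi_weight HS chi_roots ral kl Ab) invfM mulrCA.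
  by rewrite mulfV ?mulr1; [exact: bC|exact: lt0r_neq0].
have uc : coords_in P c iF (expmx_nilpotent X).
  apply: (coords_in_sum (P := P)) => j; apply/coords_inZ/(coords_inX PU) => //.
    by move=> k; rewrite /c mulfV ?O1 // lt0r_neq0.
  move=> l k m kl lm; rewrite /c.
  have -> : wt b m / wt b k = wt b m / wt b l * (wt b l / wt b k).
    by rewrite mulrA divfK // lt0r_neq0.
  exact: OM.
apply/(integral_coords O_subring O_convex iR iF _ PU) => k l.
rewrite (coords_diag_mulr PU _ _ _ (torus_diag HS Sb)).
rewrite (coords_diag_mull PU _ _ _ (torus_diag HS SVb)) A_weight_inv //.
have [->|/uc kl] := eqVneq (coords P iF (expmx_nilpotent X) k l) 0.
  by rewrite mulr0 mul0r O0.
rewrite mulrAC mulrC [_^-1 * _]mulrC; apply: OM => //.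
by move: Ou => /(integral_coords O_subring O_convex iR iF _ PU); apply.
Qed.

Lemma pointwise_stabilizer_factorization :
  pointwise_stabilizer iF G (Weyl_chamber0 iF O G S g Delta chi) =
    B_F iR iF G S g Delta `&` integral /\
  B_F iR iF G S g Delta `&` integral =
    mxset_mul (mxset_mul (U_F iR iF g Delta `&` integral) (A_F iF S `&` integral))
      (M_F iF G S).
Proof.
have A1 : Apart 1%:M by apply: (positive_part1 PU Sgrp).
split; apply/seteqP; split=> h.
- move=> /stabilizerE[Gh hP].
  have [X [b [m [NX Ab Km mA hE]]]] :=
    parabolic_decomposition HS Gh (stabilizer_parabolic Gh hP).
  split.
    exists (expmx_nilpotent X *m b); last by exists m => //; apply/M_FP.
    exists (expmx_nilpotent X); first by apply/unipotent_FE; exists X.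
    by exists b => //; rewrite split_componentFE.
  have := hP 1%:M; rewrite mulmx1 invmx1 mul1mx; apply; split=> // al [ral _].
  by rewrite (chi1 chi_roots) // invr1 O1.
- move=> [[_ [_ /unipotent_FE[X NX ->] [b Ab <-]] [m /M_FP[[Gm mm] mA] hE]] Oh].
  rewrite split_componentFE /= in Ab.
  rewrite -hE in Oh *; have [Ou Ob] := factors_integral NX Ab mm Oh.
  have GX : GF (expmx_nilpotent X) by case: (NX) => _ /(_ 1); rewrite scale1r.
  apply/stabilizerE; split.
    by do !apply: (geom_points_mul Ggrp) => //; apply: A_G.
  move=> b' Cb'; have [Ab' _] := Cb'; have b'U := G_unit (A_G Ab').
  (* b' commutes with m and with b, so it can be moved next to the unipotent factor. *)
  have -> : invmx b' *m (expmx_nilpotent X *m b *m m) *m b' =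
      (invmx b' *m expmx_nilpotent X *m b') *m b *m m.
    have [Sb _] := Ab; have [Sb' _] := Ab'.
    rewrite -!mulmxA mA // !mulmxA; congr (_ *m _).
    by rewrite -!mulmxA (positive_part_comm PU (torus_diag HS) Sb Sb').
  apply: integralM => //; last exact: (integral_orthogonal O_subring O_convex).
  by apply: integralM => //; apply: nilpotent_chamber.
- move=> [[_ [u Uu [b Ab <-]] [m Mm hE]] Oh].
  have /unipotent_FE[X NX uE] := Uu; have /M_FP[[_ mm] _] := Mm.
  have Ab' := Ab; rewrite split_componentFE /= in Ab'.
  have [Ou Ob] : integral u /\ integral b.
    by rewrite uE; apply: (factors_integral NX Ab' mm); rewrite -uE hE.
  by exists (u *m b); [exists u => //; exists b|exists m].
move=> [_ [u [Uu Ou] [b [Ab Ob] <-]] [m Mm <-]]; split.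
  by exists (u *m b); [exists u => //; exists b|exists m].
have /M_FP[[_ mm] _] := Mm.
apply: integralM => //; first exact: integralM.
exact: (integral_orthogonal O_subring O_convex).
Qed.

End Building.

Theorem theorem5p17 (K : rcfType) (R : realType) (F : rcfType)
  (iR : {rmorphism K -> R}) (iF : {rmorphism K -> F})
  (O : {pred F}) (n : nat) (G S : set (mxpoly K n))
  (g a : {vspace 'M[R]_n}) (Delta : seq (dual a))
  (chi : dual a -> mxpoly K n)
  (O_subring : GRing.subring_closed O)
  (O_convex : order_convex O)
  (O_proper : exists x : F, x \notin O)
  (G_semisimple : connected_semisimple_subgroup_of_SL G)
  (G_self_adjoint : self_adjoint G)
  (S_maximal : maximal_split_torus G S)
  (S_symmetric : forall s, geom_points S s -> s = s^T)
  (g_Lie : is_Lie_algebra (points iR G) g)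
  (a_Lie : is_Lie_algebra (split_component iR S) a)
  (chi_roots : root_characters iR S g chi)
  (Delta_basis : root_basis g Delta) :
  let U := U_F iR iF g Delta in
  let A := A_F iF S in
  let M := M_F iF G S in
  let B := B_F iR iF G S g Delta in
  let C0 := Weyl_chamber0 iF O G S g Delta chi in
  let integral := integral_mx O (n := n) in
  pointwise_stabilizer iF G C0 = B `&` integral /\
  B `&` integral = mxset_mul (mxset_mul (U `&` integral) (A `&` integral)) M.
Proof.
have [Ggrp Gdet _ _] := G_semisimple.
have [[_ _ [P PU SP]] _ _] := S_maximal.
have HS : torus_setting iR P G S g a.
  split=> // s Ss k l kl; rewrite map_invmx.
  by move: (SP s Ss) => /is_diag_mxP; apply.
have [H0 H0E] := dual_basis_point Delta_basis.
exact: (pointwise_stabilizer_factorization iF HS Delta_basis H0E chi_roots).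
Qed.
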